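(* Let $n\ge2$, let $\Gamma$ be the star graph with $n$ edges $e_j=[0,\infty)$ joined at a single vertex, and let $V$ be a real-valued function on $\Gamma$ with restrictions $V_j=V|_{e_j}$ satisfying $\int_{e_j}|V_j(x)|\,dx<\infty$ for all $1\le j\le n$. Let $H$ be the Schr\''odinger operator $H\psi=-\psi''+V\psi$ on $L_2(\Gamma)$ with Kirchhoff vertex condition, and $H_0$ the same operator with $V\equiv0$. Then for $z\in\rho(H)$ the perturbation determinant $D(z)$ of $H$ with respect to $H_0$ is given by $$ D(z)=\frac{K(z^{1/2})}{i\,n\,z^{1/2}}\prod_{j=1}^n w_j(z^{1/2}), $$ where $\operatorname{Im}z^{1/2}>0$.
   Context: $L_2(\Gamma)=\bigoplus_{j=1}^n L_2(e_j)$ and $\psi_j$ denotes the restriction of $\psi$ to $e_j$. The self-adjoint operator $H$ is defined through the closed quadratic form $h[\phi]=\int_\Gamma|\phi'|^2\,dx+\int_\Gamma V|\phi|^2\,dx$ with form domain $H^1(\Gamma)$, the set of continuous functions $\phi$ on $\Gamma$ (so $\phi_1(0)=\dots=\phi_n(0)$) with $\phi_j\in H^1(e_j)$ for every $j$. This corresponds to the vertex conditions $\psi_1(0)=\dots=\psi_n(0)$ and $\sum_{j=1}^n\psi_j'(0)=0$ (Kirchhoff). $H_0$ is defined in the same way with $V\equiv0$. $\rho(\cdot)$ denotes the resolvent set; $\rho(H)\subset\rho(H_0)=\mathbb{C}\setminus[0,\infty)$. (Modified) perturbation determinant: $D(z)=\det\left(\mathbf{1}+\sqrt{V}\,(H_0-z)^{-1}\sqrt{|V|}\right)$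 for $z\in\rho(H_0)$, a Fredholm determinant, where $\sqrt{V}:=(\operatorname{sgn}V)\sqrt{|V|}$. Jost solution: for $\operatorname{Im}\zeta\ge0$, $\zeta\neq0$, $\theta_j(x,\zeta)$ is the unique solution on $[0,\infty)$ of $-u''+V_ju=\zeta^2u$ with $\theta_j(x,\zeta)=e^{ix\zeta}(1+o(1))$ as $x\to\infty$; a prime denotes $d/dx$. Further $w_j(\zeta)=\theta_j(0,\zeta)$ and $K(\zeta)=\sum_{j=1}^n\theta_j'(0,\zeta)/\theta_j(0,\zeta)$; where some $w_j(\zeta)=0$, the product $K(\zeta)\prod_jw_j(\zeta)$ is understood as $\sum_j\theta_j'(0,\zeta)\prod_{k\ne j}\theta_k(0,\zeta)$. *)

(* Defs.v *)
From HB Require Import structures.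
From mathcomp Require Import all_boot all_order all_algebra.
From mathcomp Require Import all_classical all_reals all_analysis.
From mathcomp.real_closed Require Import complex.

Set Implicit Arguments.
Unset Strict Implicit.
Unset Printing Implicit Defensive.

Import Order.TTheory GRing.Theory Num.Theory.
Import numFieldNormedType.Exports.

Local Open Scope classical_set_scope.
Local Open Scope ring_scope.
Local Open Scope complex_scope.

(* The topology and the norm of the field R[i] *)
HB.instance Definition _ (R : realType) := NormedModule.copy R[i] R[i]^o.

(* Functions on the star graph are families 'I_n -> R -> R[i]; only the values
   on [0, +oo[ matter.  L_2 classes are represented by functions, so that
   equality in L_2 is equality almost everywhere. *)

Section HalfLine.
Context {R : realType}.
Implicit Types (D : set R) (u du : R -> R[i]).

Definition halfline : set R := `[0, +oo[.

Definition cmeasurable D u :=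
  measurable_fun D (fun x => complex.Re (u x)) /\
  measurable_fun D (fun x => complex.Im (u x)).

Definition cintegrable D u :=
  (@lebesgue_measure R).-integrable D (fun x => (complex.Re (u x))%:E) /\
  (@lebesgue_measure R).-integrable D (fun x => (complex.Im (u x))%:E).

Definition cint D u : R[i] :=
  (\int[@lebesgue_measure R]_(x in D) complex.Re (u x)) +i*
  (\int[@lebesgue_measure R]_(x in D) complex.Im (u x)).

Definition square_integrable u :=
  cmeasurable halfline u /\
  (@lebesgue_measure R).-integrable halfline
    (fun x => ((Normc.normc (u x)) ^+ 2)%:E).

(* u is locally absolutely continuous on [0, +oo[ and u' = du a.e.  When du is
   continuous, it is the derivative of u everywhere (one-sided at 0). *)
Definition ac_deriv u du :=
  forall b, 0 <= b -> cintegrable `[0, b] du /\ u b = u 0 + cint `[0, b] du.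

Definition cexp (w : R[i]) : R[i] :=
  (expR (complex.Re w) * cos (complex.Im w)) +i*
  (expR (complex.Re w) * sin (complex.Im w)).

(* theta solves - u'' + V u = zeta^2 u with theta(x) = e^(i x zeta) (1 + o(1)).
   For V in L_1 a solution is a u such that u and u' are locally absolutely
   continuous and the equation holds a.e.; dtheta is the derivative of theta. *)
Definition jost_solution (V : R -> R) (zeta : R[i]) (theta dtheta : R -> R[i]) :=
  [/\ ac_deriv theta dtheta,
      ac_deriv dtheta (fun x => ((V x)%:C - zeta ^+ 2) * theta x) &
      (fun x : R => theta x / cexp ((0 +i* 1) * x%:C * zeta)) x @[x --> +oo] --> (1 : R[i])].

End HalfLine.

Section StarGraph.
Context {R : realType} {n : nat}.
Local Notation starfun := ('I_n -> R -> R[i]).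
Implicit Types (V : 'I_n -> R -> R) (u v f g phi dphi psi dpsi : starfun).

Definition L2 u := forall j, square_integrable (u j).

Definition L2_eq u v :=
  forall j, ae_eq (@lebesgue_measure R) halfline (u j) (v j).

Definition inner u v : R[i] :=
  \sum_(j < n) cint halfline (fun x => conjc (u j x) * v j x).

Definition L2norm u : R := Num.sqrt (complex.Re (inner u u)).

(* phi belongs to H^1 of the star graph, and phi' = dphi a.e. *)
Definition H1 phi dphi :=
  [/\ L2 phi, L2 dphi, forall j, ac_deriv (phi j) (dphi j) &
      forall i j, phi i 0 = phi j 0].

(* The sesquilinear form (antilinear in phi) whose quadratic form is h. *)
Definition form V phi dphi psi dpsi : R[i] :=
  inner dphi dpsi +
  \sum_(j < n) cint halfline (fun x => (V j x)%:C * conjc (phi j x) * psi j x).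

(* Graph of the self-adjoint operator H associated with the form h: psi is in
   the domain of H and H psi = g. *)
Definition schrodinger V psi g :=
  L2 g /\ exists2 dpsi, H1 psi dpsi &
    forall phi dphi, H1 phi dphi -> form V phi dphi psi dpsi = inner phi g.

(* (H - z) psi = f *)
Definition resolvent V (z : R[i]) f psi :=
  schrodinger V psi (fun j x => f j x + z * psi j x).

Definition resolvent_set V (z : R[i]) :=
  (forall psi, resolvent V z (fun _ _ => 0) psi -> L2_eq psi (fun _ _ => 0)) /\
  exists M : R, forall f, L2 f ->
    exists2 psi, resolvent V z f psi & L2norm psi <= M * L2norm f.

Definition bounded_operator (T : starfun -> starfun) :=
  [/\ forall u, L2 u -> L2 (T u),
      forall (a : R[i]) u v, L2 u -> L2 v ->
        L2_eq (T (fun j x => a * u j x + v j x))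
              (fun j x => a * T u j x + T v j x) &
      exists M : R, forall u, L2 u -> L2norm (T u) <= M * L2norm u].

(* T = sum_k <f_k, .> g_k with sum_k |f_k| |g_k| < oo *)
Definition trace_class (T : starfun -> starfun) :=
  exists f g : nat -> starfun,
    [/\ forall k, L2 (f k) /\ L2 (g k),
        cvgn (series (fun k => L2norm (f k) * L2norm (g k))) &
        forall u, L2 u ->
          (fun N : nat => L2norm (fun j x =>
             T u j x - \sum_(k < N) inner (f k) u * g k j x)) @ \oo --> (0 : R)].

Definition orthonormal_basis (e : nat -> starfun) :=
  [/\ forall k, L2 (e k),
      forall k l, inner (e k) (e l) = (k == l)%:R &
      forall u, L2 u -> (forall k, inner (e k) u = 0) ->
        L2_eq u (fun _ _ => 0)].

(* d = det (1 + T).  The N-th determinant below is the sum of the principal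
   minors of (<e_k, T e_l>)_(k, l < N), i.e. a partial sum of
   det (1 + T) = sum_m Tr (Lambda^m T) computed in the basis e. *)
Definition fredholm_det (T : starfun -> starfun) (d : R[i]) :=
  trace_class T /\
  forall e, orthonormal_basis e ->
    (fun N : nat => \det (\matrix_(k < N, l < N)
       ((k == l)%:R + inner (e k) (T (e l))))) @ \oo --> (d : R[i]).

Definition mul_sqrt_abs V u : starfun :=
  fun j x => (Num.sqrt `|V j x|)%:C * u j x.

Definition mul_sqrt V u : starfun :=
  fun j x => (Num.sg (V j x) * Num.sqrt `|V j x|)%:C * u j x.

(* T is the bounded extension of sqrt V (H_0 - z)^-1 sqrt |V|, which is given on
   the (dense) domain of the possibly unbounded operator sqrt |V|. *)
Definition birman_schwinger V (z : R[i]) (T : starfun -> starfun) :=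
  bounded_operator T /\
  forall phi, L2 phi -> L2 (mul_sqrt_abs V phi) ->
    exists2 psi, resolvent (fun _ _ => 0) z (mul_sqrt_abs V phi) psi &
      L2_eq (T phi) (mul_sqrt V psi).

(* z is in the resolvent set of H_0 and D(z) = d *)
Definition perturbation_det V (z d : R[i]) :=
  resolvent_set (fun _ _ => 0) z /\
  exists2 T, birman_schwinger V z T & fredholm_det T d.

Definition jost_w (theta : starfun) (j : 'I_n) : R[i] := theta j 0.

Definition jost_K (theta dtheta : starfun) : R[i] :=
  \sum_(j < n) dtheta j 0 / theta j 0.

Definition jost_Kw (theta dtheta : starfun) : R[i] :=
  if [forall j, jost_w theta j != 0]
  then jost_K theta dtheta * \prod_(j < n) jost_w theta j
  else \sum_(j < n) dtheta j 0 * \prod_(k < n | k != j) theta k 0.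

End StarGraph.

(* Main.v *)
(* Put c = i zeta, so that Re c < 0, and E_c(x) = e^(c x).  Factoring
   -d^2/dx^2 + c^2 = -(d/dx - c)(d/dx + c) and integrating twice gives the resolvent of
   H_0 explicitly: with h_t(x) = 1_(t <= x) E_c(x - t), on each edge it maps f to
   int_0^oo (int h_t f) h_t dt, plus one rank-one term coupling the edges at the vertex.

   Replacing the integral over t by Riemann sums on dyadically refined grids
   of growing intervals [0, L_m] gives finite-rank approximations of the Birman-Schwinger
   operator.  Their successive differences have summable nuclear norms, which proves that
   the operator is trace class and, by continuity of the determinant for the nuclear
   norm, reduces D(z) to a limit of finite Gram determinants.

   For two nodes s, t of the same edge the Gram entry is E_c(-s) E_c(-t) W(max(s, t)) with
   W(t) = int_t^oo E_c(2 x) V(x) dx, so these determinants are semiseparable: together with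
   one bordered determinant they obey a two-term recursion along the edge.  That recursion
   is the Euler scheme of the system satisfied by E_c(-t) theta(t) and
   -E_c(t) (theta'(t) - c theta(t)); a discrete Gronwall inequality shows that it converges
   to theta_j(0) and -(theta_j'(0) - c theta_j(0)). *)
Require Import Defs.
From HB Require Import structures.
From mathcomp Require Import all_boot all_order all_algebra.
From mathcomp Require Import all_classical all_reals all_analysis.
From mathcomp Require Import measurable_realfun.
From mathcomp.real_closed Require Import complex.
From mathcomp Require Import ring lra.

Set Implicit Arguments.
Unset Strict Implicit.
Unset Printing Implicit Defensive.

Import Order.TTheory GRing.Theory Num.Theory.
Import numFieldNormedType.Exports.

Local Open Scope classical_set_scope.
Local Open Scope ring_scope.
Local Open Scope complex_scope.

Local Notation normc := Normc.normc.
Local Notation Re := complex.Re.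
Local Notation Im := complex.Im.

(** * Complex numbers and complex-valued integrals *)

Section ComplexNumbers.
Context {R : realType}.
Implicit Types (x y z : R[i]).

Lemma ReD x y : Re (x + y) = Re x + Re y. Proof. by case: x; case: y. Qed.
Lemma ImD x y : Im (x + y) = Im x + Im y. Proof. by case: x; case: y. Qed.
Lemma ReN x : Re (- x) = - Re x. Proof. by case: x. Qed.
Lemma ImN x : Im (- x) = - Im x. Proof. by case: x. Qed.
Lemma ReM x y : Re (x * y) = Re x * Re y - Im x * Im y.
Proof. by case: x; case: y. Qed.
Lemma ImM x y : Im (x * y) = Re x * Im y + Im x * Re y.
Proof. by case: x => a b; case: y. Qed.
Lemma ReJ x : Re (conjc x) = Re x. Proof. by case: x. Qed.
Lemma ImJ x : Im (conjc x) = - Im x. Proof. by case: x. Qed.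
Lemma ReC (a : R) : Re a%:C = a. Proof. by []. Qed.
Lemma ImC (a : R) : Im a%:C = 0. Proof. by []. Qed.
Definition ReImE := (ReD, ImD, ReN, ImN, ReM, ImM, ReJ, ImJ, ReC, ImC).

Lemma complexP x y : Re x = Re y -> Im x = Im y -> x = y.
Proof. by case: x => a b; case: y => c d /= -> ->. Qed.

Lemma normcE z : normc z = Num.sqrt (Re z ^+ 2 + Im z ^+ 2).
Proof. by case: z. Qed.
Lemma normc_ge0 z : 0 <= normc z. Proof. by rewrite normcE sqrtr_ge0. Qed.
Lemma sqr_normcE z : normc z ^+ 2 = Re z ^+ 2 + Im z ^+ 2.
Proof. by rewrite normcE sqr_sqrtr// addr_ge0 ?sqr_ge0. Qed.
Lemma normc_conj z : normc (conjc z) = normc z.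
Proof. by rewrite !normcE ReJ ImJ sqrrN. Qed.
Lemma normc_real (a : R) : normc a%:C = `|a|.
Proof. by rewrite normcE /= expr0n addr0 sqrtr_sqr. Qed.
Lemma Re_le_normc z : `|Re z| <= normc z.
Proof.
by rewrite normcE -sqrtr_sqr ler_wsqrtr// lerDl sqr_ge0.
Qed.
Lemma Im_le_normc z : `|Im z| <= normc z.
Proof.
by rewrite normcE -sqrtr_sqr ler_wsqrtr// lerDr sqr_ge0.
Qed.
Lemma normc_le_ReIm z : normc z <= `|Re z| + `|Im z|.
Proof.
rewrite -(ler_pXn2r (n := 2)) ?nnegrE ?normc_ge0 ?addr_ge0//.
rewrite sqr_normcE sqrrD !real_normK ?num_real// -addrA [_ *+ 2 + _]addrC addrA.
by rewrite lerDl mulrn_wge0// mulr_ge0.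
Qed.
Lemma normcD x y : normc (x + y) <= normc x + normc y.
Proof. exact: le_normcD. Qed.
Lemma normcB x y : normc (x - y) <= normc x + normc y.
Proof. by rewrite (le_trans (normcD _ _))// normcN. Qed.
Lemma normc_distC x y : normc (x - y) = normc (y - x).
Proof. by rewrite -opprB normcN. Qed.
Lemma normc_sum I (r : seq I) P (F : I -> R[i]) :
  normc (\sum_(i <- r | P i) F i) <= \sum_(i <- r | P i) normc (F i).
Proof.
elim/big_rec2 : _ => [|i y x _ h]; first by rewrite Normc.normc0.
by rewrite (le_trans (normcD _ _))// lerD2l.
Qed.
Lemma normc_prod I (r : seq I) P (F : I -> R[i]) :
  normc (\prod_(i <- r | P i) F i) = \prod_(i <- r | P i) normc (F i).
Proof.
elim/big_rec2 : _ => [|i y x _ <-]; first exact: Normc.normc1.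
exact: Normc.normcM.
Qed.
Lemma conjcM_normc z : conjc z * z = (normc z ^+ 2)%:C.
Proof. by apply: complexP; rewrite !ReImE ?sqr_normcE /=; ring. Qed.
Lemma normc_eq0 z : (normc z == 0) = (z == 0).
Proof.
apply/eqP/eqP => [|->]; first exact: Normc.eq0_normc.
exact: Normc.normc0.
Qed.
Lemma conjcD x y : conjc (x + y) = conjc x + conjc y.
Proof. exact: rmorphD. Qed.
Lemma conjcM x y : conjc (x * y) = conjc x * conjc y.
Proof. exact: rmorphM. Qed.

Lemma normr_normc z : `|z| = (normc z)%:C.
Proof. by case: z. Qed.

Lemma cvgCP (T : Type) (F : set_system T) (FF : Filter F) (f : T -> R[i]) (l : R[i]) :
  f @ F --> l <-> forall e : R, 0 < e -> \forall x \near F, normc (f x - l) < e.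
Proof.
split => [/cvgrPdist_lt h e e0|h].
  have /h : 0 < e%:C by rewrite ltcE /= eqxx.
  by apply: filterS => x; rewrite normr_normc ltcR normc_distC.
apply/cvgrPdist_lt => -[a b]; rewrite ltcE/= => /andP[/eqP-> a0].
apply: filterS (h _ a0) => x; rewrite normc_distC => hx.
by rewrite normr_normc ltcE /= eqxx.
Qed.

Lemma cvgC_normc (T : Type) (F : set_system T) (FF : Filter F) (f : T -> R[i]) (l : R[i]) :
  (fun t => normc (f t - l)) @ F --> (0 : R) <-> f @ F --> l.
Proof.
split => [/cvgrPdist_lt h|/cvgCP h].
  apply/cvgCP => e /h; apply: filterS => x.
  by rewrite sub0r normrN ger0_norm// normc_ge0.
apply/cvgrPdist_lt => e /h; apply: filterS => x.
by rewrite sub0r normrN ger0_norm// normc_ge0.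
Qed.

End ComplexNumbers.

Section ComplexIntegral.
Context {R : realType}.
Local Notation mu := (@lebesgue_measure R).
Implicit Types (D : set R) (u v : R -> R[i]).

Lemma measurable_normc D u : measurable D -> cmeasurable D u ->
  measurable_fun D (fun x => normc (u x)).
Proof.
move=> mD [mr mi].
under eq_fun do rewrite normcE.
have msqrt : measurable_fun setT (@Num.sqrt R).
  exact: continuous_measurable_fun (@sqrt_continuous R).
suff h : measurable_fun D (fun x => Re (u x) ^+ 2 + Im (u x) ^+ 2).
  exact: (measurableT_comp msqrt h).
by apply: measurable_funD; apply: measurable_funX.
Qed.

Lemma cmeasurableD D u v : measurable D -> cmeasurable D u -> cmeasurable D v ->
  cmeasurable D (fun x => u x + v x).
Proof.
move=> mD [a b] [c d]; split.
  by under eq_fun do rewrite ReD; exact: measurable_funD.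
by under eq_fun do rewrite ImD; exact: measurable_funD.
Qed.

Lemma cmeasurableN D u : measurable D -> cmeasurable D u ->
  cmeasurable D (fun x => - u x).
Proof.
move=> mD [a b]; split.
  by under eq_fun do rewrite ReN; exact: measurable_funN.
by under eq_fun do rewrite ImN; exact: measurable_funN.
Qed.

Lemma cmeasurableB D u v : measurable D -> cmeasurable D u -> cmeasurable D v ->
  cmeasurable D (fun x => u x - v x).
Proof. by move=> mD mu1 mv; apply: cmeasurableD => //; exact: cmeasurableN. Qed.

Lemma cmeasurableM D u v : measurable D -> cmeasurable D u -> cmeasurable D v ->
  cmeasurable D (fun x => u x * v x).
Proof.
move=> mD [a b] [c d]; split.
  under eq_fun do rewrite ReM.
  by apply: measurable_funB; exact: measurable_funM.
under eq_fun do rewrite ImM.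
by apply: measurable_funD; exact: measurable_funM.
Qed.

Lemma cmeasurable_conj D u : measurable D -> cmeasurable D u ->
  cmeasurable D (fun x => conjc (u x)).
Proof.
move=> mD [a b]; split.
  by under eq_fun do rewrite ReJ.
by under eq_fun do rewrite ImJ; exact: measurable_funN.
Qed.

Lemma cmeasurable_cst D (c : R[i]) : cmeasurable D (fun=> c).
Proof. by split; exact: measurable_cst. Qed.

Lemma cmeasurable_real D (f : R -> R) : measurable_fun D f ->
  cmeasurable D (fun x => (f x)%:C).
Proof. by move=> mf; split => //; exact: measurable_cst. Qed.

Lemma cmeasurable_sum D I (r : seq I) (F : I -> R -> R[i]) : measurable D ->
  (forall i, cmeasurable D (F i)) ->
  cmeasurable D (fun x => \sum_(i <- r) F i x).
Proof.
move=> mD h; elim: r => [|i r ih].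
  by under eq_fun do rewrite big_nil; exact: cmeasurable_cst.
by under eq_fun do rewrite big_cons; exact: cmeasurableD.
Qed.

Lemma cmeasurableS D1 D2 u : measurable D1 -> measurable D2 -> D2 `<=` D1 ->
  cmeasurable D1 u -> cmeasurable D2 u.
Proof. by move=> m1 m2 s [a b]; split; exact: (measurable_funS m1 s). Qed.

Lemma eq_cmeasurable D u v : (forall x, D x -> u x = v x) ->
  cmeasurable D u -> cmeasurable D v.
Proof.
move=> e [a b]; split.
  by apply: eq_measurable_fun a => x /set_mem /e ->.
by apply: eq_measurable_fun b => x /set_mem /e ->.
Qed.

Lemma cintegrableP D u : measurable D -> cintegrable D u <->
  cmeasurable D u /\ mu.-integrable D (fun x => (normc (u x))%:E).
Proof.
move=> mD; split => [[ir ii]|[[mr mi] inorm]].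
  have mr : measurable_fun D (fun x => Re (u x)).
    by apply/measurable_EFinP; exact: measurable_int ir.
  have mi : measurable_fun D (fun x => Im (u x)).
    by apply/measurable_EFinP; exact: measurable_int ii.
  split; first by [].
  apply: (@le_integrable _ _ _ mu D mD _
    (fun x => (`|Re (u x)|%:E + `|Im (u x)|%:E)%E)).
  - by apply/measurable_EFinP; exact: measurable_normc.
  - move=> x Dx; rewrite /= lee_fin ger0_norm ?normc_ge0//.
    by rewrite [leRHS]ger0_norm ?addr_ge0// normc_le_ReIm.
  - by apply: integrableD => //; exact: integrable_norm.
split.
- apply: le_integrable inorm => //; first exact/measurable_EFinP.
  by move=> x Dx /=; rewrite lee_fin [leRHS]ger0_norm ?normc_ge0// Re_le_normc.
- apply: le_integrable inorm => //; first exact/measurable_EFinP.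
  by move=> x Dx /=; rewrite lee_fin [leRHS]ger0_norm ?normc_ge0// Im_le_normc.
Qed.

Lemma cintegrable_measurable D u : measurable D -> cintegrable D u -> cmeasurable D u.
Proof. by move=> mD /cintegrableP[]. Qed.

Lemma cintegrable_normc D u : measurable D -> cintegrable D u ->
  mu.-integrable D (fun x => (normc (u x))%:E).
Proof. by move=> mD /cintegrableP[]. Qed.

Lemma le_cintegrable D u (f : R -> R) : measurable D -> cmeasurable D u ->
  mu.-integrable D (EFin \o f) -> (forall x, D x -> normc (u x) <= f x) ->
  cintegrable D u.
Proof.
move=> mD mu1 fi h; apply/cintegrableP => //; split => //.
apply: le_integrable fi => //.
  by apply/measurable_EFinP; exact: measurable_normc.
move=> x Dx /=; rewrite lee_fin ger0_norm ?normc_ge0//.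
by rewrite (le_trans (h _ Dx))// ler_norm.
Qed.

Lemma cintegrableD D u v : measurable D -> cintegrable D u -> cintegrable D v ->
  cintegrable D (fun x => u x + v x).
Proof.
move=> mD [a b] [c d]; split.
  by under eq_fun do rewrite ReD EFinD; exact: integrableD.
by under eq_fun do rewrite ImD EFinD; exact: integrableD.
Qed.

Lemma cintegrableN D u : measurable D -> cintegrable D u ->
  cintegrable D (fun x => - u x).
Proof.
move=> mD [a b]; split.
  by under eq_fun do rewrite ReN EFinN; exact: integrableN.
by under eq_fun do rewrite ImN EFinN; exact: integrableN.
Qed.

Lemma cintegrableB D u v : measurable D -> cintegrable D u -> cintegrable D v ->
  cintegrable D (fun x => u x - v x).
Proof. by move=> mD mu1 mv; apply: cintegrableD => //; exact: cintegrableN. Qed.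

Lemma cintegrableM D u v (C : R) : measurable D -> cmeasurable D u ->
  (forall x, D x -> normc (u x) <= C) -> cintegrable D v ->
  cintegrable D (fun x => u x * v x).
Proof.
move=> mD mu1 hC iv.
apply: (@le_cintegrable _ _ (fun x => C * normc (v x))) => //.
- by apply: cmeasurableM => //; exact: cintegrable_measurable.
- rewrite /comp; under eq_fun do rewrite EFinM.
  by apply: integrableZl => //; exact: cintegrable_normc.
- by move=> x Dx; rewrite Normc.normcM ler_wpM2r ?normc_ge0// hC.
Qed.

Lemma cintegrableZ D (c : R[i]) u : measurable D -> cintegrable D u ->
  cintegrable D (fun x => c * u x).
Proof.
move=> mD iu; apply: (@cintegrableM D (fun=> c) u (normc c)) => //.
Qed.

Lemma cintegrable_conj D u : measurable D -> cintegrable D u ->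
  cintegrable D (fun x => conjc (u x)).
Proof.
move=> mD [a b]; split.
  by under eq_fun do rewrite ReJ.
by under eq_fun do rewrite ImJ EFinN; exact: integrableN.
Qed.

Lemma cintegrable0 D : measurable D -> cintegrable D (fun=> 0).
Proof. by move=> mD; split; exact: integrable0. Qed.

Lemma cintegrableS D1 D2 u : measurable D1 -> measurable D2 -> D2 `<=` D1 ->
  cintegrable D1 u -> cintegrable D2 u.
Proof. by move=> m1 m2 s [a b]; split; apply: (@integrableS _ _ _ mu D1 D2). Qed.

Lemma eq_cintegrable D u v : measurable D -> (forall x, D x -> u x = v x) ->
  cintegrable D u -> cintegrable D v.
Proof.
move=> mD e [a b]; split.
  by apply: eq_integrable a => // x /set_mem /e ->.
by apply: eq_integrable b => // x /set_mem /e ->.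
Qed.

Lemma eq_cint D u v : (forall x, D x -> u x = v x) -> cint D u = cint D v.
Proof.
by move=> e; rewrite /cint; congr (_ +i* _); apply: eq_Rintegral => x /set_mem /e ->.
Qed.

Lemma cintD D u v : measurable D -> cintegrable D u -> cintegrable D v ->
  cint D (fun x => u x + v x) = cint D u + cint D v.
Proof.
move=> mD [a b] [c d]; rewrite /cint; apply: complexP => /=.
  by under eq_Rintegral do rewrite ReD; rewrite RintegralD.
by under eq_Rintegral do rewrite ImD; rewrite RintegralD.
Qed.

Lemma cintZ D (c : R[i]) u : measurable D -> cintegrable D u ->
  cint D (fun x => c * u x) = c * cint D u.
Proof.
move=> mD [a b]; have iz (r : R) (f : R -> R) : mu.-integrable D (EFin \o f) ->
    mu.-integrable D (EFin \o (fun x => r * f x)).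
  by move=> h; rewrite /comp; under eq_fun do rewrite EFinM; exact: integrableZl.
apply: complexP; rewrite ?ReM ?ImM /=.
  under eq_Rintegral do rewrite ReM.
  by rewrite RintegralB// ?RintegralZl//; exact: iz.
under eq_Rintegral do rewrite ImM.
by rewrite RintegralD// ?RintegralZl//; exact: iz.
Qed.

Lemma cintN D u : measurable D -> cintegrable D u ->
  cint D (fun x => - u x) = - cint D u.
Proof.
move=> mD iu; rewrite -mulN1r -cintZ//.
by apply: eq_cint => x _; rewrite mulN1r.
Qed.

Lemma cintB D u v : measurable D -> cintegrable D u -> cintegrable D v ->
  cint D (fun x => u x - v x) = cint D u - cint D v.
Proof.
by move=> mD iu iv; rewrite cintD// ?cintN//; exact: cintegrableN.
Qed.

Lemma cintZr D (c : R[i]) u : measurable D -> cintegrable D u ->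
  cint D (fun x => u x * c) = cint D u * c.
Proof.
move=> mD iu; rewrite mulrC -cintZ//.
by apply: eq_cint => x _; rewrite mulrC.
Qed.

Lemma cint0 D : cint D (fun=> 0 : R[i]) = 0.
Proof. by rewrite /cint; apply: complexP => /=; rewrite /Rintegral integral0. Qed.

Lemma cint_conj D u : measurable D -> cintegrable D u ->
  cint D (fun x => conjc (u x)) = conjc (cint D u).
Proof.
move=> mD [a b]; apply: complexP; rewrite ?ReJ ?ImJ /=.
  by under eq_Rintegral do rewrite ReJ.
under eq_Rintegral do rewrite ImJ -mulN1r.
by rewrite RintegralZl// mulN1r.
Qed.

Lemma cint_setU D1 D2 u : measurable D1 -> measurable D2 -> [disjoint D1 & D2] ->
  cintegrable (D1 `|` D2) u -> cint (D1 `|` D2) u = cint D1 u + cint D2 u.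
Proof.
by move=> m1 m2 d [a b]; apply: complexP => /=; rewrite Rintegral_setU.
Qed.

Lemma normc_cint D u : measurable D -> cintegrable D u ->
  normc (cint D u) <= \int[mu]_(x in D) normc (u x).
Proof.
move=> mD iu; move zE : (cint D u) => z.
have [->|z0] := eqVneq z 0.
  by rewrite Normc.normc0; apply: Rintegral_ge0 => x _; exact: normc_ge0.
have nz : 0 < normc z by rewrite lt_neqAle eq_sym normc_eq0 z0 normc_ge0.
rewrite -(ler_pM2l nz) -RintegralZl//; last exact: cintegrable_normc.
have -> : normc z * normc z = Re (cint D (fun x => conjc z * u x)).
  by rewrite cintZ// zE conjcM_normc /= expr2.
have izu : cintegrable D (fun x => conjc z * u x) by exact: cintegrableZ.
rewrite [leLHS]/=; apply: le_Rintegral => //.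
- by case: izu.
- rewrite /comp; under eq_fun do rewrite EFinM.
  by apply: integrableZl => //; exact: cintegrable_normc.
- move=> x _; rewrite (le_trans (ler_norm _))// (le_trans (Re_le_normc _))//.
  by rewrite Normc.normcM normc_conj.
Qed.

End ComplexIntegral.

(** * Determinants of sums of rank-one matrices *)

Section Determinants.

Lemma det_bordered_regular (K : idomainType) N (a : K) (r : 'M[K]_(1, N))
    (c : 'M[K]_(N, 1)) (M : 'M[K]_N) : \det M != 0 ->
  \det (block_mx a%:M r c M) = a * \det M - (r *m \adj M *m c) 0 0.
Proof.
move=> M0; apply: (mulIf M0).
pose X := block_mx ((\det M)%:M : 'M[K]_1) 0 (- (\adj M *m c)) (1%:M : 'M[K]_N).
have dX : \det X = \det M by rewrite det_lblock det1 mulr1 det_scalar1.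
rewrite -{1}dX -det_mulmx mulmx_block !mulmx0 !mulmx1 !add0r.
rewrite !mulmxN (mulmxA M) mul_mx_adj (mul_scalar_mx _ c) (mul_mx_scalar _ c) subrr.
rewrite det_ublock det_mx11 mulmxA; congr (_ * _).
by rewrite -scalar_mxM mxE [X in X + _]mxE [X in _ + X]mxE eqxx mulr1n.
Qed.

Lemma det_bordered (F : fieldType) N (a : F) (r : 'M[F]_(1, N))
    (c : 'M[F]_(N, 1)) (M : 'M[F]_N) :
  \det (block_mx a%:M r c M) = a * \det M - (r *m \adj M *m c) 0 0.
Proof.
pose MX := char_poly_mx (- M).
have MX0 : \det MX != 0 by rewrite monic_neq0// char_poly_monic.
have := det_bordered_regular a%:P (map_mx polyC r) (map_mx polyC c) MX0.
move/(congr1 (horner_eval 0)).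
have hM : map_mx (horner_eval 0) MX = M.
  by apply/matrixP => i j; rewrite !mxE /horner_eval !hornerE hornerMn hornerX mul0rn sub0r opprK.
have hc p q (A : 'M[F]_(p, q)) : map_mx (horner_eval 0) (map_mx polyC A) = A.
  by apply/matrixP => i j; rewrite !mxE /horner_eval hornerC.
rewrite -det_map_mx map_block_mx map_scalar_mx !hc hM /= /horner_eval hornerC => ->.
rewrite hornerD hornerN hornerM hornerC -/(horner_eval 0 (\det MX)).
rewrite -det_map_mx hM; congr (_ - _).
have <- : map_mx (horner_eval 0) (map_mx polyC r *m \adj MX *m map_mx polyC c) =
  r *m \adj M *m c by rewrite !map_mxM map_mx_adj hM !hc.
by rewrite !mxE.
Qed.

Lemma det_rank1_update (F : fieldType) N (M : 'M[F]_N) (x : 'M[F]_(N, 1))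
    (y : 'M[F]_(1, N)) :
  \det (M + x *m y) = \det M + (y *m \adj M *m x) 0 0.
Proof.
have := det_bordered 1 (- y) x M.
rewrite mul1r !mulNmx mxE opprK => <-.
pose X := block_mx (1%:M : 'M[F]_1) y 0 (1%:M : 'M[F]_N).
have dX : \det X = 1 by rewrite det_ublock !det1 mulr1.
have -> : \det (block_mx 1%:M (- y) x M) = \det (block_mx 1%:M (- y) x M *m X).
  by rewrite det_mulmx dX mulr1.
rewrite mulmx_block !mulmx0 !mulmx1 !mul1mx !addr0.
by rewrite subrr det_lblock det1 mul1r addrC.
Qed.

Lemma det_sylvester (F : fieldType) p q (X : 'M[F]_(p, q)) (Y : 'M[F]_(q, p)) :
  \det (1%:M + X *m Y) = \det (1%:M + Y *m X).
Proof.
pose B := block_mx (1%:M : 'M[F]_q) (- Y) X (1%:M : 'M[F]_p).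
transitivity (\det B).
  pose Z := block_mx (1%:M : 'M[F]_q) Y 0 (1%:M : 'M[F]_p).
  have dZ : \det Z = 1 by rewrite det_ublock !det1 mulr1.
  have -> : \det B = \det (B *m Z) by rewrite det_mulmx dZ mulr1.
  rewrite mulmx_block !mulmx0 !mulmx1 !mul1mx !addr0.
  by rewrite subrr det_lblock det1 mul1r addrC.
pose Z := block_mx (1%:M : 'M[F]_q) 0 (- X) (1%:M : 'M[F]_p).
have dZ : \det Z = 1 by rewrite det_lblock !det1 mulr1.
have -> : \det B = \det (B *m Z) by rewrite det_mulmx dZ mulr1.
rewrite mulmx_block !mulmx0 !mulmx1 !mul1mx !add0r.
by rewrite mulmxN mulNmx opprK subrr det_ublock det1 mulr1.
Qed.

End Determinants.

Section Hadamard.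
Context {R : realType}.

Lemma det_unitary_normc N (B : 'M[R[i]]_N) : B \is unitarymx -> normc (\det B) = 1.
Proof.
move=> /unitarymxP /(congr1 determinant); rewrite det1 det_mulmx det_map_mx det_tr.
move=> /(congr1 (@Normc.normc R)); rewrite Normc.normcM Normc.normc1.
rewrite [X in _ * normc X](_ : _ = conjc (\det B))// normc_conj => /eqP.
by rewrite -expr2 sqrf_eq1 => /orP[/eqP//|/eqP h]; have := normc_ge0 (\det B); rewrite h oppr_ge0 ler10.
Qed.

Lemma lq_decomposition N (Z : 'M[R[i]]_N) :
  exists L B : 'M[R[i]]_N, [/\ B \is unitarymx, Z = L *m B & is_trig_mx L].
Proof.
have uB : schmidt Z \is unitarymx by exact: schmidt_unitarymx.
exists (Z *m (schmidt Z ^t*)%sesqui), (schmidt Z); split => //.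
  by rewrite mulmxKtV.
apply/is_trig_mxP => i j ij.
have -> : (Z *m (schmidt Z ^t*)%sesqui) i j = dotmx (row i Z) (row j (schmidt Z)).
  by rewrite dotmxE !mxE; apply: eq_bigr => k _; rewrite !mxE.
rewrite dotmxE.
suff -> : row i Z *m ((row j (schmidt Z)) ^t*)%sesqui = 0 by rewrite mxE.
apply/sub_kermxP; apply: submx_trans (row_schmidt_sub Z i) _.
apply/sumsmx_subP => k ki; rewrite genmxE; apply/sub_kermxP.
apply/matrixP => a b; rewrite !ord1 -dotmxE (row_unitarymxP uB) mxE.
by have -> : (k == j) = false by apply/eqP => kj; move: ij; rewrite -kj ltnNge ki.
Qed.

Lemma det_hadamard N (Z : 'M[R[i]]_N) :
  normc (\det Z) <= \prod_(i < N) Num.sqrt (\sum_(j < N) normc (Z i j) ^+ 2).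
Proof.
have [L [B [uB -> trigL]]] := lq_decomposition Z.
rewrite det_mulmx Normc.normcM [X in _ * X]det_unitary_normc// mulr1 det_trig// normc_prod.
apply: ler_prod => i _; rewrite normc_ge0/=.
rewrite -[leLHS]ger0_norm ?normc_ge0// -sqrtr_sqr; apply: ler_wsqrtr.
have sumE (A : 'M[R[i]]_N) :
    (\sum_(j < N) normc (A i j) ^+ 2)%:C = (A *m (A ^t*)%sesqui) i i.
  rewrite mxE rmorph_sum; apply: eq_bigr => j _; rewrite !mxE.
  by rewrite [RHS]mulrC -[Num.conj _]/(conjc (A i j)) conjcM_normc.
have -> : \sum_(j < N) normc ((L *m B) i j) ^+ 2 = \sum_(j < N) normc (L i j) ^+ 2.
  apply: complexI; rewrite !sumE.
  congr (fun_of_matrix _ i i); rewrite trmx_mul map_mxM mulmxA.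
  by rewrite mulmxtVK.
by rewrite (bigD1 i)//= lerDl sumr_ge0// => j _; rewrite sqr_ge0.
Qed.

End Hadamard.


Section NuclearBound.
Context {R : realType}.

Lemma cauchy_schwarz_amgm (p q s : R) : 0 <= p -> 0 <= q ->
  (forall t, 0 < t -> 2 * s <= t * p + q / t) -> s <= Num.sqrt p * Num.sqrt q.
Proof.
move=> p0 q0 h; have [s0|s0] := leP s 0.
  by rewrite (le_trans s0)// mulr_ge0 ?sqrtr_ge0.
have pP : 0 < p.
  rewrite lt_neqAle p0 andbT eq_sym; apply/eqP => pz.
  have t0 : 0 < (q + 1) / s by rewrite divr_gt0// ltr_wpDl.
  have := h _ t0; rewrite pz mulr0 add0r invf_div mulrA ler_pdivlMr ?ltr_wpDl//.
  rewrite leNgt => /negP; apply; nra.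
have qP : 0 < q.
  rewrite lt_neqAle q0 andbT eq_sym; apply/eqP => qz.
  have t0 : 0 < s / p by rewrite divr_gt0.
  have := h _ t0; rewrite qz mul0r addr0 divfK ?gt_eqF//; lra.
have a0 : 0 < Num.sqrt p by rewrite sqrtr_gt0.
have b0 : 0 < Num.sqrt q by rewrite sqrtr_gt0.
have t0 : 0 < Num.sqrt q / Num.sqrt p by rewrite divr_gt0.
have := h _ t0.
have -> : Num.sqrt q / Num.sqrt p * p = Num.sqrt p * Num.sqrt q.
  by rewrite -{2}(sqr_sqrtr p0); field; rewrite gt_eqF.
have -> : q / (Num.sqrt q / Num.sqrt p) = Num.sqrt p * Num.sqrt q.
  by rewrite -{1}(sqr_sqrtr q0); field; rewrite !gt_eqF.
lra.
Qed.

Lemma amgm_weighted (t x y : R) : 0 < t -> 2 * (x * y) <= t * x ^+ 2 + y ^+ 2 / t.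
Proof.
move=> t0; rewrite -subr_ge0.
have -> : t * x ^+ 2 + y ^+ 2 / t - 2 * (x * y) = t * (x - y / t) ^+ 2.
  by field; rewrite gt_eqF.
by rewrite mulr_ge0 ?sqr_ge0// ltW.
Qed.

Lemma cauchy_schwarz_sum N (a b : 'I_N -> R) :
  \sum_k a k * b k <=
  Num.sqrt (\sum_k a k ^+ 2) * Num.sqrt (\sum_k b k ^+ 2).
Proof.
apply: cauchy_schwarz_amgm.
- by apply: sumr_ge0 => k _; rewrite sqr_ge0.
- by apply: sumr_ge0 => k _; rewrite sqr_ge0.
move=> t t0; rewrite !mulr_sumr mulr_suml -big_split /=.
by apply: ler_sum => k _; exact: amgm_weighted.
Qed.

Definition vnorm N (v : 'I_N -> R[i]) : R := Num.sqrt (\sum_k normc (v k) ^+ 2).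

Lemma vnorm_ge0 N (v : 'I_N -> R[i]) : 0 <= vnorm v.
Proof. exact: sqrtr_ge0. Qed.

Lemma vnormZ N (c : R[i]) (v : 'I_N -> R[i]) :
  vnorm (fun k => c * v k) = normc c * vnorm v.
Proof.
rewrite /vnorm; under eq_bigr do rewrite Normc.normcM exprMn.
by rewrite -mulr_sumr sqrtrM ?sqr_ge0// sqrtr_sqr ger0_norm ?normc_ge0.
Qed.

Lemma vnorm_eq0 N (v : 'I_N -> R[i]) k : vnorm v = 0 -> v k = 0.
Proof.
move=> /eqP; rewrite sqrtr_eq0 => h.
have : normc (v k) ^+ 2 <= 0.
  apply: le_trans h; rewrite (bigD1 k)//= lerDl.
  by apply: sumr_ge0 => i _; rewrite sqr_ge0.
rewrite le_eqVlt ltNge sqr_ge0 orbF sqrf_eq0 normc_eq0.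
by move/eqP.
Qed.

Definition sum_rank1 N (x y : nat -> 'I_N -> R[i]) M : 'M[R[i]]_N :=
  \matrix_(k, l) \sum_(i < M) x i k * y i l.

Definition growth (a : R) := expR (a + a ^+ 2 / 2).

Lemma growth_ge0 a : 0 <= growth a. Proof. exact: expR_ge0. Qed.

Lemma ler_growth a b : 0 <= a -> a <= b -> growth a <= growth b.
Proof.
move=> a0 ab; rewrite /growth ler_expR lerD// ler_wpM2r ?invr_ge0//.
by rewrite ler_sqr ?nnegrE// (le_trans a0).
Qed.

Lemma det_add1_bound N (A : 'M[R[i]]_N) (a : R) :
  \sum_k normc (A k k) <= a -> \sum_k \sum_l normc (A k l) ^+ 2 <= a ^+ 2 ->
  normc (\det (1%:M + A)) <= growth a.
Proof.
move=> tr fr; apply: le_trans (det_hadamard _) _.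
have row_le k : Num.sqrt (\sum_(j < N) normc ((1%:M + A) k j) ^+ 2) <=
    expR (normc (A k k) + (\sum_l normc (A k l) ^+ 2) / 2).
  set E := expR _; have E0 : 0 <= E by exact: expR_ge0.
  rewrite -[E]ger0_norm// -sqrtr_sqr; apply: ler_wsqrtr.
  rewrite /E -expRM_natl.
  have -> : \sum_(j < N) normc ((1%:M + A) k j) ^+ 2 =
      1 + 2 * Re (A k k) + \sum_l normc (A k l) ^+ 2.
    rewrite (bigD1 k)//= [X in _ = _ + X](bigD1 k)//= addrA; congr (_ + _).
      by rewrite !mxE eqxx !sqr_normcE !ReImE /=; ring.
    by apply: eq_bigr => j jk; rewrite !mxE eq_sym (negbTE jk) add0r.
  apply: le_trans (expR_ge1Dx _).
  have := le_trans (ler_norm _) (Re_le_normc (A k k)).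
  move: (\sum_l _) => r hr; lra.
apply: (@le_trans _ _ (\prod_(k < N) expR (normc (A k k) + (\sum_l normc (A k l) ^+ 2) / 2))).
  by apply: ler_prod => k _; rewrite sqrtr_ge0 row_le.
rewrite -expR_sum ler_expR big_split/= lerD// -mulr_suml ler_wpM2r//.
Qed.

Lemma det_sum_rank1_bound N (x y : nat -> 'I_N -> R[i]) M :
  normc (\det (1%:M + sum_rank1 x y M)) <=
  growth (\sum_(i < M) vnorm (x i) * vnorm (y i)).
Proof.
have csv (u v : 'I_N -> R[i]) : \sum_k normc (u k) * normc (v k) <= vnorm u * vnorm v.
  exact: (cauchy_schwarz_sum (fun k => normc (u k)) (fun k => normc (v k))).
have entry k l : normc (sum_rank1 x y M k l) <= \sum_(i < M) normc (x i k) * normc (y i l).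
  rewrite mxE (le_trans (normc_sum _ _ _))//.
  by apply: ler_sum => i _; rewrite Normc.normcM.
apply: det_add1_bound.
  apply: (@le_trans _ _ (\sum_k \sum_(i < M) normc (x i k) * normc (y i k))).
    by apply: ler_sum => k _; exact: entry.
  by rewrite exchange_big; apply: ler_sum => i _; exact: csv.
apply: (@le_trans _ _ (\sum_k \sum_l
    (\sum_(i < M) normc (x i k) * normc (y i l)) ^+ 2)).
  apply: ler_sum => k _; apply: ler_sum => l _.
  rewrite ler_sqr ?nnegrE ?normc_ge0 ?entry//.
  by apply: sumr_ge0 => i _; rewrite mulr_ge0 ?normc_ge0.
under eq_bigr => k _ do under eq_bigr => l _ do rewrite expr2 big_distrlr /=.
under eq_bigr => k _ do rewrite exchange_big /=.
rewrite exchange_big expr2 big_distrlr /=; apply: ler_sum => i _.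
under eq_bigr => k _ do rewrite exchange_big /=.
rewrite exchange_big /=; apply: ler_sum => j _.
have -> : \sum_k \sum_l normc (x i k) * normc (y i l) * (normc (x j k) * normc (y j l))
  = (\sum_k normc (x i k) * normc (x j k)) * (\sum_l normc (y i l) * normc (y j l)).
  rewrite big_distrlr /=; apply: eq_bigr => k _; apply: eq_bigr => l _; ring.
rewrite mulrACA; apply: ler_pM; rewrite ?csv//.
  by apply: sumr_ge0 => k _; rewrite mulr_ge0 ?normc_ge0.
by apply: sumr_ge0 => k _; rewrite mulr_ge0 ?normc_ge0.
Qed.

(* [det (1 + A + s x y)] is affine in [s]; taking [s = 1 / (|x| |y|)] bounds its
   slope. *)
Lemma det_sum_rank1_step N (x y : nat -> 'I_N -> R[i]) M :
  normc (\det (1%:M + sum_rank1 x y M.+1) - \det (1%:M + sum_rank1 x y M)) <=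
  vnorm (x M) * vnorm (y M) *
  (2 * growth (\sum_(i < M) vnorm (x i) * vnorm (y i) + 1)).
Proof.
set w := vnorm (x M) * vnorm (y M).
pose xc : 'M[R[i]]_(N, 1) := \matrix_(k, l) x M k.
pose yr : 'M[R[i]]_(1, N) := \matrix_(k, l) y M l.
pose beta := (yr *m \adj (1%:M + sum_rank1 x y M) *m xc) 0 0.
have affine (s : R[i]) : \det (1%:M + sum_rank1 (fun i k => (if (i == M)%N then s else 1) * x i k) y M.+1) =
    \det (1%:M + sum_rank1 x y M) + s * beta.
  have -> : s * beta = (yr *m \adj (1%:M + sum_rank1 x y M) *m (s *: xc)) 0 0.
    by rewrite -scalemxAr [in RHS]mxE.
  rewrite -det_rank1_update -addrA; congr (\det (_ + _)).
  apply/matrixP => k l; rewrite !mxE big_ord_recr /= eqxx; congr (_ + _).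
    by apply: eq_bigr => i _; rewrite ltn_eqF// mul1r.
  by rewrite big_ord1 !mxE.
have nonneg : 0 <= \sum_(i < M) vnorm (x i) * vnorm (y i).
  by apply: sumr_ge0 => i _; rewrite mulr_ge0 ?vnorm_ge0.
have w0 : 0 <= w by rewrite mulr_ge0 ?vnorm_ge0.
have -> : \det (1%:M + sum_rank1 x y M.+1) = \det (1%:M + sum_rank1 x y M) + beta.
  rewrite -[beta]mul1r -affine; congr (\det (_ + _)).
  by apply/matrixP => k l; rewrite !mxE; apply: eq_bigr => i _; rewrite if_same mul1r.
rewrite addrC addKr; have [wz|wn] := eqVneq w 0.
  rewrite wz mul0r; suff -> : beta = 0 by rewrite Normc.normc0.
  move: wz => /eqP; rewrite mulf_eq0 => /orP[/eqP h|/eqP h].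
    suff xc0 : xc = 0 by rewrite /beta xc0 mulmx0 mxE.
    by apply/matrixP => k l; rewrite !mxE (vnorm_eq0 k h).
  suff yr0 : yr = 0 by rewrite /beta yr0 !mul0mx mxE.
  by apply/matrixP => k l; rewrite !mxE (vnorm_eq0 l h).
have wP : 0 < w by rewrite lt_neqAle eq_sym wn w0.
set G := growth _.
have hs : normc (\det (1%:M + sum_rank1 x y M) + (w^-1)%:C * beta) <= G.
  rewrite -affine; apply: le_trans (det_sum_rank1_bound _ _ _) _.
  rewrite big_ord_recr /= eqxx vnormZ normc_real ger0_norm ?invr_ge0//.
  rewrite -mulrA mulVf// /G; apply: ler_growth.
    by apply: addr_ge0 => //; apply: sumr_ge0 => i _; rewrite mulr_ge0 ?vnorm_ge0.
  rewrite lerD2r; apply: ler_sum => i _.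
  by rewrite ltn_eqF// vnormZ Normc.normc1 mul1r.
have h0 : normc (\det (1%:M + sum_rank1 x y M)) <= G.
  apply: le_trans (det_sum_rank1_bound _ _ _) _; apply: ler_growth => //.
  by rewrite lerDl.
have : normc ((w^-1)%:C * beta) <= 2 * G.
  rewrite -[X in normc X](addKr (\det (1%:M + sum_rank1 x y M))) addrC.
  by rewrite (le_trans (normcB _ _))// mulr_natl mulr2n lerD.
by rewrite Normc.normcM normc_real ger0_norm ?invr_ge0// mulrC ler_pdivrMr// mulrC.
Qed.

Lemma det_sum_rank1_diff N (x y : nat -> 'I_N -> R[i]) M K (a : R) :
  (forall M, \sum_(i < M) vnorm (x i) * vnorm (y i) <= a) ->
  normc (\det (1%:M + sum_rank1 x y (M + K)) - \det (1%:M + sum_rank1 x y M)) <=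
  (\sum_(M <= i < M + K) vnorm (x i) * vnorm (y i)) * (2 * growth (a + 1)).
Proof.
move=> ha; elim: K => [|K ih].
  by rewrite addn0 subrr Normc.normc0 big_geq// mul0r.
rewrite addnS big_nat_recr ?leq_addr//= mulrDl.
rewrite -[X in normc X](subrKA (\det (1%:M + sum_rank1 x y (M + K)))).
rewrite (le_trans (normcD _ _))// addrC lerD//.
apply: le_trans (det_sum_rank1_step _ _ _) _.
rewrite ler_wpM2l ?mulr_ge0 ?vnorm_ge0// ler_pM2l// ler_growth ?lerD2r//.
by rewrite addr_ge0//; apply: sumr_ge0 => i _; rewrite mulr_ge0 ?vnorm_ge0.
Qed.

End NuclearBound.

(** * Square integrable functions on the star graph *)

Section SquareIntegrable.
Context {R : realType}.
Local Notation mu := (@lebesgue_measure R).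
Implicit Types (u v : R -> R[i]).

Lemma measurable_halfline : measurable (halfline : set R).
Proof. exact: measurable_itv. Qed.
Hint Extern 0 (measurable halfline) => exact: measurable_halfline : core.

Lemma le_square_integrable u (f : R -> R) : cmeasurable halfline u ->
  mu.-integrable halfline (EFin \o f) ->
  (forall x, halfline x -> normc (u x) ^+ 2 <= f x) -> square_integrable u.
Proof.
move=> mu1 fi h; split => //; apply: le_integrable fi => //.
  apply/measurable_EFinP; apply: measurable_funX; exact: measurable_normc.
move=> x Dx /=; rewrite lee_fin ger0_norm ?sqr_ge0//.
by rewrite (le_trans (h _ Dx))// ler_norm.
Qed.

Lemma integrable_scale (D : set R) (c : R) (f : R -> R) : measurable D ->
  mu.-integrable D (EFin \o f) -> mu.-integrable D (EFin \o (fun x => c * f x)).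
Proof.
move=> mD fi; rewrite /comp; under eq_fun do rewrite EFinM.
exact: integrableZl.
Qed.

Lemma integrable_add (D : set R) (f g : R -> R) : measurable D ->
  mu.-integrable D (EFin \o f) -> mu.-integrable D (EFin \o g) ->
  mu.-integrable D (EFin \o (fun x => f x + g x)).
Proof.
move=> mD fi gi; rewrite /comp; under eq_fun do rewrite EFinD.
exact: integrableD.
Qed.

Lemma square_integrableD u v : square_integrable u -> square_integrable v ->
  square_integrable (fun x => u x + v x).
Proof.
move=> [mu1 iu] [mv iv].
apply: (@le_square_integrable _ (fun x => 2 * normc (u x) ^+ 2 + 2 * normc (v x) ^+ 2)).
- exact: cmeasurableD.
- by apply: integrable_add => //; apply: integrable_scale.
move=> x _; apply: (@le_trans _ _ ((normc (u x) + normc (v x)) ^+ 2)).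
  by rewrite ler_sqr ?nnegrE ?addr_ge0 ?normc_ge0// normcD.
rewrite -subr_ge0.
have -> : 2 * normc (u x) ^+ 2 + 2 * normc (v x) ^+ 2 - (normc (u x) + normc (v x)) ^+ 2
  = (normc (u x) - normc (v x)) ^+ 2 by ring.
exact: sqr_ge0.
Qed.

Lemma square_integrableM (m : R -> R[i]) (C : R) u : cmeasurable halfline m ->
  (forall x, halfline x -> normc (m x) <= C) -> square_integrable u ->
  square_integrable (fun x => m x * u x).
Proof.
move=> mm hC [mu1 iu].
apply: (@le_square_integrable _ (fun x => C ^+ 2 * normc (u x) ^+ 2)).
- exact: cmeasurableM.
- exact: integrable_scale.
move=> x Dx; rewrite Normc.normcM exprMn ler_wpM2r ?sqr_ge0//.
have := hC _ Dx => h; rewrite ler_sqr ?nnegrE ?normc_ge0//.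
exact: le_trans (normc_ge0 _) h.
Qed.

Lemma square_integrableZ (c : R[i]) u : square_integrable u ->
  square_integrable (fun x => c * u x).
Proof.
by apply: (@square_integrableM (fun=> c) (normc c)).
Qed.

Lemma square_integrableN u : square_integrable u ->
  square_integrable (fun x => - u x).
Proof.
by move=> /(square_integrableZ (-1)); under eq_fun do rewrite mulN1r.
Qed.

Lemma square_integrable0 : square_integrable (fun=> 0 : R[i]).
Proof.
split; first exact: cmeasurable_cst.
rewrite Normc.normc0 expr0n /=; exact: integrable0.
Qed.

Lemma square_integrable_conj u : square_integrable u ->
  square_integrable (fun x => conjc (u x)).
Proof.
move=> [mu1 iu]; split; first exact: cmeasurable_conj.
by under eq_fun do rewrite normc_conj.
Qed.

Lemma square_integrable_mul u v : square_integrable u -> square_integrable v ->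
  cintegrable halfline (fun x => u x * v x).
Proof.
move=> [mu1 iu] [mv iv].
apply: (@le_cintegrable _ _ _ (fun x => normc (u x) ^+ 2 + normc (v x) ^+ 2)) => //.
- exact: cmeasurableM.
- exact: integrable_add.
move=> x _; rewrite Normc.normcM.
have := sqr_ge0 (normc (u x) - normc (v x)).
have := sqr_ge0 (normc (u x)); have := sqr_ge0 (normc (v x)); nra.
Qed.

Lemma square_integrable_dot u v : square_integrable u -> square_integrable v ->
  cintegrable halfline (fun x => conjc (u x) * v x).
Proof.
by move=> iu iv; apply: square_integrable_mul => //; exact: square_integrable_conj.
Qed.

End SquareIntegrable.
#[global] Hint Extern 0 (measurable halfline) => exact: measurable_halfline : core.

Section InnerProduct.
Context {R : realType} {n : nat}.
Local Notation mu := (@lebesgue_measure R).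
Local Notation starfun := ('I_n -> R -> R[i]).
Implicit Types (u v w : starfun).

Definition sadd u v : starfun := fun j x => u j x + v j x.
Definition ssub u v : starfun := fun j x => u j x - v j x.
Definition sscale (c : R[i]) u : starfun := fun j x => c * u j x.
Definition ssum (I : Type) (r : seq I) (F : I -> starfun) : starfun :=
  fun j x => \sum_(i <- r) F i j x.

Lemma L2D u v : L2 u -> L2 v -> L2 (sadd u v).
Proof. by move=> hu hv j; exact: square_integrableD. Qed.
Lemma L2Z c u : L2 u -> L2 (sscale c u).
Proof. by move=> hu j; exact: square_integrableZ. Qed.
Lemma L2B u v : L2 u -> L2 v -> L2 (ssub u v).
Proof.
by move=> hu hv j; apply: square_integrableD => //; exact: square_integrableN.
Qed.
Lemma L20 : L2 ((fun _ _ => 0) : starfun).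
Proof. by move=> j; exact: square_integrable0. Qed.
Lemma ssum_nil I (F : I -> starfun) : ssum [::] F = fun _ _ => 0.
Proof. by apply/funext => j; apply/funext => x; rewrite /ssum big_nil. Qed.
Lemma ssum_cons I i r (F : I -> starfun) : ssum (i :: r) F = sadd (F i) (ssum r F).
Proof. by apply/funext => j; apply/funext => x; rewrite /ssum big_cons. Qed.
Lemma L2_ssum I r (F : I -> starfun) : (forall i, L2 (F i)) -> L2 (ssum r F).
Proof.
move=> h; elim: r => [|i r ih]; first by rewrite ssum_nil; exact: L20.
by rewrite ssum_cons; exact: L2D.
Qed.

Lemma inner_conj u v : L2 u -> L2 v -> inner v u = conjc (inner u v).
Proof.
move=> hu hv; rewrite /inner rmorph_sum; apply: eq_bigr => j _ /=.
have hc : cintegrable halfline (fun x => conjc (u j x) * v j x).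
  exact: square_integrable_dot.
rewrite [RHS](_ : _ = conjc (cint halfline (fun x => conjc (u j x) * v j x)))//.
rewrite -cint_conj//.
by apply: eq_cint => x _; rewrite conjcM conjcK mulrC.
Qed.

Lemma innerDr u v w : L2 u -> L2 v -> L2 w ->
  inner u (sadd v w) = inner u v + inner u w.
Proof.
move=> hu hv hw; rewrite /inner -big_split; apply: eq_bigr => j _ /=.
rewrite -cintD//; try exact: square_integrable_dot.
by apply: eq_cint => x _; rewrite mulrDr.
Qed.

Lemma innerZr u c v : L2 u -> L2 v -> inner u (sscale c v) = c * inner u v.
Proof.
move=> hu hv; rewrite /inner mulr_sumr; apply: eq_bigr => j _ /=.
rewrite -cintZ//; try exact: square_integrable_dot.
by apply: eq_cint => x _; rewrite mulrCA.
Qed.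

Lemma ssubE u v : ssub u v = sadd u (sscale (-1) v).
Proof. by apply/funext => j; apply/funext => x; rewrite /ssub /sadd /sscale mulN1r. Qed.

Lemma innerBr u v w : L2 u -> L2 v -> L2 w ->
  inner u (ssub v w) = inner u v - inner u w.
Proof.
move=> hu hv hw; rewrite ssubE innerDr//; last exact: L2Z.
by rewrite innerZr// mulN1r.
Qed.

Lemma inner0r u : inner u (fun _ _ => 0) = 0.
Proof.
rewrite /inner big1// => j _; rewrite -[RHS](cint0 halfline).
by apply: eq_cint => x _; rewrite mulr0.
Qed.

Lemma inner_ssumr u I r (F : I -> starfun) : L2 u -> (forall i, L2 (F i)) ->
  inner u (ssum r F) = \sum_(i <- r) inner u (F i).
Proof.
move=> hu h; elim: r => [|i r ih]; first by rewrite ssum_nil big_nil inner0r.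
by rewrite ssum_cons big_cons innerDr// ?ih//; exact: L2_ssum.
Qed.

Lemma innerDl u v w : L2 u -> L2 v -> L2 w ->
  inner (sadd v w) u = inner v u + inner w u.
Proof.
move=> hu hv hw; rewrite (inner_conj hu (L2D hv hw)) innerDr// conjcD.
by rewrite -!inner_conj.
Qed.

Lemma innerZl u c v : L2 u -> L2 v -> inner (sscale c v) u = conjc c * inner v u.
Proof.
by move=> hu hv; rewrite (inner_conj hu (L2Z c hv)) innerZr// conjcM -inner_conj.
Qed.

Lemma inner_ssuml u I r (F : I -> starfun) : L2 u -> (forall i, L2 (F i)) ->
  inner (ssum r F) u = \sum_(i <- r) inner (F i) u.
Proof.
move=> hu h; rewrite (inner_conj hu (L2_ssum _ h)) inner_ssumr// rmorph_sum.
by apply: eq_bigr => i _; rewrite /= -inner_conj.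
Qed.

Definition normsq u : R := \sum_j \int[mu]_(x in halfline) (normc (u j x) ^+ 2).

Lemma normsq_ge0 u : 0 <= normsq u.
Proof. by apply: sumr_ge0 => j _; apply: Rintegral_ge0 => x _; rewrite sqr_ge0. Qed.

Lemma inner_self u : inner u u = (normsq u)%:C.
Proof.
rewrite /inner /normsq rmorph_sum; apply: eq_bigr => j _ /=; apply: complexP => /=.
  by apply: eq_Rintegral => x _; rewrite conjcM_normc.
rewrite -[RHS](Rintegral_set0 mu (fun=> 0)) /Rintegral integral_set0.
by rewrite integral0_eq// => x _; rewrite conjcM_normc.
Qed.

Lemma L2normE u : L2norm u = Num.sqrt (normsq u).
Proof. by rewrite /L2norm inner_self. Qed.
Lemma L2norm_ge0 u : 0 <= L2norm u.
Proof. exact: sqrtr_ge0. Qed.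
Lemma sqr_L2norm u : L2norm u ^+ 2 = normsq u.
Proof. by rewrite L2normE sqr_sqrtr ?normsq_ge0. Qed.

Lemma cauchy_schwarz u v : L2 u -> L2 v -> normc (inner u v) <= L2norm u * L2norm v.
Proof.
move=> hu hv; rewrite !L2normE.
have absI j : mu.-integrable halfline (EFin \o (fun x => normc (u j x) * normc (v j x))).
  have := cintegrable_normc measurable_halfline (square_integrable_dot (hu j) (hv j)).
  by under eq_fun do rewrite Normc.normcM normc_conj.
have usq j : mu.-integrable halfline (EFin \o (fun x => normc (u j x) ^+ 2)).
  by case: (hu j).
have vsq j : mu.-integrable halfline (EFin \o (fun x => normc (v j x) ^+ 2)).
  by case: (hv j).
apply: (@le_trans _ _ (\sum_j \int[mu]_(x in halfline) (normc (u j x) * normc (v j x)))).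
  rewrite (le_trans (normc_sum _ _ _))//; apply: ler_sum => j _.
  rewrite (le_trans (normc_cint _ _))//; first exact: square_integrable_dot.
  by under eq_Rintegral do rewrite Normc.normcM normc_conj.
apply: cauchy_schwarz_amgm; try exact: normsq_ge0.
move=> t t0; rewrite /normsq !mulr_sumr mulr_suml -big_split /=.
apply: ler_sum => j _; rewrite -!RintegralZl// -[X in _ + X]RintegralZr//.
rewrite -RintegralD//; last 2 first.
- exact: integrable_scale.
- rewrite /comp; under eq_fun do rewrite mulrC EFinM.
  by apply: integrableZl => //; exact: vsq.
apply: le_Rintegral => //.
- exact: integrable_scale.
- apply: integrable_add => //; first exact: integrable_scale.
  rewrite /comp; under eq_fun do rewrite mulrC EFinM.
  by apply: integrableZl => //; exact: vsq.
- by move=> x _; exact: amgm_weighted.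
Qed.

Lemma normsqD u v : L2 u -> L2 v ->
  normsq (sadd u v) = normsq u + normsq v + 2 * Re (inner u v).
Proof.
move=> hu hv; have huv := L2D hu hv; apply: complexI.
rewrite -inner_self innerDl// !innerDr// (inner_conj hu hv) !inner_self.
by apply: complexP; rewrite !ReImE /=; ring.
Qed.

Lemma L2normD u v : L2 u -> L2 v -> L2norm (sadd u v) <= L2norm u + L2norm v.
Proof.
move=> hu hv; rewrite -(ler_pXn2r (n := 2)) ?nnegrE ?addr_ge0 ?L2norm_ge0//.
rewrite sqr_L2norm normsqD// sqrrD !sqr_L2norm -addrA [X in _ + X]addrC addrA.
rewrite lerD2r lerD2l mulr_natl ler_pMn2r//.
apply: le_trans (cauchy_schwarz hu hv); exact: le_trans (ler_norm _) (Re_le_normc _).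
Qed.

Lemma normsqZ c u : L2 u -> normsq (sscale c u) = normc c ^+ 2 * normsq u.
Proof.
move=> hu; rewrite /normsq mulr_sumr; apply: eq_bigr => j _.
rewrite -RintegralZl//; last by case: (hu j).
by apply: eq_Rintegral => x _; rewrite /sscale Normc.normcM exprMn.
Qed.

Lemma L2normZ c u : L2 u -> L2norm (sscale c u) = normc c * L2norm u.
Proof.
move=> hu; rewrite !L2normE normsqZ// sqrtrM ?sqr_ge0// sqrtr_sqr.
by rewrite ger0_norm ?normc_ge0.
Qed.

Lemma L2normB u v : L2 u -> L2 v -> L2norm (ssub u v) <= L2norm u + L2norm v.
Proof.
move=> hu hv; rewrite ssubE (le_trans (L2normD _ _))//; first exact: L2Z.
by rewrite L2normZ// normcN Normc.normc1 mul1r.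
Qed.

Lemma L2norm_distC u v : L2norm (ssub u v) = L2norm (ssub v u).
Proof.
rewrite !L2normE; congr Num.sqrt; apply: eq_bigr => j _.
by apply: eq_Rintegral => x _; rewrite normc_distC.
Qed.

Lemma L2norm_ssum I r (F : I -> starfun) : (forall i, L2 (F i)) ->
  L2norm (ssum r F) <= \sum_(i <- r) L2norm (F i).
Proof.
move=> h; elim: r => [|i r ih].
  rewrite ssum_nil big_nil L2normE /normsq big1 ?sqrtr0// => j _.
  by under eq_Rintegral do rewrite Normc.normc0 expr0n; rewrite /Rintegral integral0.
rewrite ssum_cons big_cons (le_trans (L2normD _ _))// ?lerD2l//.
exact: L2_ssum.
Qed.

Lemma L2norm_eq0 u : L2 u -> L2norm u = 0 -> L2_eq u (fun _ _ => 0).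
Proof.
move=> hu /eqP; rewrite L2normE sqrtr_eq0 => h j.
have hz : \int[mu]_(x in halfline) (normc (u j x) ^+ 2) = 0.
  apply/eqP; rewrite eq_le Rintegral_ge0 ?andbT; last by move=> x _; rewrite sqr_ge0.
  apply: le_trans h; rewrite /normsq (bigD1 j)//= lerDl.
  by apply: sumr_ge0 => i _; apply: Rintegral_ge0 => x _; rewrite sqr_ge0.
have [mu1 iu] := hu j.
have : (\int[mu]_(x in halfline) `|(normc (u j x) ^+ 2)%:E| = 0)%E.
  under eq_integral do rewrite gee0_abs ?lee_fin ?sqr_ge0//.
  rewrite -[LHS]fineK; first by congr EFin; exact: hz.
  exact: integrable_fin_num.
have mF : measurable_fun halfline (fun x => (normc (u j x) ^+ 2)%:E).
  exact: measurable_int iu.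
move/(ae_eq_integral_abs mu measurable_halfline mF).
apply: filterS => x e Dx; have /eqP := e Dx.
rewrite eqe sqrf_eq0 normc_eq0; exact: eqP.
Qed.

End InnerProduct.

(** * Completeness and orthonormal bases *)

Section RieszFischer.
Context {R : realType}.
Local Notation mu := (@lebesgue_measure R).

Lemma ler_dist_normc (z w : R[i]) : `|normc z - normc w| <= normc (z - w).
Proof.
rewrite ler_norml; apply/andP; split.
  by rewrite lerNl opprB lerBlDr normc_distC (le_trans _ (normcD _ _))// subrK.
by rewrite lerBlDr (le_trans _ (normcD _ _))// subrK.
Qed.

Lemma EFin_Rintegral (D : set R) (f : R -> R) : measurable D ->
  mu.-integrable D (EFin \o f) ->
  (\int[mu]_(x in D) (f x)%:E = (\int[mu]_(x in D) f x)%:E)%E.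
Proof. by move=> mD fi; rewrite /Rintegral fineK//; exact: integrable_fin_num fi. Qed.

Lemma fatou_bound (D : set R) (f : nat -> R -> R) (g : R -> R) (M : R) :
  measurable D -> (forall i, mu.-integrable D (EFin \o f i)) ->
  (forall i x, D x -> 0 <= f i x) ->
  (forall x, D x -> f i x @[i --> \oo] --> g x) ->
  (forall i, \int[mu]_(x in D) f i x <= M) ->
  mu.-integrable D (EFin \o g) /\ \int[mu]_(x in D) g x <= M.
Proof.
move=> mD fi f0 fg hM.
have mf i : measurable_fun D (f i) by apply/measurable_EFinP; exact: measurable_int (fi i).
have mg : measurable_fun D g by exact: measurable_fun_cvg mf fg.
have g0 x : D x -> 0 <= g x.
  move=> Dx; rewrite -(cvg_lim (@norm_hausdorff _ _) (fg x Dx)).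
  apply: limr_ge; first exact: cvgP (fg x Dx).
  by apply: nearW => i; exact: f0.
have bnd : (\int[mu]_(x in D) (g x)%:E <= M%:E)%E.
  have -> : (\int[mu]_(x in D) (g x)%:E = \int[mu]_(x in D) limn_einf (fun i => (f i x)%:E))%E.
    apply: eq_integral => x /set_mem Dx; apply/esym.
    have h : (f i x)%:E @[i --> \oo] --> (g x)%:E by apply: cvg_EFin; [exact: nearW|exact: fg].
    by rewrite (cvg_limn_einf_sup h).
  apply: le_trans (fatou mu mD _ _) _.
  - by move=> i; apply/measurable_EFinP; exact: mf.
  - by move=> i x Dx; rewrite lee_fin f0.
  rewrite limn_einf_lim; apply: lime_le; first exact: is_cvg_einfs.
  apply: nearW => i; apply: (@le_trans _ _ (\int[mu]_(x in D) (f i x)%:E)%E).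
    by apply: ereal_inf_lbound; exists i => /=.
  by rewrite EFin_Rintegral// lee_fin hM.
have gi : mu.-integrable D (EFin \o g).
  apply/integrableP; split; first exact/measurable_EFinP.
  under eq_integral => x /set_mem Dx do rewrite gee0_abs ?lee_fin ?g0//.
  by rewrite (le_lt_trans bnd)// ltry.
by split => //; rewrite -lee_fin -EFin_Rintegral.
Qed.

(* The squared partial sums of the absolutely convergent telescoping series have
   bounded integrals, so the series is finite outside a null set. *)
Lemma ae_cauchy_limit (t : nat -> R -> R[i]) (M : R) :
  (forall i, square_integrable (t i)) ->
  (forall N, \int[mu]_(x in halfline) (\sum_(i < N) normc (t i.+1 x - t i x)) ^+ 2 <= M) ->
  exists (A : set R) (u : R -> R[i]),
    [/\ measurable A, {ae mu, forall x, halfline x -> A x},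
        cmeasurable halfline u &
        forall x, halfline x -> (\1_A x)%:C * t i x @[i --> \oo] --> u x].
Proof.
move=> ti hM.
pose a i x := normc (t i.+1 x - t i x).
pose G N x := \sum_(i < N) a i x.
have a0 i x : 0 <= a i x by exact: normc_ge0.
have G0 N x : 0 <= G N x by apply: sumr_ge0.
have dt i : square_integrable (fun x => t i.+1 x - t i x).
  by apply: square_integrableD => //; exact: square_integrableN.
have mG N : measurable_fun halfline (G N).
  apply: measurable_sum => i; apply: measurable_normc => //.
  by case: (dt i).
have Gint N : mu.-integrable halfline (EFin \o (fun x => (G N x) ^+ 2)).
  suff [_] : square_integrable (fun x => (G N x)%:C).
    by under eq_fun do rewrite normc_real ger0_norm//.
  rewrite /G; elim: N => [|N ih].
    by under eq_fun do rewrite big_ord0; exact: square_integrable0.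
  under eq_fun do rewrite big_ord_recr rmorphD /=.
  apply: square_integrableD => //; split.
    by apply: cmeasurable_real; apply: measurable_normc => //; case: (dt N).
  by under eq_fun do rewrite normc_real ger0_norm ?normc_ge0//; case: (dt N).
pose g N x := ((G N x) ^+ 2)%:E.
have mg N : measurable_fun halfline (g N) by exact: measurable_int (Gint N).
have Gnd x : {homo G^~ x : n m / (n <= m)%N >-> n <= m}.
  move=> n m nm; rewrite /G -!(big_mkord xpredT (fun i => a i x)).
  by rewrite [leRHS](big_cat_nat (n := n))//= lerDl sumr_ge0.
have gnd x : {homo g^~ x : n m / (n <= m)%N >-> (n <= m)%E}.
  by move=> n m nm; rewrite lee_fin ler_sqr ?nnegrE// Gnd.
have gcvg x : g N x @[N --> \oo] --> limn (g^~ x).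
  exact: ereal_nondecreasing_is_cvgn.
have mlim : measurable_fun halfline (fun x => limn (g^~ x)).
  by apply: (@emeasurable_fun_cvg _ _ _ _ g) => // x _; exact: gcvg.
have lim0 x : (0 <= limn (g^~ x))%E.
  by apply: lime_ge; [exact: gcvg|apply: nearW => N; rewrite lee_fin sqr_ge0].
have limi : mu.-integrable halfline (fun x => limn (g^~ x)).
  apply/integrableP; split => //.
  under eq_integral do rewrite gee0_abs//.
  have h := @cvg_monotone_convergence _ _ _ mu halfline measurable_halfline g mg
    (fun N x _ => sqr_ge0 (G N x) : (0 <= g N x)%E) (fun x _ => gnd x).
  rewrite -(cvg_lim _ h)//; apply: (@le_lt_trans _ _ M%:E); last exact: ltry.
  apply: lime_le; first exact: cvgP h.
  by apply: nearW => N; rewrite EFin_Rintegral// lee_fin; exact: hM.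
pose A := halfline `&` [set x | limn (g^~ x) \is a fin_num].
have mA : measurable A by exact: emeasurable_fin_num.
have tcvg x : A x -> exists l : R[i], t i x @[i --> \oo] --> l.
  move=> [_ /= fin].
  have ub : has_ubound (range (G^~ x)).
    exists (fine (limn (g^~ x)) + 1) => _ [N _ <-].
    have : (g N x <= limn (g^~ x))%E.
      by apply: lime_ge; [exact: gcvg|exists N => //= m; exact: gnd].
    rewrite -[limn _]fineK// lee_fin => hN.
    have := G0 N x; have := sqr_ge0 (G N x - 1); nra.
  have cG : cvgn (G^~ x) by exact: nondecreasing_is_cvgn.
  have cs (h : R[i] -> R) : (forall z w, h (z - w) = h z - h w) ->
      (forall z, `|h z| <= normc z) -> cvgn (fun i => h (t i x)).
    move=> hB hle.
    have tel : (fun i => h (t i x)) = (fun i => series (fun i => h (t i.+1 x) - h (t i x)) i + h (t 0%N x)).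
      by apply/funext => i; rewrite seriesEnat /= telescope_sumr// subrK.
    rewrite tel; apply: is_cvgD; last exact: is_cvg_cst.
    apply: normed_cvg.
    apply: (@series_le_cvg _ _ (fun i => a i x)).
    - by move=> i; exact: normr_ge0.
    - by move=> i; exact: a0.
    - by move=> i; rewrite /= -hB hle.
    by rewrite (_ : series _ = G^~ x)//; apply/funext => N; rewrite seriesEord.
  have cr : cvgn (fun i => Re (t i x)).
    by apply: cs => [z w|z]; [rewrite ReD ReN|exact: Re_le_normc].
  have ci : cvgn (fun i => Im (t i x)).
    by apply: cs => [z w|z]; [rewrite ImD ImN|exact: Im_le_normc].
  exists (limn (fun i => Re (t i x)) +i* limn (fun i => Im (t i x))).
  apply/cvgCP => e e0.
  have e20 : 0 < e / 2 by rewrite divr_gt0.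
  move/cvgrPdist_lt/(_ _ e20) : cr => hr; move/cvgrPdist_lt/(_ _ e20) : ci => hi.
  near=> i; apply: le_lt_trans (normc_le_ReIm _) _.
  rewrite ReD ImD ReN ImN /= (splitr e) ltrD// distrC; near: i; [exact: hr|exact: hi].
have /choice[u hu] : forall x, exists l : R[i],
    halfline x -> (\1_A x)%:C * t i x @[i --> \oo] --> l.
  move=> x.
  have [Ax|nAx] := pselect (A x).
    have [l hl] := tcvg _ Ax; exists l => _.
    by rewrite indicE mem_set//; under eq_fun do rewrite mul1r.
  exists 0 => _; rewrite indicE memNset//; under eq_fun do rewrite mul0r; exact: cvg_cst.
exists A, u; split => //.
  have := @integrable_ae _ _ _ mu _ (measurable_itv _) _ limi.
  by apply: filterS => x h hx; split => //; exact: h.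
have m1 : cmeasurable halfline (fun x => (\1_A x)%:C : R[i]).
  by apply: cmeasurable_real; exact: measurable_indic.
have mt i : cmeasurable halfline (fun x => (\1_A x)%:C * t i x).
  by apply: cmeasurableM => //; case: (ti i).
have comp (h : R[i] -> R) : (forall z w, h (z - w) = h z - h w) ->
      (forall z, `|h z| <= normc z) -> forall x, halfline x -> h ((\1_A x)%:C * t i x) @[i --> \oo] --> h (u x).
  move=> hB hle x hx; apply/cvgrPdist_lt => e e0.
  move/cvgCP/(_ _ e0) : (hu x hx); apply: filterS => i.
  by rewrite distrC -hB => /(le_lt_trans (hle _)).
split.
  apply: (@measurable_fun_cvg _ _ _ _ (fun i x => Re ((\1_A x)%:C * t i x))).
    by move=> i; case: (mt i).
  by move=> x hx; apply: (comp (@complex.Re R)) => // [z w|z]; [rewrite ReD ReN|exact: Re_le_normc].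
apply: (@measurable_fun_cvg _ _ _ _ (fun i x => Im ((\1_A x)%:C * t i x))).
  by move=> i; case: (mt i).
by move=> x hx; apply: (comp (@complex.Im R)) => // [z w|z]; [rewrite ImD ImN|exact: Im_le_normc].
Unshelve. all: by end_near. Qed.

End RieszFischer.

Section Completeness.
Context {R : realType} {n : nat}.
Local Notation mu := (@lebesgue_measure R).
Local Notation starfun := ('I_n -> R -> R[i]).
Implicit Types (u v w : starfun).

Lemma normsq_component u j :
  \int[mu]_(x in halfline) (normc (u j x) ^+ 2) <= normsq u.
Proof.
rewrite /normsq (bigD1 j)//= lerDl; apply: sumr_ge0 => i _.
by apply: Rintegral_ge0 => x _; rewrite sqr_ge0.
Qed.

Lemma geometric_sum_le2 N : \sum_(i < N) (2 ^- i : R) <= 2.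
Proof.
suff : \sum_(i < N) (2 ^- i : R) = 2 - 2 * 2 ^- N.
  by move=> ->; rewrite gerBl mulr_ge0// invr_ge0 exprn_ge0.
elim: N => [|N ih]; first by rewrite big_ord0 expr0 invr1 mulr1 subrr.
by rewrite big_ord_recr /= ih exprS; field; rewrite expf_neq0.
Qed.

Lemma L2norm_triangle u v w : L2 u -> L2 v -> L2 w ->
  L2norm (ssub u w) <= L2norm (ssub u v) + L2norm (ssub v w).
Proof.
move=> hu hv hw.
have -> : ssub u w = sadd (ssub u v) (ssub v w).
  by apply/funext => j; apply/funext => x; rewrite /ssub /sadd subrKA.
by apply: L2normD; exact: L2B.
Qed.

Lemma L2_complete_rapid (t : nat -> starfun) : (forall i, L2 (t i)) ->
  (forall i k, (i <= k)%N -> L2norm (ssub (t k) (t i)) <= 2 ^- i) ->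
  exists2 u, L2 u & forall k, L2norm (ssub u (t k)) <= n%:R * 2 ^- k.
Proof.
move=> ti tc.
have step N j : \int[mu]_(x in halfline)
    (\sum_(i < N) normc (t i.+1 j x - t i j x)) ^+ 2 <= 4.
  pose F i : starfun := fun j x => (normc (t i.+1 j x - t i j x))%:C.
  have hF i : L2 (F i).
    move=> k; have [m1 i1] := L2B (ti i.+1) (ti i) k; split.
      by apply: cmeasurable_real; exact: measurable_normc.
    by under eq_fun do rewrite normc_real ger0_norm ?normc_ge0//.
  have nF i : L2norm (F i) = L2norm (ssub (t i.+1) (t i)).
    rewrite !L2normE; congr Num.sqrt; apply: eq_bigr => k _.
    by apply: eq_Rintegral => x _; rewrite normc_real ger0_norm ?normc_ge0.
  have hS := @L2norm_ssum R n _ (index_enum 'I_N) (fun i : 'I_N => F i) (fun i => hF i).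
  have : L2norm (ssum (index_enum 'I_N) (fun i => F i)) <= 2.
    apply: (le_trans hS).
    apply: le_trans (geometric_sum_le2 N); apply: ler_sum => i _.
    by rewrite nF; exact: tc.
  move=> h2; have h : normsq (ssum (index_enum 'I_N) (fun i : 'I_N => F i)) <= 2 ^+ 2.
    by rewrite -sqr_L2norm ler_sqr ?nnegrE ?L2norm_ge0.
  apply: (@le_trans _ _ (2 ^+ 2)); last by rewrite expr2 -natrM.
  apply: le_trans h; apply: le_trans (normsq_component _ j).
  rewrite le_eqVlt; apply/orP; left; apply/eqP; apply: eq_Rintegral => x _.
  by rewrite /ssum /F -rmorph_sum normc_real ger0_norm// sumr_ge0// => i _; exact: normc_ge0.
have H j := ae_cauchy_limit (fun i => ti i j) (fun N => step N j).
have /choice[A HA] := H.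
have /choice[u Hu] := HA.
have fat k j : mu.-integrable halfline (EFin \o (fun x => normc (u j x - (\1_(A j) x)%:C * t k j x) ^+ 2)) /\
    \int[mu]_(x in halfline) (normc (u j x - (\1_(A j) x)%:C * t k j x) ^+ 2) <= (2 ^- k) ^+ 2.
  have [mA aeA mu1 hlim] := Hu j.
  have m1 : cmeasurable halfline (fun x => (\1_(A j) x)%:C : R[i]).
    by apply: cmeasurable_real; exact: measurable_indic.
  have le1 i x : normc ((\1_(A j) x)%:C * t i j x - (\1_(A j) x)%:C * t k j x) ^+ 2 <=
      normc (t i j x - t k j x) ^+ 2.
    rewrite -mulrBr Normc.normcM exprMn ler_piMl ?sqr_ge0//.
    by rewrite normc_real real_normK ?num_real// indicE; case: (_ \in _); rewrite ?expr0n ?expr1n.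
  have fi i : mu.-integrable halfline (EFin \o (fun x =>
      normc ((\1_(A j) x)%:C * t (i + k)%N j x - (\1_(A j) x)%:C * t k j x) ^+ 2)).
    have [msq isq] := L2B (ti (i + k)%N) (ti k) j.
    suff [] : square_integrable (fun x => (\1_(A j) x)%:C * t (i + k)%N j x - (\1_(A j) x)%:C * t k j x) by [].
    apply: le_square_integrable isq _; last by move=> x _; exact: le1.
    apply: cmeasurableB => //; apply: cmeasurableM => //.
      by case: (ti (i + k)%N j).
    by case: (ti k j).
  apply: (fatou_bound _ fi) => //.
  - by move=> i x _; rewrite sqr_ge0.
  - move=> x hx; apply: (@cvg_comp _ _ _ _ (fun y : R => y ^+ 2) _ (nbhs (normc (u j x - (\1_(A j) x)%:C * t k j x)))); last first.
      exact: exprn_continuous.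
    apply/cvgrPdist_lt => e e0; have /cvgCP/(_ _ e0) := hlim x hx.
    move=> [N _ hN]; exists N => // i /= Ni; have /= := hN (i + k)%N (leq_trans Ni (leq_addr _ _)).
    apply: le_lt_trans.
    set z := (\1_(A j) x)%:C * t (i + k)%N j x; set w := (\1_(A j) x)%:C * t k j x.
    apply: le_trans (ler_dist_normc _ _) _.
    by rewrite opprB addrA subrK normc_distC.
  move=> i; apply: (@le_trans _ _ (normsq (ssub (t (i + k)%N) (t k)))).
    apply: le_trans (normsq_component _ j); apply: le_Rintegral.
    - exact: measurable_halfline.
    - exact: fi.
    - by case: (L2B (ti (i + k)%N) (ti k) j).
    - by move=> x _; exact: le1.
  by rewrite -sqr_L2norm ler_sqr ?nnegrE ?L2norm_ge0 ?invr_ge0 ?exprn_ge0// tc// leq_addl.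
have mAt k j : cmeasurable halfline (fun x => (\1_(A j) x)%:C * t k j x).
  have [mA _ _ _] := Hu j; apply: cmeasurableM => //; last by case: (ti k j).
  by apply: cmeasurable_real; exact: measurable_indic.
have L2d k : L2 (fun j x => u j x - (\1_(A j) x)%:C * t k j x).
  move=> j; have [mA _ mu1 _] := Hu j; split; first exact: cmeasurableB.
  by have [] := fat k j.
have L2t k : L2 (fun j x => (\1_(A j) x)%:C * t k j x).
  move=> j; apply: le_square_integrable (proj2 (ti k j)) _; first exact: mAt.
  move=> x _; rewrite Normc.normcM exprMn ler_piMl ?sqr_ge0//.
  by rewrite normc_real real_normK ?num_real// indicE; case: (_ \in _); rewrite ?expr0n ?expr1n.
have L2u : L2 u.
  have -> : u = sadd (fun j x => u j x - (\1_(A j) x)%:C * t 0%N j x) (fun j x => (\1_(A j) x)%:C * t 0%N j x).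
    by apply/funext => j; apply/funext => x; rewrite /sadd subrK.
  exact: L2D.
exists u => // k; rewrite L2normE.
have le_nn : normsq (ssub u (t k)) <= n%:R * (2 ^- k) ^+ 2.
  apply: (@le_trans _ _ (\sum_(j < n) (2 ^- k) ^+ 2)); last first.
    by rewrite sumr_const card_ord mulr_natl.
  apply: ler_sum => j _; apply: le_trans (proj2 (fat k j)).
  rewrite le_eqVlt; apply/orP; left; apply/eqP.
  have [mA aeA _ _] := Hu j; congr fine.
  apply: ae_eq_integral => //.
  - by have [_ /measurable_int] := L2B L2u (ti k) j.
  - by have [/measurable_int] := fat k j.
  - apply: (@filterS _ _ (ae_filter_ringOfSetsType _) _ _ _ aeA) => x hx Dx; rewrite indicE mem_set ?mul1r//; exact: hx.
apply: (@le_trans _ _ (Num.sqrt ((n%:R * 2 ^- k) ^+ 2))).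
  apply: ler_wsqrtr; apply: le_trans le_nn _.
  rewrite exprMn ler_wpM2r ?sqr_ge0//.
  by rewrite -natrX ler_nat; case: (n) => // m; rewrite leq_pmulr.
by rewrite sqrtr_sqr ger0_norm// mulr_ge0// invr_ge0 exprn_ge0.
Qed.

End Completeness.

Section Parseval.
Context {R : realType} {n : nat}.
Local Notation mu := (@lebesgue_measure R).
Local Notation starfun := ('I_n -> R -> R[i]).
Implicit Types (u v w : starfun).

Lemma L2norm_ae0 u : L2 u -> L2_eq u (fun _ _ => 0) -> L2norm u = 0.
Proof.
move=> hu h; rewrite L2normE /normsq big1 ?sqrtr0// => j _.
rewrite /Rintegral (@ae_eq_integral _ _ _ mu halfline (fun=> 0%E)) ?integral0//.
  by have [_ /measurable_int] := hu j.
by apply: filterS (h j) => x e /e ->; rewrite Normc.normc0 expr0n.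
Qed.

Lemma normsq0 : normsq ((fun _ _ => 0) : starfun) = 0.
Proof.
rewrite /normsq big1// => j _.
by under eq_Rintegral do rewrite Normc.normc0 expr0n; rewrite /Rintegral integral0.
Qed.

Definition fourier_sum (e : nat -> starfun) u N : starfun :=
  fun j x => \sum_(k < N) inner (e k) u * e k j x.

Section Basis.
Variable e : nat -> starfun.
Hypothesis he : orthonormal_basis e.

Let eL2 k : L2 (e k). Proof. by case: he. Qed.
Let eorth k l : inner (e k) (e l) = (k == l)%:R. Proof. by case: he. Qed.

Lemma L2_fourier_sum u N : L2 (fourier_sum e u N).
Proof. by apply: (@L2_ssum _ _ _ _ (fun k : 'I_N => sscale _ (e k))) => k; exact: L2Z. Qed.

Lemma inner_basis_fourier_sum u N l : (l < N)%N ->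
  inner (e l) (fourier_sum e u N) = inner (e l) u.
Proof.
move=> lN; rewrite (@inner_ssumr _ _ _ _ _ (fun k : 'I_N => sscale (inner (e k) u) (e k)))//; last first.
  by move=> k; exact: L2Z.
rewrite (bigD1 (Ordinal lN))//= innerZr// eorth eqxx mulr1 big1 ?addr0// => k kl.
rewrite innerZr// eorth; case: eqP => [lk|]; last by rewrite mulr0.
by move: kl; rewrite -val_eqE /= -lk eqxx.
Qed.

Lemma normsq_fourier_sumB u N M : (N <= M)%N ->
  normsq (ssub (fourier_sum e u M) (fourier_sum e u N)) =
  \sum_(N <= k < M) normc (inner (e k) u) ^+ 2.
Proof.
move=> NM; have -> : ssub (fourier_sum e u M) (fourier_sum e u N) =
    ssum (index_iota N M) (fun k => sscale (inner (e k) u) (e k)).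
  apply/funext => j; apply/funext => x; rewrite /ssub /fourier_sum /ssum /sscale.
  rewrite -!(big_mkord xpredT (fun k => inner (e k) u * e k j x)).
  by rewrite [X in X - _](big_cat_nat (n := N))//= [X in X - _]addrC addrK.
elim: M NM => [|M ih].
  by rewrite leqn0 => /eqP->; rewrite !big_geq// /index_iota subnn ssum_nil normsq0.
rewrite leq_eqVlt => /predU1P[->|NM].
  by rewrite /index_iota subnn ssum_nil normsq0 big_nil.
have hL2 r : L2 (ssum r (fun k => sscale (inner (e k) u) (e k))).
  by apply: L2_ssum => k; exact: L2Z.
have -> : ssum (index_iota N M.+1) (fun k => sscale (inner (e k) u) (e k)) =
    sadd (ssum (index_iota N M) (fun k => sscale (inner (e k) u) (e k)))
      (sscale (inner (e M) u) (e M)).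
  by apply/funext => j; apply/funext => x; rewrite /ssum big_nat_recr.
rewrite normsqD//; last exact: L2Z.
rewrite ih// big_nat_recr//= normsqZ// -[normsq (e M)]ReC -inner_self eorth eqxx /= mulr1.
rewrite innerZr// inner_ssuml//; last by move=> k; exact: L2Z.
suff -> : \sum_(N <= i < M) inner (sscale (inner (e i) u) (e i)) (e M) = 0.
  by rewrite mulr0 /= mulr0 addr0.
rewrite big_nat; apply: big1 => k /andP[_ kM].
by rewrite innerZl// eorth ltn_eqF// mulr0.
Qed.

Lemma inner_fourier_residual u N : L2 u ->
  inner (fourier_sum e u N) (ssub u (fourier_sum e u N)) = 0.
Proof.
move=> hu; rewrite (@inner_ssuml _ _ _ _ _ (fun k : 'I_N => sscale (inner (e k) u) (e k))); last 2 first.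
- by apply: L2B => //; exact: L2_fourier_sum.
- by move=> k; exact: L2Z.
rewrite big1// => k _; rewrite innerZl//; last by apply: L2B => //; exact: L2_fourier_sum.
rewrite innerBr//; last exact: L2_fourier_sum.
by rewrite inner_basis_fourier_sum// subrr mulr0.
Qed.

Lemma normsq_fourier_residual u N : L2 u ->
  normsq (ssub u (fourier_sum e u N)) =
  normsq u - \sum_(0 <= k < N) normc (inner (e k) u) ^+ 2.
Proof.
move=> hu; have hr : L2 (ssub u (fourier_sum e u N)).
  by apply: L2B => //; exact: L2_fourier_sum.
have -> : normsq u = normsq (sadd (fourier_sum e u N) (ssub u (fourier_sum e u N))).
  congr normsq; apply/funext => j; apply/funext => x; rewrite /sadd /ssub addrC subrK//.
rewrite normsqD//; last exact: L2_fourier_sum.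
rewrite inner_fourier_residual// mulr0 addr0.
rewrite -(normsq_fourier_sumB u (leq0n N)).
suff -> : ssub (fourier_sum e u N) (fourier_sum e u 0) = fourier_sum e u N.
  by rewrite [RHS]addrC addKr.
by apply/funext => j; apply/funext => x; rewrite /ssub /fourier_sum big_ord0 subr0.
Qed.

Lemma bessel u N : L2 u -> \sum_(k < N) normc (inner (e k) u) ^+ 2 <= normsq u.
Proof.
move=> hu; rewrite -subr_ge0 -(big_mkord xpredT (fun k => normc (inner (e k) u) ^+ 2)).
by rewrite -normsq_fourier_residual// normsq_ge0.
Qed.

Lemma fourier_sum_cvg u (eps : R) : L2 u -> 0 < eps ->
  exists N0, forall N, (N0 <= N)%N -> L2norm (ssub u (fourier_sum e u N)) <= eps.
Proof.
move=> hu eps0.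
pose c := series (fun k => normc (inner (e k) u) ^+ 2).
have cE N : c N = \sum_(0 <= k < N) normc (inner (e k) u) ^+ 2 by [].
have cnd : {homo c : n m / (n <= m)%N >-> n <= m}.
  by apply: nondecreasing_series => k _ _; exact: sqr_ge0.
have cc : cvgn c.
  apply: nondecreasing_is_cvgn => //; exists (normsq u) => _ [N _ <-].
  by rewrite cE big_mkord bessel.
have tail i : exists N0, forall M N, (N0 <= N)%N -> (N <= M)%N -> c M - c N <= (2 ^- i) ^+ 2.
  have pos : 0 < (2 ^- i : R) ^+ 2 by rewrite exprn_gt0// invr_gt0 exprn_gt0.
  have /cvgrPdist_le/(_ _ pos)[N0 _ hN0] := cc.
  exists N0 => M N h1 h2; apply: le_trans (hN0 N h1); apply: le_trans (ler_norm _).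
  by rewrite lerD2r; exact: nondecreasing_cvgn_le.
have /choice[phi hphi] := tail.
pose psi i := (i + \max_(l < i.+1) phi l)%N.
have psi_phi i : (phi i <= psi i)%N.
  by apply: leq_trans (leq_addl _ _); exact: (leq_bigmax (ord_max : 'I_i.+1)).
have psi_mono i k : (i <= k)%N -> (psi i <= psi k)%N.
  move=> ik; rewrite leq_add//; apply/bigmax_leqP => l _.
  have lk : (l < k.+1)%N by apply: leq_trans (ltn_ord l) _.
  exact: (leq_bigmax (Ordinal lk)).
have [|i k ik|s hs sc] := @L2_complete_rapid R n (fun i => fourier_sum e u (psi i)).
- by move=> i; exact: L2_fourier_sum.
- rewrite L2normE normsq_fourier_sumB ?psi_mono//.
  apply: (@le_trans _ _ (Num.sqrt ((2 ^- i) ^+ 2))); last first.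
    by rewrite sqrtr_sqr ger0_norm// invr_ge0 exprn_ge0.
  apply: ler_wsqrtr; apply: le_trans (hphi i (psi k) (psi i) _ _) => //; last exact: psi_mono.
  by rewrite (cE (psi k)) (cE (psi i)) [X in _ <= X - _](big_cat_nat (n := psi i)) ?psi_mono//= [X in X - _]addrC addrK.
have hB : L2 (ssub u s) by exact: L2B.
have small (x : R) : 0 <= x -> (forall i, x <= n%:R * 2 ^- i) -> x = 0.
  move=> x0 h; apply/eqP; rewrite eq_le x0 andbT; apply/ler_addgt0Pr => d d0.
  have [i hi] : exists i, n%:R * 2 ^- i <= d :> R.
    have h1 : (n%:R * 2 ^- i : R) @[i --> \oo] --> (n%:R * 0 : R).
      apply: cvgM; first exact: cvg_cst.
      under eq_fun do rewrite -exprVn; apply: cvg_expr.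
      by rewrite ger0_norm ?invr_ge0// invf_lt1// ltr1n.
    move: h1; rewrite mulr0 => /cvgrPdist_le/(_ _ d0)[i _ hi].
    by exists i; have := hi i (leqnn _); rewrite sub0r normrN => /(le_trans (ler_norm _)).
  by rewrite add0r (le_trans (h i)).
have orth l : inner (e l) (ssub u s) = 0.
  apply: Normc.eq0_normc; apply: small; first exact: normc_ge0.
  move=> i; pose m := maxn i l.+1.
  have -> : inner (e l) (ssub u s) = inner (e l) (ssub u (fourier_sum e u (psi m))) -
      inner (e l) (ssub s (fourier_sum e u (psi m))).
    rewrite !innerBr//; last 2 first; try exact: L2_fourier_sum.
    by rewrite opprB addrA subrK.
  rewrite innerBr//; last exact: L2_fourier_sum.
  rewrite inner_basis_fourier_sum; last first.
    apply: leq_trans (leq_addr _ _); exact: leq_maxr.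
  rewrite subrr sub0r normcN; apply: le_trans (cauchy_schwarz _ _) _ => //.
    by apply: L2B => //; exact: L2_fourier_sum.
  rewrite L2normE -[normsq (e l)]ReC -inner_self eorth eqxx /= sqrtr1 mul1r.
  apply: le_trans (sc m) _; rewrite ler_wpM2l// lef_pV2 ?posrE ?exprn_gt0//.
  by rewrite ler_eXn2l ?ltr1n// leq_maxl.
have us0 : L2norm (ssub u s) = 0 by apply: L2norm_ae0 => //; case: he => _ _; exact.
have lim0 i : L2norm (ssub u (fourier_sum e u (psi i))) <= n%:R * 2 ^- i.
  apply: le_trans (L2norm_triangle hu hs (L2_fourier_sum _ _)) _.
  by rewrite us0 add0r.
apply: contrapT => hno.
have big i : eps <= n%:R * 2 ^- i.
  rewrite leNgt; apply/negP => hi; apply: hno; exists (psi i) => N hN.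
  apply: le_trans (ltW hi); apply: le_trans (lim0 i); rewrite !L2normE ler_wsqrtr//.
  by rewrite !normsq_fourier_residual// lerD2l lerN2; exact: cnd.
by have := small eps (ltW eps0) big => h; move: eps0; rewrite h ltxx.
Qed.

Lemma parseval u v : L2 u -> L2 v ->
  \sum_(k < N) inner v (e k) * inner (e k) u @[N --> \oo] --> inner v u.
Proof.
move=> hu hv; apply/cvgCP => eps eps0.
have pos : 0 < eps / (L2norm v + 1) by rewrite divr_gt0// ltr_wpDl ?L2norm_ge0.
have [N0 hN0] := fourier_sum_cvg hu pos.
exists N0 => // N /= hN.
have -> : \sum_(k < N) inner v (e k) * inner (e k) u = inner v (fourier_sum e u N).
  rewrite (@inner_ssumr _ _ _ _ _ (fun k : 'I_N => sscale (inner (e k) u) (e k)))//; last first.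
    by move=> k; exact: L2Z.
  by apply: eq_bigr => k _; rewrite innerZr// mulrC.
rewrite normc_distC -innerBr//; last exact: L2_fourier_sum.
apply: le_lt_trans (cauchy_schwarz hv (L2B hu (L2_fourier_sum u N))) _.
have := hN0 N hN; rewrite ler_pdivlMr ?ltr_wpDl ?L2norm_ge0// => h.
have := L2norm_ge0 (ssub u (fourier_sum e u N)) => p.
have [->|nz] := eqVneq (L2norm (ssub u (fourier_sum e u N))) 0; first by rewrite mulr0.
have : 0 < L2norm (ssub u (fourier_sum e u N)) by rewrite lt_neqAle eq_sym nz p.
nra.
Qed.

End Basis.
End Parseval.

(** * Fredholm determinants *)

Section DetConvergence.
Context {R : realType}.

Lemma cvgC_prod (T : Type) (r : seq T) (f : nat -> T -> R[i]) (g : T -> R[i]) :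
  (forall k, f i k @[i --> \oo] --> g k) ->
  \prod_(k <- r) f i k @[i --> \oo] --> \prod_(k <- r) g k.
Proof.
move=> h; elim: r => [|k r ih].
  rewrite big_nil; under eq_fun do rewrite big_nil; exact: cvg_cst.
by rewrite big_cons; under eq_fun do rewrite big_cons; apply: (@cvgM R[i]); [exact: h|exact: ih].
Qed.

Lemma cvgC_sum (T : Type) (r : seq T) (f : nat -> T -> R[i]) (g : T -> R[i]) :
  (forall k, f i k @[i --> \oo] --> g k) ->
  \sum_(k <- r) f i k @[i --> \oo] --> \sum_(k <- r) g k.
Proof.
move=> h; elim: r => [|k r ih].
  rewrite big_nil; under eq_fun do rewrite big_nil; exact: cvg_cst.
by rewrite big_cons; under eq_fun do rewrite big_cons; apply: cvgD; [exact: h|exact: ih].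
Qed.

Lemma det_cvg N (A : nat -> 'M[R[i]]_N) (B : 'M[R[i]]_N) :
  (forall k l, A i k l @[i --> \oo] --> B k l) ->
  \det (A i) @[i --> \oo] --> \det B.
Proof.
move=> h; apply: cvgC_sum => s.
by apply: (@cvgM R[i]); [exact: cvg_cst|exact: cvgC_prod].
Qed.

End DetConvergence.

Section Fredholm.
Context {R : realType} {n : nat}.
Local Notation starfun := ('I_n -> R -> R[i]).
Implicit Types (u v w : starfun) (f g : nat -> starfun).

Definition rank1_sum (I : finType) (F G : I -> starfun) u : starfun :=
  fun j x => \sum_nu inner (F nu) u * G nu j x.

Definition gram_det K (F G : 'I_K -> starfun) : R[i] :=
  \det (1%:M + \matrix_(nu < K, nu' < K) inner (F nu) (G nu')).

Lemma L2_rank1_sum (I : finType) (F G : I -> starfun) u :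
  (forall i, L2 (G i)) -> L2 (rank1_sum F G u).
Proof.
by move=> h; apply: (@L2_ssum _ _ _ _ (fun i => sscale _ (G i))) => i; exact: L2Z.
Qed.

Lemma inner_rank1_sum (I : finType) (F G : I -> starfun) u v :
  (forall i, L2 (G i)) -> L2 v ->
  inner v (rank1_sum F G u) = \sum_i inner v (G i) * inner (F i) u.
Proof.
move=> h hv; rewrite (@inner_ssumr _ _ _ _ _ (fun i => sscale (inner (F i) u) (G i)))//; last first.
  by move=> i; exact: L2Z.
by apply: eq_bigr => i _; rewrite innerZr// mulrC.
Qed.

Theorem fredholm_det_approx (T : starfun -> starfun) f g (d : R[i])
    (len : nat -> nat) (K : nat -> nat)
    (F G : forall m, 'I_(K m) -> starfun) :
  (forall u, L2 u -> L2 (T u)) ->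
  (forall k, L2 (f k) /\ L2 (g k)) ->
  cvgn (series (fun k => L2norm (f k) * L2norm (g k))) ->
  (forall u, L2 u ->
    (fun N : nat => L2norm (fun j x =>
       T u j x - \sum_(k < N) inner (f k) u * g k j x)) @ \oo --> (0 : R)) ->
  (forall m, (m <= len m)%N) ->
  (forall m nu, L2 (F m nu) /\ L2 (G m nu)) ->
  (forall m u, L2 u -> (fun j x => \sum_(k < len m) inner (f k) u * g k j x) =
    rank1_sum (F m) (G m) u) ->
  gram_det (F m) (G m) @[m --> \oo] --> d ->
  fredholm_det T d.
Proof.
move=> hT fgL2 cfg approx lenm FGL2 FGE dcvg; split; first by exists f, g.
move=> e he; have eL2 k : L2 (e k) by case: he.
pose S := series (fun k => L2norm (f k) * L2norm (g k)).
pose a := limn S.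
have Snd : {homo S : n m / (n <= m)%N >-> n <= m}.
  by apply: nondecreasing_series => k _ _; rewrite mulr_ge0 ?L2norm_ge0.
have Sa M : S M <= a by exact: nondecreasing_cvgn_le.
have Scvg : S M @[M --> \oo] --> a by exact: cfg.
pose x N i := fun k : 'I_N => inner (e k) (g i).
pose y N i := fun l : 'I_N => inner (f i) (e l).
have vx N i : vnorm (x N i) <= L2norm (g i).
  by rewrite L2normE ler_wsqrtr//; apply: (bessel he); case: (fgL2 i).
have vy N i : vnorm (y N i) <= L2norm (f i).
  rewrite L2normE ler_wsqrtr//; apply: le_trans (bessel he N (proj1 (fgL2 i))).
  by apply: ler_sum => l _; rewrite /y (inner_conj (eL2 l) (proj1 (fgL2 i))) normc_conj.
have vxy N i : vnorm (x N i) * vnorm (y N i) <= L2norm (f i) * L2norm (g i).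
  by rewrite mulrC; apply: ler_pM; rewrite ?vnorm_ge0.
have vsum N M : \sum_(i < M) vnorm (x N i) * vnorm (y N i) <= a.
  apply: le_trans (Sa M); rewrite /S seriesEord /=; apply: ler_sum => i _; exact: vxy.
pose X N := \det (\matrix_(k < N, l < N) ((k == l)%:R + inner (e k) (T (e l)))).
pose Y N M := \det (1%:M + sum_rank1 (x N) (y N) M).
pose C := 2 * growth (a + 1).
have C0 : 0 <= C by rewrite mulr_ge0// growth_ge0.
have YX N : Y N M @[M --> \oo] --> X N.
  apply: det_cvg => k l; rewrite !mxE; under eq_fun do rewrite !mxE.
  apply: cvgD; first exact: cvg_cst.
  have hgL2 M : L2 (fun j x => \sum_(k < M) inner (f k) (e l) * g k j x).
    by apply: (@L2_rank1_sum _ (fun i : 'I_M => f i) (fun i : 'I_M => g i)) => i; case: (fgL2 i).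
  have hTl : L2 (T (e l)) by exact: hT.
  apply/cvgCP => eps eps0; have /cvgrPdist_lt/(_ _ eps0) := approx _ (eL2 l).
  apply: filterS => M; rewrite sub0r normrN ger0_norm ?L2norm_ge0// => hM.
  have -> : \sum_(i < M) x N i k * y N i l =
      inner (e k) (fun j x => \sum_(k < M) inner (f k) (e l) * g k j x).
    by rewrite (@inner_rank1_sum _ (fun i : 'I_M => f i) (fun i : 'I_M => g i))// => i; case: (fgL2 i).
  rewrite normc_distC -innerBr//.
  apply: le_lt_trans (cauchy_schwarz (eL2 k) (L2B hTl (hgL2 M))) _.
  rewrite L2normE -[normsq (e k)]ReC -inner_self; have [_ -> _] := he.
  by rewrite eqxx /= sqrtr1 mul1r.
have Ybnd N M : normc (X N - Y N M) <= (a - S M) * C.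
  have lim : normc (Y N (i + M)%N - Y N M) @[i --> \oo] --> normc (X N - Y N M).
    apply/cvgrPdist_lt => eps eps0.
    have /cvgCP/(_ _ eps0)[N0 _ hN0] := YX N.
    exists N0 => // i /= Ni; have /= h := hN0 (i + M)%N (leq_trans Ni (leq_addr _ _)).
    apply: le_lt_trans (ler_dist_normc _ _) _; apply: le_lt_trans h.
    by rewrite opprB addrA subrK normc_distC.
  rewrite -(cvg_lim (@norm_hausdorff _ _) lim); apply: limr_le; first exact: cvgP lim.
  apply: nearW => i; rewrite addnC.
  apply: le_trans (det_sum_rank1_diff M i (vsum N)) _; rewrite ler_wpM2r//.
  apply: (@le_trans _ _ (S (M + i)%N - S M)); last by rewrite lerD2r.
  rewrite /S /series /= [X in _ <= X - _](big_cat_nat (n := M)) ?leq_addr//=.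
  by rewrite [X in _ <= X - _]addrC addrK; apply: ler_sum => k _; exact: vxy.
have Ylim m : Y N (len m) @[N --> \oo] --> gram_det (F m) (G m).
  have YE N : Y N (len m) = \det (1%:M + \matrix_(nu < K m, nu' < K m)
      \sum_(k < N) inner (F m nu) (e k) * inner (e k) (G m nu')).
    pose XX : 'M[R[i]]_(N, K m) := \matrix_(k, nu) inner (e k) (G m nu).
    pose YY : 'M[R[i]]_(K m, N) := \matrix_(nu, l) inner (F m nu) (e l).
    have -> : Y N (len m) = \det (1%:M + XX *m YY).
      congr (\det (_ + _)); apply/matrixP => k l; rewrite !mxE.
      under [RHS]eq_bigr do rewrite !mxE.
      rewrite -(inner_rank1_sum (F m) (e l)) ?eL2//; last by move=> i; case: (FGL2 m i).
      rewrite -FGE// (@inner_rank1_sum _ (fun i : 'I_(len m) => f i) (fun i : 'I_(len m) => g i))//.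
      by move=> i; case: (fgL2 i).
    rewrite det_sylvester; congr (\det (_ + _)); apply/matrixP => k l; rewrite !mxE.
    by apply: eq_bigr => i _; rewrite !mxE.
  under eq_fun do rewrite YE.
  apply: det_cvg => k l; rewrite !mxE; under eq_fun do rewrite !mxE.
  apply: cvgD; first exact: cvg_cst.
  by apply: (parseval he); [case: (FGL2 m l)|case: (FGL2 m k)].
apply/cvgCP => eps eps0; rewrite -/X.
have e3 : 0 < eps / 3 by rewrite divr_gt0.
have [m [hm1 hm2]] : exists m, (a - S (len m)) * C < eps / 3 /\
    normc (gram_det (F m) (G m) - d) < eps / 3.
  have /cvgCP/(_ _ e3)[m1 _ hm1] := dcvg.
  have p2 : 0 < eps / 3 / (C + 1) by rewrite divr_gt0// ltr_wpDl.
  have /cvgrPdist_lt/(_ _ p2)[m2 _ hm2] := Scvg.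
  exists (maxn m1 m2); split; last by apply: hm1; rewrite /= leq_maxl.
  have /= := hm2 (len (maxn m1 m2)) (leq_trans (leq_maxr _ _) (lenm _)).
  move/(le_lt_trans (ler_norm _)); rewrite ltr_pdivlMr ?ltr_wpDl//.
  apply: le_lt_trans; rewrite ler_wpM2l ?lerDl// subr_ge0; exact: Sa.
have /cvgCP/(_ _ e3) := Ylim m; apply: filterS => N hN.
have -> : X N - d = (X N - Y N (len m)) + (Y N (len m) - gram_det (F m) (G m)) +
    (gram_det (F m) (G m) - d) by rewrite subrKA subrKA.
apply: le_lt_trans (normcD _ _) _.
have := normcD (X N - Y N (len m)) (Y N (len m) - gram_det (F m) (G m)).
have := Ybnd N (len m); lra.
Qed.

End Fredholm.

(** * Absolutely continuous functions *)

Section AbsolutelyContinuous.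
Context {R : realType}.
Local Notation mu := (@lebesgue_measure R).
Implicit Types (u v du dv g : R -> R[i]) (a b s t x : R).

Lemma itv_split0 s t : 0 <= s -> s <= t -> `[0, t]%classic = `[0, s]%classic `|` `]s, t]%classic :> set R.
Proof. by move=> s0 st; rewrite -itv_bndbnd_setU// bnd_simp. Qed.

Lemma itv_split0_disj s t : [disjoint `[0, s]%classic & (`]s, t]%classic : set R)].
Proof.
apply/disj_setPS => y [/=]; rewrite !in_itv/= => /andP[_ ys] /andP[].
by rewrite ltNge ys.
Qed.

Lemma itvoc_sub s t x y : s <= x -> y <= t -> `]x, y] `<=` (`]s, t] : set R).
Proof.
move=> sx yt z /=; rewrite !in_itv/= => /andP[xz zy].
by rewrite (le_lt_trans sx xz) (le_trans zy yt).
Qed.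

Lemma itvoc_sub_cc s t b : 0 <= s -> t <= b -> `]s, t] `<=` (`[0, b] : set R).
Proof.
move=> s0 tb z /=; rewrite !in_itv/= => /andP[xz zy].
by rewrite (le_trans zy tb) andbT (le_trans s0)// ltW.
Qed.

Lemma itvoc_sub_halfline s t : 0 <= s -> `]s, t] `<=` (halfline : set R).
Proof.
move=> s0 z /=; rewrite /halfline /= in_itv/= => /andP[xz zy].
by rewrite in_itv/= andbT (le_trans s0)// ltW.
Qed.

Lemma itvcc_sub_halfline b : `[0, b] `<=` (halfline : set R).
Proof. by move=> z /=; rewrite /halfline /= in_itv/= => /andP[z0 _]; rewrite in_itv/= z0. Qed.

Lemma itvcc_sub a b : a <= b -> `[0, a] `<=` (`[0, b] : set R).
Proof.
move=> ab z /=; rewrite !in_itv/= => /andP[-> za]; exact: le_trans za ab.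
Qed.

Lemma cint_incr g s t : 0 <= s -> s <= t -> cintegrable `[0, t] g ->
  cint `[0, t] g - cint `[0, s] g = cint `]s, t] g.
Proof.
move=> s0 st ig; rewrite (itv_split0 s0 st) cint_setU//.
- by rewrite addrC addKr.
- exact: itv_split0_disj.
- by rewrite -itv_split0.
Qed.

Definition variation g t : R := \int[mu]_(x in `[0, t]) normc (g x).

Lemma variation_incr g s t : 0 <= s -> s <= t -> cintegrable `[0, t] g ->
  variation g t - variation g s = \int[mu]_(x in `]s, t]) normc (g x).
Proof.
move=> s0 st ig; rewrite /variation (itv_split0 s0 st) Rintegral_setU//.
- by rewrite addrC addKr.
- by rewrite -itv_split0//; apply: cintegrable_normc.
- exact: itv_split0_disj.
Qed.

Lemma ler_variation g s t : 0 <= s -> s <= t -> cintegrable `[0, t] g ->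
  variation g s <= variation g t.
Proof.
move=> s0 st ig; rewrite -subr_ge0 variation_incr//.
by apply: Rintegral_ge0 => x _; exact: normc_ge0.
Qed.

Lemma normc_cint_incr g s t : 0 <= s -> s <= t -> cintegrable `[0, t] g ->
  normc (cint `]s, t] g) <= variation g t - variation g s.
Proof.
move=> s0 st ig; rewrite variation_incr//; apply: normc_cint => //.
exact: cintegrableS (itvoc_sub_cc s0 (lexx t)) ig.
Qed.

Lemma variation_continuous g b : 0 <= b -> cintegrable `[0, b] g ->
  {within `[0, b], continuous (variation g)}.
Proof.
move=> b0 ig; apply: parameterized_integral_continuous => //.
exact: cintegrable_normc.
Qed.

Lemma ac_incr u du s t : ac_deriv u du -> 0 <= s -> s <= t ->
  u t - u s = cint `]s, t] du.
Proof.
move=> h s0 st; have t0 := le_trans s0 st.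
have [it ->] := h t t0; have [_ ->] := h s s0.
by rewrite -cint_incr// opprD addrACA subrr add0r.
Qed.

Lemma ac_integrable u du b : ac_deriv u du -> 0 <= b -> cintegrable `[0, b] du.
Proof. by move=> h b0; case: (h b b0). Qed.

Lemma ac_dist u du s t : ac_deriv u du -> 0 <= s -> s <= t ->
  normc (u t - u s) <= variation du t - variation du s.
Proof.
move=> h s0 st; rewrite (ac_incr h)//; apply: normc_cint_incr => //.
exact: ac_integrable h (le_trans s0 st).
Qed.

Lemma ac_cmeasurable u du b : ac_deriv u du -> 0 <= b -> cmeasurable `[0, b] u.
Proof.
move=> h b0; have [[ir ii] _] := h b b0.
have cr := @parameterized_integral_continuous R 0 b _ b0 ir.
have ci := @parameterized_integral_continuous R 0 b _ b0 ii.
have mr : measurable_fun `[0, b] (fun x => \int[mu]_(t in `[0, x]) Re (du t)).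
  exact: subspace_continuous_measurable_fun cr.
have mi : measurable_fun `[0, b] (fun x => \int[mu]_(t in `[0, x]) Im (du t)).
  exact: subspace_continuous_measurable_fun ci.
have eqb x : `[0, b]%classic x -> u x = u 0 + cint `[0, x] du.
  by rewrite /= in_itv/= => /andP[x0 _]; case: (h x x0).
split.
  apply: (@eq_measurable_fun _ _ _ _ _ (fun x => Re (u 0) + \int[mu]_(t in `[0, x]) Re (du t))).
    by move=> x /set_mem /eqb ->; rewrite ReD.
  by apply: measurable_funD => //; exact: measurable_cst.
apply: (@eq_measurable_fun _ _ _ _ _ (fun x => Im (u 0) + \int[mu]_(t in `[0, x]) Im (du t))).
  by move=> x /set_mem /eqb ->; rewrite ImD.
by apply: measurable_funD => //; exact: measurable_cst.
Qed.

Lemma halfline_bigcup : halfline = \bigcup_k `[0, k%:R]%classic :> set R.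
Proof.
apply/seteqP; split => [x|x [k _]]; last exact: itvcc_sub_halfline.
rewrite /halfline /= in_itv/= andbT => x0.
exists (Num.trunc x).+1 => //=; rewrite in_itv/= x0/= ltW//.
by have := truncnS_gt x.
Qed.

Lemma cmeasurable_halfline u : (forall b, 0 <= b -> cmeasurable `[0, b] u) ->
  cmeasurable halfline u.
Proof.
move=> h; rewrite halfline_bigcup; split.
  by apply/measurable_fun_bigcup => // k; case: (h k%:R (ler0n _ _)).
by apply/measurable_fun_bigcup => // k; case: (h k%:R (ler0n _ _)).
Qed.

Lemma ac_cmeasurable_halfline u du : ac_deriv u du -> cmeasurable halfline u.
Proof. by move=> h; apply: cmeasurable_halfline => b; exact: ac_cmeasurable h. Qed.

Lemma ac_bounded u du b x : ac_deriv u du -> 0 <= x -> x <= b ->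
  normc (u x) <= normc (u 0) + variation du b.
Proof.
move=> h x0 xb; rewrite -[u x](subrK (u 0)) addrC.
rewrite (le_trans (normcD _ _))// lerD2l (le_trans (ac_dist h _ _))//.
have b0 := le_trans x0 xb.
apply: (@le_trans _ _ (variation du x)).
  by rewrite gerBl; apply: Rintegral_ge0 => y _; exact: normc_ge0.
by apply: ler_variation => //; exact: ac_integrable h _.
Qed.

(* Partition [0, b] into N pieces on which [w] has increment (w b - w 0) / N. *)
Lemma const_of_square_increments (F : R -> R[i]) (w : R -> R) b : 0 <= b ->
  {within `[0, b], continuous w} ->
  (forall s t, 0 <= s -> s <= t -> t <= b -> w s <= w t) ->
  (forall s t, 0 <= s -> s <= t -> t <= b ->
     normc (F t - F s) <= (w t - w s) ^+ 2) ->
  F b = F 0.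
Proof.
move=> b0 wc wnd hF; apply/eqP; rewrite -subr_eq0 -normc_eq0.
set D := w b - w 0; have D0 : 0 <= D by rewrite subr_ge0 wnd.
have [Dz|Dnz] := eqVneq D 0.
  rewrite eq_le normc_ge0 andbT; apply: le_trans (hF 0 b _ _ _) _ => //.
  by rewrite -/D Dz expr0n.
have DP : 0 < D by rewrite lt_neqAle eq_sym Dnz.
suff h N : normc (F b - F 0) <= D ^+ 2 / N.+1%:R.
  rewrite eq_le normc_ge0 andbT; apply/ler_addgt0Pr => e e0; rewrite add0r.
  pose N := Num.trunc (D ^+ 2 / e).
  apply: le_trans (h N) _; rewrite ler_pdivrMr// mulrC -ler_pdivrMr//.
  by apply/ltW/truncnS_gt.
have dN : 0 < D / N.+1%:R by rewrite divr_gt0.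
have pts k : exists x, (k <= N.+1)%N -> [/\ 0 <= x, x <= b & w x = w 0 + k%:R * (D / N.+1%:R)].
  have [kN|kN] := leqP k N.+1; last by exists 0.
  have hv : Num.min (w 0) (w b) <= w 0 + k%:R * (D / N.+1%:R) <= Num.max (w 0) (w b).
    have le1 : w 0 <= w b by rewrite -subr_ge0.
    rewrite min_l// max_r// lerDl mulr_ge0 ?ler0n ?(ltW dN)//=.
    by rewrite -lerBrDl -/D mulrCA ler_piMr// ler_pdivrMr// mul1r ler_nat.
  have [x xin xv] := IVT b0 wc hv.
  by move: xin; rewrite in_itv/= => /andP[x0 xb]; exists x.
have /choice[x hx] := pts.
have mono k : (k < N.+1)%N -> x k <= x k.+1.
  move=> kN; have [p1 p2 p3] := hx k (ltnW kN); have [q1 q2 q3] := hx k.+1 kN.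
  rewrite leNgt; apply/negP => xx; have := wnd _ _ q1 (ltW xx) p2.
  rewrite p3 q3 lerD2l ler_pM2r// ler_nat ltnn//.
have ends : normc (F (x 0%N) - F 0) = 0 /\ normc (F b - F (x N.+1)) = 0.
  have [p1 p2 p3] := hx 0%N (leq0n _); have [q1 q2 q3] := hx N.+1 (leqnn _).
  split; apply/eqP; rewrite eq_le normc_ge0 andbT.
    by rewrite (le_trans (hF _ _ _ _ _))// p3 mul0r addr0 subrr expr0n.
  rewrite (le_trans (hF _ _ _ _ _))// q3 mulrCA divff ?mulr1 ?pnatr_eq0//.
  by rewrite /D [w 0 + _]addrC subrK subrr expr0n.
have step k : (k <= N.+1)%N -> normc (F (x k) - F (x 0%N)) <= k%:R * (D / N.+1%:R) ^+ 2.
  elim: k => [|k ih] kN; first by rewrite subrr Normc.normc0 mul0r.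
  have [p1 p2 p3] := hx k (ltnW kN); have [q1 q2 q3] := hx k.+1 kN.
  rewrite -[F (x k.+1) - _](subrKA (F (x k))) (le_trans (normcD _ _))//.
  rewrite -natr1 mulrDl addrC lerD ?ih//; first by exact: ltnW.
  rewrite (le_trans (hF _ _ _ _ _))//; first exact: mono.
  by rewrite p3 q3 mul1r -natr1 mulrDl mul1r opprD addrACA subrr add0r [X in X - _]addrC addrK.
have [e1 e2] := ends.
rewrite -[F b - F 0](subrKA (F (x N.+1))) (le_trans (normcD _ _))// e2 add0r.
rewrite -[F (x N.+1) - F 0](subrKA (F (x 0%N))) (le_trans (normcD _ _))// e1 addr0.
apply: le_trans (step _ (leqnn _)) _.
have : N.+1%:R != 0 :> R by rewrite pnatr_eq0.
move: (N.+1%:R : R) => m m0; rewrite le_eqVlt; apply/orP; left; apply/eqP.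
by field.
Qed.

Lemma normc_cintM u g (D : set R) (C : R) : measurable D -> cmeasurable D u ->
  (forall x, D x -> normc (u x) <= C) -> cintegrable D g ->
  normc (cint D (fun x => u x * g x)) <= C * \int[mu]_(x in D) normc (g x).
Proof.
move=> mD mu1 hC ig; have iug := cintegrableM mD mu1 hC ig.
apply: le_trans (normc_cint mD iug) _.
rewrite -RintegralZl//; last exact: cintegrable_normc.
apply: le_Rintegral => //.
- exact: cintegrable_normc.
- by apply: integrable_scale => //; exact: cintegrable_normc.
- by move=> x Dx; rewrite Normc.normcM ler_wpM2r ?normc_ge0// hC.
Qed.

Lemma ac_mul_integrable u du v b : ac_deriv u du -> 0 <= b -> cintegrable `[0, b] v ->
  cintegrable `[0, b] (fun x => u x * v x).
Proof.
move=> hu b0 iv; apply: (@cintegrableM _ _ _ _ (normc (u 0) + variation du b)) => //.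
  exact: ac_cmeasurable hu b0.
by move=> x /=; rewrite in_itv/= => /andP[x0 xb]; exact: ac_bounded hu x0 xb.
Qed.

Lemma ac_derivM u du v dv : ac_deriv u du -> ac_deriv v dv ->
  ac_deriv (fun x => u x * v x) (fun x => v x * du x + u x * dv x).
Proof.
move=> hu hv b b0; set g := fun x => v x * du x + u x * dv x.
have ig c : 0 <= c -> cintegrable `[0, c] g.
  move=> c0; apply: cintegrableD => //.
    exact: (ac_mul_integrable hv c0 (ac_integrable hu c0)).
  exact: (ac_mul_integrable hu c0 (ac_integrable hv c0)).
split; first exact: ig.
pose F t := u t * v t - cint `[0, t] g.
pose w t := variation du t + variation dv t.
have idu t : 0 <= t -> cintegrable `[0, t] du by exact: ac_integrable hu.
have idv t : 0 <= t -> cintegrable `[0, t] dv by exact: ac_integrable hv.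
suff : F b = F 0.
  rewrite /F set_itv1 => /eqP; rewrite subr_eq => /eqP ->.
  suff -> : cint [set 0] g = 0 by rewrite subr0.
  by apply: complexP; rewrite /= Rintegral_set1.
apply: (@const_of_square_increments F w) => //.
- have c1 := variation_continuous b0 (idu b b0).
  have c2 := variation_continuous b0 (idv b b0).
  by move=> x; apply: cvgD; [exact: c1|exact: c2].
- move=> s t s0 st tb; apply: lerD; apply: ler_variation => //.
    exact: idu (le_trans s0 st).
  exact: idv (le_trans s0 st).
move=> s t s0 st tb; have t0 := le_trans s0 st.
set A := variation du t - variation du s; set B := variation dv t - variation dv s.
have A0 : 0 <= A by rewrite subr_ge0 ler_variation//; exact: idu.
have B0 : 0 <= B by rewrite subr_ge0 ler_variation//; exact: idv.
have sub : `]s, t] `<=` (`[0, t] : set R) by exact: itvoc_sub_cc.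
have i1 : cintegrable `]s, t] du by apply: cintegrableS sub (idu t t0).
have i2 : cintegrable `]s, t] dv by apply: cintegrableS sub (idv t t0).
have i3 : cintegrable `]s, t] (fun x => v x * du x).
  by apply: cintegrableS sub _ => //; apply: ac_mul_integrable hv t0 (idu t t0).
have i4 : cintegrable `]s, t] (fun x => u x * dv x).
  by apply: cintegrableS sub _ => //; apply: ac_mul_integrable hu t0 (idv t t0).
have mu1 : cmeasurable `]s, t] u by apply: cmeasurableS sub _ => //; exact: ac_cmeasurable hu t0.
have mv1 : cmeasurable `]s, t] v by apply: cmeasurableS sub _ => //; exact: ac_cmeasurable hv t0.
have key : F t - F s = cint `]s, t] (fun x => (v s - v x) * du x) +
    cint `]s, t] (fun x => (u t - u x) * dv x).
  have -> : F t - F s = (u t * v t - u s * v s) - cint `]s, t] g.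
    by rewrite -(cint_incr s0 st (ig t t0)) /F; ring.
  have -> : cint `]s, t] (fun x => (v s - v x) * du x) = v s * cint `]s, t] du - cint `]s, t] (fun x => v x * du x).
    rewrite -cintZ// -cintB//; last exact: cintegrableZ.
    by apply: eq_cint => x _; rewrite mulrBl.
  have -> : cint `]s, t] (fun x => (u t - u x) * dv x) = u t * cint `]s, t] dv - cint `]s, t] (fun x => u x * dv x).
    rewrite -cintZ// -cintB//; last exact: cintegrableZ.
    by apply: eq_cint => x _; rewrite mulrBl.
  rewrite /g cintD// -(ac_incr hu s0 st) -(ac_incr hv s0 st); ring.
rewrite key; apply: (@le_trans _ _ (B * A + A * B)); last first.
  by rewrite -/w /w opprD addrACA -/A -/B; nra.
apply: le_trans (normcD _ _) _; apply: lerD.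
  rewrite /A variation_incr//; last exact: idu.
  apply: normc_cintM => //.
    by apply: cmeasurableB => //; exact: cmeasurable_cst.
  move=> x /=; rewrite in_itv/= => /andP[sx xt]; rewrite normc_distC.
  apply: le_trans (ac_dist hv s0 (ltW sx)) _; rewrite lerD2r ler_variation//.
    by rewrite (le_trans s0)// ltW.
  exact: idv.
rewrite /B variation_incr//; last exact: idv.
apply: normc_cintM => //.
  by apply: cmeasurableB => //; exact: cmeasurable_cst.
move=> x /=; rewrite in_itv/= => /andP[sx xt].
have x0 : 0 <= x by rewrite (le_trans s0)// ltW.
apply: le_trans (ac_dist hu x0 xt) _; rewrite lerD2l lerN2 ler_variation//.
  exact: ltW.
exact: idu.
Qed.

Lemma ac_derivD u du v dv : ac_deriv u du -> ac_deriv v dv ->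
  ac_deriv (fun x => u x + v x) (fun x => du x + dv x).
Proof.
move=> hu hv b b0; have [iu eu] := hu b b0; have [iv ev] := hv b b0.
by split; [exact: cintegrableD|rewrite cintD// eu ev addrACA].
Qed.

Lemma ac_derivZ (c : R[i]) u du : ac_deriv u du ->
  ac_deriv (fun x => c * u x) (fun x => c * du x).
Proof.
move=> hu b b0; have [iu eu] := hu b b0.
by split; [exact: cintegrableZ|rewrite cintZ// eu mulrDr].
Qed.

Lemma ac_deriv_conj u du : ac_deriv u du ->
  ac_deriv (fun x => conjc (u x)) (fun x => conjc (du x)).
Proof.
move=> hu b b0; have [iu eu] := hu b b0.
by split; [exact: cintegrable_conj|rewrite cint_conj// eu conjcD].
Qed.

Lemma ac_deriv_cst (c : R[i]) : ac_deriv (fun=> c) (fun=> 0).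
Proof.
by move=> b b0; split; [exact: cintegrable0|rewrite cint0 addr0].
Qed.

Lemma ac_deriv_cint g : (forall b, 0 <= b -> cintegrable `[0, b] g) ->
  ac_deriv (fun x => cint `[0, x] g) g.
Proof.
move=> ig b b0; split; first exact: ig.
by rewrite set_itv1 /cint !Rintegral_set1 add0r.
Qed.

Lemma eq_ac_deriv u v du dv : (forall x, 0 <= x -> u x = v x) ->
  (forall x, 0 <= x -> du x = dv x) -> ac_deriv u du -> ac_deriv v dv.
Proof.
move=> uv duv hu b b0; have [iu eu] := hu b b0.
have e x : `[0, b]%classic x -> du x = dv x.
  by rewrite /= in_itv/= => /andP[x0 _]; exact: duv.
split; first exact: eq_cintegrable e iu.
by rewrite -(eq_cint e) -!uv.
Qed.

Lemma ftc_everywhere (F f : R -> R) b : 0 <= b ->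
  (forall x, is_derive x 1 F (f x)) -> continuous f ->
  mu.-integrable `[0, b] (EFin \o f) /\ \int[mu]_(x in `[0, b]) f x = F b - F 0.
Proof.
move=> b0 dF cf.
have fi : mu.-integrable `[0, b] (EFin \o f).
  apply: continuous_compact_integrable; first exact: segment_compact.
  by apply: continuous_subspaceT.
split => //; move: b0; rewrite le_eqVlt => /predU1P[<-|b0].
  by rewrite set_itv1 Rintegral_set1 subrr.
have cF : continuous F.
  by move=> x; apply: differentiable_continuous; apply/derivable1_diffP; case: (dF x).
rewrite /Rintegral (@continuous_FTC2 R f F)//.
- exact: continuous_subspaceT.
- split.
  + by move=> x _; case: (dF x).
  + by apply: cvg_at_right_filter; exact: cF.
  + by apply: cvg_at_left_filter; exact: cF.
- by move=> x _; rewrite derive1E; apply: derive_val.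
Qed.

Lemma ac_deriv_smooth u du :
  (forall x, is_derive x 1 (fun y => Re (u y)) (Re (du x))) ->
  (forall x, is_derive x 1 (fun y => Im (u y)) (Im (du x))) ->
  continuous (fun x => Re (du x)) -> continuous (fun x => Im (du x)) ->
  ac_deriv u du.
Proof.
move=> dr di cr ci b b0.
have [ir er] := ftc_everywhere b0 dr cr.
have [ii ei] := ftc_everywhere b0 di ci.
split => //; apply: complexP; rewrite ?ReD ?ImD /=.
  by rewrite er addrC subrK.
by rewrite ei addrC subrK.
Qed.

End AbsolutelyContinuous.

Section Exponential.
Context {R : realType}.
Local Notation mu := (@lebesgue_measure R).
Implicit Types (z w c : R[i]) (x y : R).

Lemma cexpD z w : cexp (z + w) = cexp z * cexp w.
Proof.
rewrite /cexp ReD ImD expRD cosD sinD; apply: complexP; rewrite ?ReM ?ImM /=; ring.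
Qed.
Lemma cexp0 : cexp (0 : R[i]) = 1.
Proof. by rewrite /cexp /= expR0 cos0 sin0 mulr1 mulr0. Qed.
Lemma normc_cexp z : normc (cexp z) = expR (Re z).
Proof.
rewrite normcE /cexp /= !exprMn -mulrDr cos2Dsin2 mulr1 sqrtr_sqr.
by rewrite ger0_norm ?expR_ge0.
Qed.
Lemma cexp_neq0 z : cexp z != 0.
Proof. by rewrite -normc_eq0 normc_cexp gt_eqF ?expR_gt0. Qed.

Definition cE c x := cexp (c * x%:C).

Arguments cE : simpl never.

Lemma cE0 c : cE c 0 = 1.
Proof. by rewrite /cE mulr0 cexp0. Qed.
Lemma cED c x y : cE c (x + y) = cE c x * cE c y.
Proof. by rewrite /cE rmorphD mulrDr cexpD. Qed.
Lemma cEDl c1 c2 x : cE (c1 + c2) x = cE c1 x * cE c2 x.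
Proof. by rewrite /cE mulrDl cexpD. Qed.
Lemma cENr c x : cE c (- x) = cE (- c) x.
Proof. by rewrite /cE rmorphN mulrN mulNr. Qed.
Lemma cEK c x : cE c x * cE (- c) x = 1.
Proof. by rewrite -cENr -cED subrr cE0. Qed.
Lemma cEVK c x : cE (- c) x * cE c x = 1.
Proof. by rewrite mulrC cEK. Qed.
Lemma Re_cE c x : Re (cE c x) = expR (Re c * x) * cos (Im c * x).
Proof. by rewrite /cE /cexp /= !ReImE !mulr0 subr0 add0r. Qed.
Lemma Im_cE c x : Im (cE c x) = expR (Re c * x) * sin (Im c * x).
Proof. by rewrite /cE /cexp /= !ReImE !mulr0 subr0 add0r. Qed.
Lemma normc_cE c x : normc (cE c x) = expR (Re c * x).
Proof. by rewrite /cE normc_cexp !ReImE mulr0 subr0. Qed.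

Lemma is_derive_scale (a x : R) : is_derive x 1 (fun y : R => a * y) a.
Proof.
have := is_deriveZ a (is_derive_id x (1 : R)).
by rewrite /GRing.scale /= mulr1.
Qed.

Lemma is_derive_expcos (a b x : R) :
  is_derive x 1 (fun y => expR (a * y) * cos (b * y))
    (a * (expR (a * x) * cos (b * x)) - b * (expR (a * x) * sin (b * x))).
Proof.
have he := is_derive1_comp (is_derive_expR (a * x)) (is_derive_scale a x).
have hc := is_derive1_comp (is_derive_cos (b * x)) (is_derive_scale b x).
apply: is_derive_eq (is_deriveM he hc) _.
rewrite /GRing.scale /=; ring.
Qed.

Lemma is_derive_expsin (a b x : R) :
  is_derive x 1 (fun y => expR (a * y) * sin (b * y))
    (a * (expR (a * x) * sin (b * x)) + b * (expR (a * x) * cos (b * x))).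
Proof.
have he := is_derive1_comp (is_derive_expR (a * x)) (is_derive_scale a x).
have hc := is_derive1_comp (is_derive_sin (b * x)) (is_derive_scale b x).
apply: is_derive_eq (is_deriveM he hc) _.
rewrite /GRing.scale /=; ring.
Qed.

Lemma continuous_scaled (f : R -> R) (a : R) : continuous f -> continuous (fun y => f (a * y)).
Proof. by move=> cf y; apply: continuous_comp; [exact: mulrl_continuous|exact: cf]. Qed.

Lemma continuous_expcos (a b : R) : continuous (fun y => expR (a * y) * cos (b * y)).
Proof.
move=> y; apply: cvgM.
  exact: (continuous_scaled (@continuous_expR R)).
exact: (continuous_scaled (@continuous_cos R)).
Qed.
Lemma continuous_expsin (a b : R) : continuous (fun y => expR (a * y) * sin (b * y)).
Proof.
move=> y; apply: cvgM.
  exact: (continuous_scaled (@continuous_expR R)).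
exact: (continuous_scaled (@continuous_sin R)).
Qed.

Lemma ac_cE c : ac_deriv (cE c) (fun x => c * cE c x).
Proof.
apply: ac_deriv_smooth => [x|x||].
- under eq_fun do rewrite Re_cE; rewrite ReM Re_cE Im_cE; exact: is_derive_expcos.
- under eq_fun do rewrite Im_cE; rewrite ImM Re_cE Im_cE; exact: is_derive_expsin.
- under eq_fun do rewrite ReM Re_cE Im_cE.
  move=> y; apply: cvgB; apply: cvgM; try exact: cvg_cst.
    exact: continuous_expcos.
  exact: continuous_expsin.
- under eq_fun do rewrite ImM Re_cE Im_cE.
  move=> y; apply: cvgD; apply: cvgM; try exact: cvg_cst.
    exact: continuous_expsin.
  exact: continuous_expcos.
Qed.

Lemma cmeasurable_cE c : cmeasurable halfline (cE c).
Proof. exact: ac_cmeasurable_halfline (ac_cE c). Qed.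

Lemma integral_exp_halfline (a t : R) : 0 < a ->
  mu.-integrable `[t, +oo[ (EFin \o (fun x => expR (- a * x))) /\
  \int[mu]_(x in `[t, +oo[) expR (- a * x) = expR (- a * t) / a.
Proof.
move=> a0; pose F x := - (expR (- a * x) / a).
have dF x : is_derive x 1 F (expR (- a * x)).
  have he := is_derive1_comp (is_derive_expR (- a * x)) (is_derive_scale (- a) x).
  have := is_deriveZ (- a^-1) he.
  rewrite (_ : - a^-1 *: _ = expR (- a * x)); last first.
    by rewrite /GRing.scale /= mulrCA mulrNN mulVf ?gt_eqF// mulr1.
  by rewrite (_ : - a^-1 \*: _ = F)//; apply/funext => y; rewrite /F /= /GRing.scale /= mulNr mulrC.
have cf : continuous (fun x : R => expR (- a * x)).
  exact: (continuous_scaled (@continuous_expR R)).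
have cF : continuous F.
  by move=> x; apply: differentiable_continuous; apply/derivable1_diffP; case: (dF x).
have Flim : F x @[x --> +oo] --> (0 : R).
  rewrite -oppr0 -[X in - X](mul0r a^-1); apply: cvgN; apply: cvgM; last exact: cvg_cst.
  have lim : a * x @[x --> +oo] --> +oo.
    apply/cvgryPge => M; near=> x.
    rewrite mulrC -ler_pdivrMr//; near: x; exact: nbhs_pinfty_ge.
  have := cvg_comp _ _ lim (@cvgr_expR R).
  rewrite (_ : _ \o _ = fun x => expR (- a * x))//.
  by apply/funext => x /=; rewrite mulNr.
have E : (\int[mu]_(x in `[t, +oo[) (expR (- a * x))%:E = (expR (- a * t) / a)%:E)%E.
  rewrite (@ge0_continuous_FTC2y R _ F t 0)//.
  - by rewrite /F sub0e -EFinN opprK.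
  - exact: continuous_subspaceT.
  - by apply: cvg_at_right_filter; exact: cF.
  - by move=> x _; rewrite derive1E; apply: derive_val.
split; last by rewrite /Rintegral E.
apply/integrableP; split.
  apply/measurable_EFinP; apply: measurable_funTS; exact: continuous_measurable_fun.
under eq_integral do rewrite gee0_abs ?lee_fin ?expR_ge0//.
by rewrite E ltry.
Unshelve. all: by end_near. Qed.

Lemma square_integrable_cE c : Re c < 0 -> square_integrable (cE c).
Proof.
move=> c0; split; first exact: cmeasurable_cE.
have a0 : 0 < - (2 * Re c) by rewrite oppr_gt0 pmulr_rlt0.
have [h _] := integral_exp_halfline 0 a0.
rewrite /comp opprK in h.
by under eq_fun do rewrite normc_cE -expRM_natl mulrA.
Qed.

End Exponential.

Arguments cE : simpl never.

Section HalflineIntegrals.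
Context {R : realType}.
Local Notation mu := (@lebesgue_measure R).
Implicit Types (f g : R -> R) (b : R).

Lemma halfline_ge0 (x : R) : halfline x -> 0 <= x.
Proof. by rewrite /halfline /= in_itv/= andbT. Qed.

Lemma halfline_split b : 0 <= b -> halfline = `[0, b]%classic `|` `]b, +oo[%classic :> set R.
Proof. by move=> b0; rewrite -itv_bndbnd_setU// bnd_simp. Qed.

Lemma halfline_split_disj b : [disjoint `[0, b]%classic & (`]b, +oo[%classic : set R)].
Proof.
apply/disj_setPS => y [/=]; rewrite !in_itv/= => /andP[_ yb]; rewrite andbT.
by rewrite ltNge yb.
Qed.

Lemma itvoy_sub_halfline b : 0 <= b -> `]b, +oo[%classic `<=` (halfline : set R).
Proof.
move=> b0 x /=; rewrite /halfline /= !in_itv/= !andbT => bx.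
by rewrite (le_trans b0)// ltW.
Qed.

Lemma itvoy_sub b1 b2 : b1 <= b2 -> `]b2, +oo[%classic `<=` (`]b1, +oo[%classic : set R).
Proof.
by move=> b12 x /=; rewrite !in_itv/= !andbT; exact: le_lt_trans.
Qed.

Lemma Rintegral_tail f b : 0 <= b -> mu.-integrable halfline (EFin \o f) ->
  \int[mu]_(x in `]b, +oo[) f x =
  \int[mu]_(x in halfline) f x - \int[mu]_(x in `[0, b]) f x.
Proof.
move=> b0 fi; rewrite (halfline_split b0) Rintegral_setU//.
- by rewrite addrC addKr.
- by rewrite -halfline_split.
- exact: halfline_split_disj.
Qed.

Lemma cint_tail (u : R -> R[i]) b : 0 <= b -> cintegrable halfline u ->
  cint halfline u - cint `[0, b] u = cint `]b, +oo[ u.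
Proof.
move=> b0 ui; rewrite (halfline_split b0) cint_setU//.
- by rewrite addrC addKr.
- exact: halfline_split_disj.
- by rewrite -halfline_split.
Qed.

Lemma ler_Rintegral_sub f (A B : set R) : measurable A -> measurable B ->
  A `<=` B -> mu.-integrable B (EFin \o f) -> (forall x, B x -> 0 <= f x) ->
  \int[mu]_(x in A) f x <= \int[mu]_(x in B) f x.
Proof.
move=> mA mB AB fi f0.
have fiA : mu.-integrable A (EFin \o f) by exact: (@integrableS _ _ _ mu B A).
rewrite -lee_fin -!EFin_Rintegral//; apply: ge0_subset_integral => //.
exact: measurable_int fi.
Qed.

Lemma tail_small f (e : R) : mu.-integrable halfline (EFin \o f) ->
  (forall x, halfline x -> 0 <= f x) -> 0 < e ->
  exists2 B, 0 <= B & forall b, B <= b -> \int[mu]_(x in `]b, +oo[) f x <= e.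
Proof.
move=> fi f0 e0.
have fik k : mu.-integrable `[0, k%:R] (EFin \o f).
  by apply: (@integrableS _ _ _ mu halfline) => //; exact: itvcc_sub_halfline.
have lim : \int[mu]_(x in `[0, k%:R]) f x @[k --> \oo] --> \int[mu]_(x in halfline) f x.
  apply: fine_cvg; rewrite /Rintegral fineK; last exact: integrable_fin_num fi.
  rewrite halfline_bigcup; apply: ge0_nondecreasing_set_cvg_integral => //.
  - move=> m k mk; rewrite subsetEset; apply: itvcc_sub; by rewrite ler_nat.
  - by move=> k; exact: measurable_int (fik k).
  - move=> k x kx; rewrite lee_fin f0//; exact: itvcc_sub_halfline kx.
have /cvgrPdist_le/(_ _ e0)[k _ hk] := lim.
exists k%:R => // b kb; have b0 : 0 <= b by exact: le_trans kb.
apply: le_trans (hk k (leqnn k)); apply: le_trans (ler_norm _).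
rewrite -Rintegral_tail//; apply: ler_Rintegral_sub => //.
- exact: itvoy_sub.
- by apply: (@integrableS _ _ _ mu halfline) => //; exact: itvoy_sub_halfline.
- by move=> x kx; apply: f0; exact: itvoy_sub_halfline kx.
Qed.

Lemma Rcauchy_schwarz (D : set R) f g : measurable D ->
  measurable_fun D f -> measurable_fun D g ->
  mu.-integrable D (EFin \o (fun x => f x ^+ 2)) ->
  mu.-integrable D (EFin \o (fun x => g x ^+ 2)) ->
  mu.-integrable D (EFin \o (fun x => f x * g x)) /\
  \int[mu]_(x in D) (f x * g x) <=
  Num.sqrt (\int[mu]_(x in D) f x ^+ 2) * Num.sqrt (\int[mu]_(x in D) g x ^+ 2).
Proof.
move=> mD mf mg f2 g2.
have fg : mu.-integrable D (EFin \o (fun x => f x * g x)).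
  apply: (@le_integrable _ _ _ mu D mD _ (EFin \o (fun x => f x ^+ 2 + g x ^+ 2))).
  - by apply/measurable_EFinP; exact: measurable_funM.
  - move=> x Dx /=; rewrite lee_fin [leRHS]ger0_norm ?addr_ge0 ?sqr_ge0//.
    rewrite ler_norml; have := sqr_ge0 (f x - g x); have := sqr_ge0 (f x + g x).
    have := sqr_ge0 (f x); have := sqr_ge0 (g x); nra.
  - exact: integrable_add.
split => //; apply: cauchy_schwarz_amgm.
- by apply: Rintegral_ge0 => x _; exact: sqr_ge0.
- by apply: Rintegral_ge0 => x _; exact: sqr_ge0.
move=> t t0.
have i1 := integrable_scale t mD f2.
have i2 : mu.-integrable D (EFin \o (fun x => g x ^+ 2 / t)).
  by rewrite /comp; under eq_fun do rewrite mulrC; exact: integrable_scale.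
rewrite -!RintegralZl// -RintegralZr// -RintegralD//; apply: le_Rintegral => //.
- exact: integrable_scale.
- exact: integrable_add.
- by move=> x _; exact: amgm_weighted.
Qed.

Lemma measure_itvoc (s t : R) : s <= t -> (lebesgue_measure `]s, t]%classic = (t - s)%:E)%E.
Proof.
rewrite lebesgue_measure_itv/= lte_fin le_eqVlt => /predU1P[->|->//].
by rewrite ltxx subrr.
Qed.

Lemma integral_cst_le (u : R -> R) (s t c : R) : s <= t ->
  mu.-integrable `]s, t] (EFin \o u) -> (forall x, s < x -> x <= t -> c <= u x) ->
  c * (t - s) <= \int[mu]_(x in `]s, t]) u x.
Proof.
move=> st ui h.
have E : \int[mu]_(x in `]s, t]) c = c * (t - s).
  rewrite Rintegral_cst// [X in fine X](_ : _ = (t - s)%:E)//; exact: measure_itvoc.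
rewrite -E; apply: le_Rintegral => //.
  apply: measurable_bounded_integrable => //.
    by rewrite [X in (X < _)%E](_ : _ = (t - s)%:E) ?ltry//; exact: measure_itvoc.
  by exists `|c|; split => [|M cM x _]; rewrite ?num_real// ltW.
by move=> x /=; rewrite in_itv/= => /andP[]; exact: h.
Qed.

Lemma integral_le_cst (u : R -> R) (s t c : R) : s <= t ->
  mu.-integrable `]s, t] (EFin \o u) -> (forall x, s < x -> x <= t -> u x <= c) ->
  \int[mu]_(x in `]s, t]) u x <= c * (t - s).
Proof.
move=> st ui h; rewrite -lerN2 -mulNr.
have : - c * (t - s) <= \int[mu]_(x in `]s, t]) (-1 * u x).
  apply: integral_cst_le => //; first exact: integrable_scale.
  by move=> x sx xt; rewrite mulN1r lerN2 h.
by rewrite RintegralZl// mulN1r.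
Qed.

End HalflineIntegrals.

Section Boundary.
Context {R : realType}.
Local Notation mu := (@lebesgue_measure R).

(* [w] has a limit at infinity because [dw] is integrable, and the limit is 0
   because [w] itself is integrable. *)
Lemma ac_deriv_boundary (w dw : R -> R[i]) : ac_deriv w dw ->
  cintegrable halfline w -> cintegrable halfline dw ->
  cint halfline dw = - w 0.
Proof.
move=> hw iw idw; apply/eqP; rewrite -addr_eq0 addrC; set l := w 0 + _.
rewrite -normc_eq0 eq_le normc_ge0 andbT leNgt; apply/negP => l0.
have l2 : 0 < normc l / 2 by rewrite divr_gt0.
have [B B0 hB] := tail_small (cintegrable_normc measurable_halfline idw) (fun x _ => normc_ge0 _) l2.
have big b : B <= b -> normc l / 2 <= normc (w b).
  move=> Bb; have b0 := le_trans B0 Bb.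
  have : normc (l - w b) <= normc l / 2.
    have -> : l - w b = cint `]b, +oo[ dw.
      rewrite -cint_tail//; have [_ ->] := hw b b0; rewrite /l; ring.
    apply: le_trans (normc_cint _ _) (hB b Bb) => //.
    by apply: cintegrableS idw => //; exact: itvoy_sub_halfline.
  have := ler_dist_normc l (w b); rewrite ler_norml => /andP[_ h1] h2; lra.
pose I := \int[mu]_(x in halfline) normc (w x).
have inw := cintegrable_normc measurable_halfline iw.
have [N hN] : exists N : nat, I < N%:R * (normc l / 2).
  exists (Num.trunc (I / (normc l / 2))).+1.
  by rewrite -ltr_pdivrMr// truncnS_gt.
suff : normc l / 2 * (B + N%:R - B) <= I.
  by rewrite addrC addKr mulrC leNgt hN.
have BN : B <= B + N%:R by rewrite lerDl.
have sub : `]B, B + N%:R]%classic `<=` (halfline : set R) by exact: itvoc_sub_halfline.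
apply: le_trans (@integral_cst_le R (fun x => normc (w x)) _ _ _ BN _ _) _.
- by apply: (@integrableS _ _ _ mu halfline).
- by move=> x Bx _; apply: big; exact: ltW.
by apply: ler_Rintegral_sub => // x _; exact: normc_ge0.
Qed.

Lemma square_integrable_of_bound (u : R -> R[i]) (M : R) :
  cmeasurable halfline u ->
  (forall b, 0 <= b -> mu.-integrable `[0, b] (EFin \o (fun x => normc (u x) ^+ 2)) /\
    \int[mu]_(x in `[0, b]) normc (u x) ^+ 2 <= M) ->
  square_integrable u /\ \int[mu]_(x in halfline) normc (u x) ^+ 2 <= M.
Proof.
move=> mu1 h.
have mn : measurable_fun halfline (fun x => normc (u x) ^+ 2).
  by apply: measurable_funX; exact: measurable_normc.
pose f i x : R := \1_(`[0, i%:R]%classic) x * normc (u x) ^+ 2.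
have fE i : (fun x => (f i x)%:E) = (fun x => (normc (u x) ^+ 2)%:E) \_ `[0, i%:R].
  apply/funext => x; rewrite /f patchE indicE; case: ifPn => _; by rewrite ?mul1r ?mul0r.
have sub i : `[0, i%:R]%classic `<=` (halfline : set R) by exact: itvcc_sub_halfline.
have fi i : mu.-integrable halfline (EFin \o f i).
  rewrite (_ : EFin \o f i = fun x => (f i x)%:E)// fE.
  apply/integrable_restrict => //; rewrite setIidr//.
  by have [] := h i%:R (ler0n _ _).
have If i : \int[mu]_(x in halfline) f i x = \int[mu]_(x in `[0, i%:R]) normc (u x) ^+ 2.
  rewrite /Rintegral fE -integral_mkcondr setIidr//.
have [] := @fatou_bound R halfline f (fun x => normc (u x) ^+ 2) M measurable_halfline fi.
- by move=> i x _; apply: mulr_ge0; rewrite ?sqr_ge0// indicE.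
- move=> x; rewrite /halfline /= in_itv/= andbT => x0.
  apply/cvgrPdist_lt => e e0; near=> i.
  rewrite /f indicE mem_set ?mul1r ?subrr ?normr0//= in_itv/= x0/=.
  near: i; exists (Num.trunc x).+1 => // i /= hi.
  by apply: ltW; apply: lt_le_trans (truncnS_gt x) _; rewrite ler_nat.
- by move=> i; rewrite If; have [] := h i%:R (ler0n _ _).
by move=> gi gM; split => //; split.
Unshelve. all: by end_near. Qed.

End Boundary.

Arguments Normc.normc : simpl never.
Arguments cint : simpl never.

(** * The free resolvent *)

Section GreenEdge.
Context {R : realType}.
Local Notation mu := (@lebesgue_measure R).
Variable c : R[i].
Hypothesis hc : Re c < 0.
Implicit Types (f p y g : R -> R[i]) (b t x : R).

Definition decaying f :=
  cmeasurable halfline f /\ cintegrable halfline (fun x => cE c x * f x).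

Definition tail_transform f t : R[i] :=
  cE (- c) t * (cint halfline (fun x => cE c x * f x) -
                cint `[0, t] (fun x => cE c x * f x)).

Definition head_transform p x : R[i] := cE c x * cint `[0, x] (fun t => cE (- c) t * p t).

Lemma tail_transform_ac f : decaying f ->
  ac_deriv (tail_transform f) (fun t => - c * tail_transform f t - f t).
Proof.
move=> df; have [mf fi] := df.
have ig b : 0 <= b -> cintegrable `[0, b] (fun x => cE c x * f x).
  by move=> b0; apply: cintegrableS fi => //; exact: itvcc_sub_halfline.
have h1 := ac_deriv_cst (cint halfline (fun x => cE c x * f x)).
have h2 := ac_derivD h1 (ac_derivZ (-1) (ac_deriv_cint ig)).
have := ac_derivM (ac_cE (- c)) h2; apply: eq_ac_deriv => x x0.
  by rewrite mulN1r.
rewrite /tail_transform add0r mulN1r mulN1r.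
have -> : cE (- c) x * - (cE c x * f x) = - f x by rewrite mulrN mulrA cEVK mul1r.
ring.
Qed.

Lemma tail_transformE f t : decaying f -> 0 <= t ->
  tail_transform f t = cE (- c) t * cint `]t, +oo[ (fun x => cE c x * f x).
Proof. by move=> [mf fi] t0; rewrite /tail_transform cint_tail. Qed.

Lemma decaying_integrable f : cintegrable halfline f -> decaying f.
Proof.
move=> fi; split; first exact: cintegrable_measurable fi.
apply: (@cintegrableM _ _ _ _ 1) => //; first exact: cmeasurable_cE.
move=> x /halfline_ge0 x0.
by rewrite normc_cE -expR0 ler_expR mulr_le0_ge0// ltW.
Qed.

Lemma decaying_square_integrable f : square_integrable f -> decaying f.
Proof.
move=> hf; split; first by case: hf.
by apply: square_integrable_mul => //; exact: square_integrable_cE.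
Qed.

Lemma normc_tail_transform_le f t : cintegrable halfline f -> 0 <= t ->
  normc (tail_transform f t) <= \int[mu]_(x in `]t, +oo[) normc (f x).
Proof.
move=> fi t0; have df := decaying_integrable fi; have [_ cfi] := df.
have sub : `]t, +oo[%classic `<=` (halfline : set R) by exact: itvoy_sub_halfline.
have fit : cintegrable `]t, +oo[ f by exact: cintegrableS sub fi.
have cfit : cintegrable `]t, +oo[ (fun x => cE c x * f x) by exact: cintegrableS sub cfi.
rewrite tail_transformE// -cintZ//.
apply: le_trans (normc_cint _ _) _ => //; first exact: cintegrableZ.
apply: le_Rintegral => //.
- by apply: cintegrable_normc => //; exact: cintegrableZ.
- exact: cintegrable_normc.
move=> x /=; rewrite in_itv/= andbT => tx.
rewrite !Normc.normcM !normc_cE mulrA -expRD ReN mulNr -mulrN -mulrDr.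
rewrite ler_piMl ?normc_ge0// -expR0 ler_expR mulr_le0_ge0// ?(ltW hc)//.
rewrite addrC subr_ge0; exact: ltW.
Qed.

Lemma sqr_tail_transform_le f t : square_integrable f -> 0 <= t ->
  normc (tail_transform f t) ^+ 2 <=
  (\int[mu]_(x in halfline) normc (f x) ^+ 2) / (- (2 * Re c)).
Proof.
move=> hf t0; have df := decaying_square_integrable hf; have [mf cfi] := df.
have a0 : 0 < - (2 * Re c) by rewrite oppr_gt0 pmulr_rlt0.
have sub : `]t, +oo[%classic `<=` (halfline : set R) by exact: itvoy_sub_halfline.
have cfit : cintegrable `]t, +oo[ (fun x => cE c x * f x) by exact: cintegrableS sub cfi.
have mc : cmeasurable `]t, +oo[ (cE c) by apply: cmeasurableS sub _ => //; exact: cmeasurable_cE.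
have mft : cmeasurable `]t, +oo[ f by apply: cmeasurableS sub mf.
have [_ hf2] := hf; have [_ hE2] := square_integrable_cE hc.
have [i1 le1] := Rcauchy_schwarz (measurable_itv `]t, +oo[)
  (measurable_normc (measurable_itv `]t, +oo[) mc)
  (measurable_normc (measurable_itv `]t, +oo[) mft)
  (@integrableS _ _ _ mu halfline _ _ measurable_halfline (measurable_itv _) sub hE2)
  (@integrableS _ _ _ mu halfline _ _ measurable_halfline (measurable_itv _) sub hf2).
have [ie IE] := integral_exp_halfline t a0.
have {}IE : \int[mu]_(x in `]t, +oo[) normc (cE c x) ^+ 2 = expR (2 * Re c * t) / (- (2 * Re c)).
  rewrite -[X in expR (X * t)]opprK -IE -Rintegral_itv_obnd_cbnd.
    by apply: eq_Rintegral => x _; rewrite normc_cE -expRM_natl mulrA opprK.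
  apply: (@integrableS _ _ _ mu `[t, +oo[) => // x /=.
  by rewrite !in_itv/= !andbT; exact: ltW.
have If : \int[mu]_(x in `]t, +oo[) normc (f x) ^+ 2 <= \int[mu]_(x in halfline) normc (f x) ^+ 2.
  by apply: ler_Rintegral_sub => // x _; exact: sqr_ge0.
have h : normc (tail_transform f t) <= expR (- Re c * t) *
    (Num.sqrt (expR (2 * Re c * t) / (- (2 * Re c))) *
     Num.sqrt (\int[mu]_(x in halfline) normc (f x) ^+ 2)).
  rewrite tail_transformE// Normc.normcM normc_cE ReN ler_wpM2l ?expR_ge0//.
  apply: le_trans (normc_cint _ cfit) _ => //.
  under eq_Rintegral do rewrite Normc.normcM.
  by apply: le_trans le1 _; rewrite IE ler_wpM2l ?sqrtr_ge0// ler_wsqrtr.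
have e2 : expR (- Re c * t) ^+ 2 * expR (2 * Re c * t) = 1.
  rewrite -expRM_natl -expRD [X in expR X](_ : _ = 0) ?expR0//; ring.
have G0 : 0 <= \int[mu]_(x in halfline) normc (f x) ^+ 2.
  by apply: Rintegral_ge0 => x _; exact: sqr_ge0.
apply: (@le_trans _ _ ((expR (- Re c * t) *
    (Num.sqrt (expR (2 * Re c * t) / (- (2 * Re c))) *
     Num.sqrt (\int[mu]_(x in halfline) normc (f x) ^+ 2))) ^+ 2)).
  by rewrite ler_sqr ?nnegrE ?normc_ge0 ?(le_trans (normc_ge0 _) h).
rewrite !exprMn !sqr_sqrtr//; last by rewrite divr_ge0 ?expR_ge0// ltW.
by rewrite mulrA mulrA e2 mul1r mulrC.
Qed.

Lemma energy_identity y g (a : R[i]) b : 0 <= b ->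
  ac_deriv y (fun x => a * y x + g x) -> square_integrable g ->
  mu.-integrable `[0, b] (EFin \o (fun x => normc (y x) ^+ 2)) /\
  `|normc (y b) ^+ 2 - normc (y 0) ^+ 2 -
    2 * Re a * \int[mu]_(x in `[0, b]) normc (y x) ^+ 2| <=
  2 * (Num.sqrt (\int[mu]_(x in `[0, b]) normc (y x) ^+ 2) *
       Num.sqrt (\int[mu]_(x in halfline) normc (g x) ^+ 2)).
Proof.
move=> b0 hy hg.
have sub : `[0, b] `<=` (halfline : set R) by exact: itvcc_sub_halfline.
have my := ac_cmeasurable hy b0.
have y2 : mu.-integrable `[0, b] (EFin \o (fun x => normc (y x) ^+ 2)).
  apply: measurable_bounded_integrable => //.
  - suff : (lebesgue_measure `[0%R, b]%classic < +oo :> \bar R)%E by [].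
    by rewrite lebesgue_measure_itv/=; case: ifP => // _; exact: ltry.
  - by apply: measurable_funX; exact: measurable_normc.
  - exists ((normc (y 0) + variation (fun x => a * y x + g x) b) ^+ 2); split; rewrite ?num_real//.
    move=> M hM x /=; rewrite in_itv/= => /andP[x0 xb].
    apply: le_trans (ltW hM); rewrite ger0_norm ?sqr_ge0//.
    have := ac_bounded hy x0 xb => h.
    by rewrite ler_sqr ?nnegrE ?normc_ge0// (le_trans (normc_ge0 _) h).
split => //.
have [mg hg2] := hg.
have g2 : mu.-integrable `[0, b] (EFin \o (fun x => normc (g x) ^+ 2)).
  by apply: (@integrableS _ _ _ mu halfline).
have mgb : cmeasurable `[0, b] g by apply: cmeasurableS sub mg.
have [iyg leyg] := Rcauchy_schwarz (measurable_itv `[0, b])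
  (measurable_normc (measurable_itv _) my) (measurable_normc (measurable_itv _) mgb) y2 g2.
have iy : cintegrable `[0, b] (fun x => conjc (y x) * g x).
  apply: (@le_cintegrable _ _ _ (fun x => normc (y x) * normc (g x))) => //.
    by apply: cmeasurableM => //; exact: cmeasurable_conj.
  by move=> x _; rewrite Normc.normcM normc_conj.
have iyy : cintegrable `[0, b] (fun x => (normc (y x) ^+ 2)%:C).
  by split => //; exact: integrable0.
have [_] := ac_derivM (ac_deriv_conj hy) hy b0.
move/(congr1 (@complex.Re R)); rewrite ReD !conjcM_normc !ReC => E.
have iRe : mu.-integrable `[0, b] (EFin \o (fun x => Re (conjc (y x) * g x))) by case: iy.
have -> : normc (y b) ^+ 2 - normc (y 0) ^+ 2 - 2 * Re a * \int[mu]_(x in `[0, b]) normc (y x) ^+ 2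
  = 2 * \int[mu]_(x in `[0, b]) Re (conjc (y x) * g x).
  rewrite E; set I := fine _.
  have -> : I = \int[mu]_(x in `[0, b])
      (2 * Re a * normc (y x) ^+ 2 + 2 * Re (conjc (y x) * g x)).
    by apply: eq_Rintegral => x _; rewrite sqr_normcE !ReImE; ring.
  rewrite RintegralD ?RintegralZl//; first by ring.
    exact: integrable_scale.
  exact: integrable_scale.
rewrite normrM ger0_norm// ler_pM2l//.
apply: le_trans (le_normr_Rintegral _ _) _ => //.
apply: (@le_trans _ _ (\int[mu]_(x in `[0, b]) (normc (y x) * normc (g x)))).
  apply: le_Rintegral => //.
    by apply: integrable_norm; case: iy.
  move=> x _; apply: le_trans (Re_le_normc _) _; by rewrite Normc.normcM normc_conj.
apply: le_trans leyg _; rewrite ler_wpM2l ?sqrtr_ge0// ler_wsqrtr//.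
by apply: ler_Rintegral_sub => // x _; exact: sqr_ge0.
Qed.

Lemma head_transform_ac p : (forall b, 0 <= b -> cintegrable `[0, b] p) ->
  ac_deriv (head_transform p) (fun x => c * head_transform p x + p x).
Proof.
move=> ip.
have ig b : 0 <= b -> cintegrable `[0, b] (fun x => cE (- c) x * p x).
  by move=> b0; apply: ac_mul_integrable (ac_cE _) b0 (ip b b0).
have := ac_derivM (ac_cE c) (ac_deriv_cint ig); apply: eq_ac_deriv => x x0 //.
by rewrite [cE c x * (_ * _)]mulrA cEK mul1r /head_transform; ring.
Qed.

Lemma head_transform0 p : head_transform p 0 = 0.
Proof.
rewrite /head_transform cE0 mul1r set_itv1.
by apply: complexP; rewrite /= Rintegral_set1.
Qed.

Lemma head_transform_square p : square_integrable p ->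
  (forall b, 0 <= b -> cintegrable `[0, b] p) ->
  square_integrable (head_transform p) /\
  \int[mu]_(x in halfline) normc (head_transform p x) ^+ 2 <=
  (\int[mu]_(x in halfline) normc (p x) ^+ 2) / Re c ^+ 2.
Proof.
move=> hp ip; have hy := head_transform_ac ip.
apply: square_integrable_of_bound; first exact: ac_cmeasurable_halfline hy.
move=> b b0; have [iy] := energy_identity b0 hy hp; move=> H; split => //.
have z2 : (0 : R) ^+ 2 = 0 by rewrite expr0n.
move: H; rewrite head_transform0 Normc.normc0 z2 subr0.
set X := \int[mu]_(x in `[0, b]) _; set G := \int[mu]_(x in halfline) _.
have X0 : 0 <= X by apply: Rintegral_ge0 => x _; exact: sqr_ge0.
have G0 : 0 <= G by apply: Rintegral_ge0 => x _; exact: sqr_ge0.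
have := sqr_sqrtr X0; have := sqr_sqrtr G0.
have := sqrtr_ge0 X; have := sqrtr_ge0 G.
move: (Num.sqrt X) (Num.sqrt G) => s r r0 s0 rG sX; rewrite ler_norml => /andP[_ h].
have yb := sqr_ge0 (normc (head_transform p b)).
rewrite ler_pdivlMr; last by rewrite exprn_even_gt0//= lt_eqF.
rewrite -sX -rG -exprMn -[leLHS]sqrrN -mulrN ler_sqr ?nnegrE ?mulr_ge0 ?oppr_ge0 ?(ltW hc)//.
have [->|sn] := eqVneq s 0; first by rewrite mul0r.
have sP : 0 < s by rewrite lt_neqAle eq_sym sn.
rewrite -(ler_pM2l sP); nra.
Qed.

Lemma tail_transform_square f : square_integrable f ->
  square_integrable (tail_transform f) /\
  \int[mu]_(x in halfline) normc (tail_transform f x) ^+ 2 <=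
  2 * (\int[mu]_(x in halfline) normc (f x) ^+ 2) / Re c ^+ 2.
Proof.
move=> hf; have df := decaying_square_integrable hf.
have hy := tail_transform_ac df.
have hfN := square_integrableN hf.
apply: square_integrable_of_bound; first exact: ac_cmeasurable_halfline hy.
move=> b b0; have [iy] := energy_identity b0 hy hfN; move=> H; split => //.
move: H.
set X := \int[mu]_(x in `[0, b]) _; set G := \int[mu]_(x in halfline) normc (f x) ^+ 2.
have -> : \int[mu]_(x in halfline) normc (- f x) ^+ 2 = G.
  by apply: eq_Rintegral => x _; rewrite normcN.
have X0 : 0 <= X by apply: Rintegral_ge0 => x _; exact: sqr_ge0.
have G0 : 0 <= G by apply: Rintegral_ge0 => x _; exact: sqr_ge0.
have yb : normc (tail_transform f b) ^+ 2 <= G / (- (2 * Re c)) by exact: sqr_tail_transform_le.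
have y0 := sqr_ge0 (normc (tail_transform f 0)).
have := sqr_sqrtr X0; have := sqr_sqrtr G0.
have := sqrtr_ge0 X; have := sqrtr_ge0 G.
move: (Num.sqrt X) (Num.sqrt G) => s r r0 s0 rG sX; rewrite ReN ler_norml => /andP[h _].
move: yb; rewrite ler_pdivlMr ?oppr_gt0 ?pmulr_rlt0// => yb.
rewrite ler_pdivlMr; last by rewrite exprn_even_gt0//= lt_eqF.
move: h yb y0 hc; rewrite -sX -rG; move: (normc _ ^+ 2) (normc _ ^+ 2) (Re c) => pb p0 k.
move=> h yb y0 k0; have := sqr_ge0 (- k * s - r).
have h2 : - k * (2 * - k * s ^+ 2) <= - k * (p0 + 2 * (s * r)).
  by rewrite ler_wpM2l ?oppr_ge0 ?(ltW k0)//; lra.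
nra.
Qed.

End GreenEdge.

Section GreenStar.
Context {R : realType} {n : nat}.
Local Notation mu := (@lebesgue_measure R).
Local Notation starfun := ('I_n -> R -> R[i]).
Variable c : R[i].
Hypothesis hc : Re c < 0.
Hypothesis hn : (0 < n)%N.
Implicit Types (f g phi dphi psi dpsi : starfun).

Definition green_coef f : R[i] :=
  - (\sum_k tail_transform c (f k) 0) / (n%:R * c).

Definition green f : starfun := fun j x =>
  head_transform c (tail_transform c (f j)) x + green_coef f * cE c x.

Definition dgreen f : starfun := fun j x =>
  c * green f j x + tail_transform c (f j) x.

Let c0 : c != 0.
Proof. by apply/eqP => h; move: hc; rewrite h ltxx. Qed.

Lemma cintegrable_one b : cintegrable `[0, b] (fun=> 1 : R[i]).
Proof.
split; apply: continuous_compact_integrable; try exact: segment_compact.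
  by apply: continuous_subspaceT => x; exact: cvg_cst.
by apply: continuous_subspaceT => x; exact: cvg_cst.
Qed.

Lemma tail_transform_loc f j b : decaying c (f j) -> 0 <= b ->
  cintegrable `[0, b] (tail_transform c (f j)).
Proof.
move=> df b0; have h := ac_mul_integrable (tail_transform_ac df) b0 (cintegrable_one b).
by apply: eq_cintegrable h => // x _; rewrite mulr1.
Qed.

Lemma green_ac f j : decaying c (f j) -> ac_deriv (green f j) (dgreen f j).
Proof.
move=> df.
have := ac_derivD (head_transform_ac c (fun b b0 => tail_transform_loc df b0))
  (ac_derivZ (green_coef f) (ac_cE c)); apply: eq_ac_deriv => x x0 //.
by rewrite /dgreen /green; ring.
Qed.

Lemma dgreen_ac f j : decaying c (f j) ->
  ac_deriv (dgreen f j) (fun x => c ^+ 2 * green f j x - f j x).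
Proof.
move=> df; have := ac_derivD (ac_derivZ c (green_ac df)) (tail_transform_ac df).
by apply: eq_ac_deriv => x x0 //; rewrite /dgreen; ring.
Qed.

Lemma green0 f j : green f j 0 = green_coef f.
Proof. by rewrite /green head_transform0 cE0 mulr1 add0r. Qed.

Lemma dgreen_kirchhoff f : \sum_j dgreen f j 0 = 0.
Proof.
rewrite /dgreen big_split/=; under eq_bigr do rewrite green0.
rewrite sumr_const card_ord -mulr_natl /green_coef.
have n0 : n%:R != 0 :> R[i] by rewrite pnatr_eq0 -lt0n.
move: (\sum_k _) => S; field; by rewrite c0 n0.
Qed.

Lemma green_L2 f : L2 f -> L2 (green f).
Proof.
move=> hf j; apply: square_integrableD.
  have [hp _] := tail_transform_square hc (hf j).
  have df := decaying_square_integrable hc (hf j).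
  by have [] := head_transform_square hc hp (fun b b0 => tail_transform_loc df b0).
by apply: square_integrableZ; exact: square_integrable_cE.
Qed.

Lemma dgreen_L2 f : L2 f -> L2 (dgreen f).
Proof.
move=> hf j; apply: square_integrableD.
  by apply: square_integrableZ; exact: green_L2.
by have [] := tail_transform_square hc (hf j).
Qed.

Lemma green_bounded : exists2 M : R, 0 <= M & forall f, L2 f -> L2norm (green f) <= M * L2norm f.
Proof.
pose E : starfun := fun _ => cE c.
have hE : L2 E by move=> j; exact: square_integrable_cE.
pose M1 := Num.sqrt (2 / (Re c ^+ 2) ^+ 2).
pose M2 := (Num.sqrt ((- (2 * Re c))^-1) * n%:R / normc (n%:R * c)) * L2norm E.
have M2_ge0 : 0 <= M2.
  by rewrite mulr_ge0 ?L2norm_ge0// divr_ge0 ?normc_ge0// mulr_ge0 ?sqrtr_ge0.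
exists (M1 + M2) => [|f hf]; first by rewrite addr_ge0 ?sqrtr_ge0.
pose Y : starfun := fun j => head_transform c (tail_transform c (f j)).
have hY : L2 Y /\ normsq Y <= (2 / (Re c ^+ 2) ^+ 2) * normsq f.
  have h j : square_integrable (Y j) /\ \int[mu]_(x in halfline) normc (Y j x) ^+ 2 <=
      (2 / (Re c ^+ 2) ^+ 2) * \int[mu]_(x in halfline) normc (f j x) ^+ 2.
    have [hp hp2] := tail_transform_square hc (hf j).
    have df := decaying_square_integrable hc (hf j).
    have [h1 h2] := head_transform_square hc hp (fun b b0 => tail_transform_loc df b0).
    split => //; apply: le_trans h2 _.
    rewrite ler_pdivrMr; last by rewrite exprn_even_gt0//= lt_eqF.
    apply: le_trans hp2 _; rewrite le_eqVlt; apply/orP; left; apply/eqP.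
    by field; rewrite lt_eqF.
  split; first by move=> j; case: (h j).
  by rewrite /normsq mulr_sumr; apply: ler_sum => j _; case: (h j).
have [hY1 hY2] := hY.
have nY : L2norm Y <= M1 * L2norm f.
  rewrite !L2normE /M1 -sqrtrM ?divr_ge0 ?sqr_ge0//; exact: ler_wsqrtr.
have -> : green f = sadd Y (sscale (green_coef f) E) by [].
apply: le_trans (L2normD hY1 (L2Z _ hE)) _; rewrite mulrDl lerD// L2normZ//.
rewrite /M2 mulrAC ler_wpM2r ?L2norm_ge0//.
rewrite /green_coef mulNr normcN Normc.normcM Normc.normcV mulrAC.
rewrite ler_wpM2r ?invr_ge0 ?normc_ge0//.
apply: le_trans (normc_sum _ _ _) _.
apply: (@le_trans _ _ (\sum_(k < n) Num.sqrt ((- (2 * Re c))^-1) * L2norm f)); last first.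
  rewrite sumr_const card_ord -mulr_natr mulrAC le_eqVlt; apply/orP; left; apply/eqP; ring.
apply: ler_sum => k _.
have a0 : 0 < - (2 * Re c) by rewrite oppr_gt0 pmulr_rlt0.
rewrite L2normE -sqrtrM ?invr_ge0 ?(ltW a0)//.
rewrite -[leLHS]ger0_norm ?normc_ge0// -sqrtr_sqr; apply: ler_wsqrtr.
apply: le_trans (sqr_tail_transform_le hc (hf k) (lexx 0)) _.
by rewrite mulrC ler_wpM2l ?invr_ge0 ?(ltW a0)//; exact: normsq_component.
Qed.

Lemma form0E phi dphi psi dpsi :
  Defs.form (fun _ _ => 0) phi dphi psi dpsi = inner dphi dpsi.
Proof.
rewrite /Defs.form big1 ?addr0// => j _; rewrite -[RHS](cint0 halfline).
by apply: eq_cint => x _; rewrite !mul0r.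
Qed.

Lemma green_resolvent f : L2 f -> resolvent (fun _ _ => 0) (- c ^+ 2) f (green f).
Proof.
move=> hf; have hG := green_L2 hf; have hdG := dgreen_L2 hf.
have hg : L2 (fun j x => f j x + - c ^+ 2 * green f j x) by exact: L2D (L2Z _ _).
split => //.
have df j : decaying c (f j) by exact: decaying_square_integrable.
exists (dgreen f).
  split; [exact: hG|exact: hdG|by move=> j; exact: green_ac|].
  by move=> i j; rewrite !green0.
move=> phi dphi [hphi hdphi acphi cphi]; rewrite form0E /inner.
have edge j : cint halfline (fun x => conjc (dphi j x) * dgreen f j x) =
    - (conjc (phi j 0) * dgreen f j 0) +
    cint halfline (fun x => conjc (phi j x) * (f j x + - c ^+ 2 * green f j x)).
  have hw := ac_derivM (ac_deriv_conj (acphi j)) (dgreen_ac (df j)).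
  have i1 := square_integrable_dot (hphi j) (hdG j).
  have i2 := square_integrable_dot (hdphi j) (hdG j).
  have i3 := square_integrable_dot (hphi j) (hg j).
  have i4 : cintegrable halfline (fun x => dgreen f j x * conjc (dphi j x) +
      conjc (phi j x) * (c ^+ 2 * green f j x - f j x)).
    apply: eq_cintegrable (cintegrableB measurable_halfline i2 i3) => // x _.
    by rewrite mulNr; ring.
  rewrite -(ac_deriv_boundary hw i1 i4) -cintD//.
  by apply: eq_cint => x _; rewrite mulNr; ring.
under eq_bigr do rewrite edge.
rewrite big_split/= [X in X + _](_ : _ = 0) ?add0r// sumrN.
have j0 : 'I_n by case: (n) hn => // m _; exact: ord0.
under eq_bigr do rewrite (cphi _ j0).
by rewrite -mulr_sumr dgreen_kirchhoff mulr0 oppr0.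
Qed.

Lemma resolvent0_unique psi : (forall s : R, 0 <= s -> - c ^+ 2 != s%:C) ->
  resolvent (fun _ _ => 0) (- c ^+ 2) (fun _ _ => 0) psi ->
  L2_eq psi (fun _ _ => 0).
Proof.
move=> zn [hg [dpsi H1psi hform]].
have [hpsi hdpsi acpsi _] := H1psi.
have := hform psi dpsi H1psi; rewrite form0E.
have -> : (fun (j : 'I_n) x => 0 + - c ^+ 2 * psi j x) = sscale (- c ^+ 2) psi.
  by apply/funext => j; apply/funext => x; rewrite add0r.
rewrite innerZr// !inner_self => E.
apply: L2norm_eq0 => //; rewrite L2normE.
have [->|nz] := eqVneq (normsq psi) 0; first by rewrite sqrtr0.
have zz : - c ^+ 2 = (normsq dpsi / normsq psi)%:C.
  have nzC : (normsq psi)%:C != 0 :> R[i] by apply: contra nz => /eqP [->].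
  apply: (mulIf nzC); rewrite -E -rmorphM divfK//.
by have := zn _ (divr_ge0 (normsq_ge0 dpsi) (normsq_ge0 psi)); rewrite -zz eqxx.
Qed.

End GreenStar.

(** * Finite-rank approximation of the Birman-Schwinger operator *)

Section DiscreteSums.
Context {R : realType}.

Lemma sum_le_telescope (psi : R -> R) (a : nat -> R) (d : R) N :
  (forall k, a k <= psi (k.+1%:R * d) - psi (k%:R * d)) ->
  \sum_(k < N) a k <= psi (N%:R * d) - psi 0.
Proof.
move=> h; rewrite -[X in _ - psi X](mul0r d).
have -> : psi (N%:R * d) - psi (0%:R * d) = \sum_(0 <= k < N) (psi (k.+1%:R * d) - psi (k%:R * d)).
  by rewrite (telescope_sumr (fun k => psi (k%:R * d))).
by rewrite big_mkord; apply: ler_sum => k _; exact: h.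
Qed.

Lemma geometric_sum_bound (a d x : R) N : 0 < a -> 0 < d ->
  \sum_(k < N) d * (if k%:R * d <= x then expR (- a * (x - k%:R * d)) else 0) <= d + a^-1.
Proof.
move=> a0 d0; pose psi s := (d + a^-1) * expR (- a * Num.max 0 (x + d - s)).
have C0 : 0 <= d + a^-1 by rewrite addr_ge0 ?invr_ge0// ltW.
suff hk k : d * (if k%:R * d <= x then expR (- a * (x - k%:R * d)) else 0) <=
    psi (k.+1%:R * d) - psi (k%:R * d).
  apply: le_trans (@sum_le_telescope psi _ d N hk) _.
  rewrite /psi; have : expR (- a * Num.max 0 (x + d - N%:R * d)) <= 1.
    by rewrite -expR0 ler_expR mulNr oppr_le0 mulr_ge0 ?(ltW a0)// le_max lexx.
  have := expR_ge0 (- a * Num.max 0 (x + d - 0)); nra.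
have mono : psi (k%:R * d) <= psi (k.+1%:R * d).
  rewrite /psi ler_wpM2l// ler_expR !mulNr lerN2 ler_pM2l// ge_max le_max lexx/=.
  rewrite le_max; apply/orP; right; rewrite lerD2l lerN2 ler_pM2r// ler_nat//.
case: ifP => [kx|_]; last by rewrite mulr0 subr_ge0.
rewrite /psi !max_r; last 2 first.
- by rewrite -addrA; nra.
- by rewrite -natr1 mulrDl mul1r; nra.
have -> : x + d - k.+1%:R * d = x - k%:R * d by rewrite -natr1; ring.
have -> : - a * (x + d - k%:R * d) = - a * (x - k%:R * d) - a * d by ring.
rewrite expRD -mulrBr -{2}[expR (- a * (x - k%:R * d))]mulr1 -mulrBr [leRHS]mulrCA mulrC.
rewrite ler_wpM2l ?expR_ge0//.
have e1 : expR (- (a * d)) <= (1 + a * d)^-1.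
  rewrite expRN lef_pV2 ?posrE ?expR_gt0//; first exact: expR_ge1Dx.
  by rewrite ltr_wpDr ?mulr_ge0 ?ltW.
have ad : 0 < 1 + a * d by rewrite ltr_wpDr ?mulr_ge0 ?ltW.
have dE : d = (d + a^-1) * (1 - (1 + a * d)^-1).
  by field; rewrite (gt_eqF ad) gt_eqF.
rewrite {1}dE.
by rewrite ler_wpM2l// lerD2l lerN2.
Qed.

Lemma window_sum_bound (d w x : R) N : 0 < d -> d <= w ->
  \sum_(k < N) d * (if (x < k%:R * d) && (k%:R * d <= x + w) then 1 else 0) <= 2 * w.
Proof.
move=> d0 dw; pose psi s := Num.min (2 * w) (Num.max 0 (s - x)).
have w0 : 0 < w by exact: lt_le_trans dw.
suff hk k : d * (if (x < k%:R * d) && (k%:R * d <= x + w) then 1 else 0) <=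
    psi (k.+1%:R * d) - psi (k%:R * d).
  apply: le_trans (@sum_le_telescope psi _ d N hk) _.
  have : psi (N%:R * d) <= 2 * w by rewrite ge_min lexx.
  have : 0 <= psi 0 by rewrite le_min le_max lexx mulr_ge0 ?(ltW w0).
  lra.
have mono : psi (k%:R * d) <= psi (k.+1%:R * d).
  rewrite /psi le_min !ge_min lexx/=; apply/orP; right.
  rewrite ge_max le_max lexx/= le_max lerD2r ler_pM2r// ler_nat leqnSn orbT//.
case: ifP => [/andP[xk kx]|_]; last by rewrite mulr0 subr_ge0.
rewrite mulr1 /psi !max_r; last 2 first.
- by rewrite subr_ge0 ltW.
- by rewrite subr_ge0 -natr1 mulrDl mul1r; nra.
rewrite !min_r; first by rewrite -natr1; nra.
  by rewrite lerBlDl; nra.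
by rewrite -natr1 mulrDl mul1r; nra.
Qed.

End DiscreteSums.

Section Kernel.
Context {R : realType}.
Local Notation mu := (@lebesgue_measure R).
Variable c : R[i].
Hypothesis hc : Re c < 0.

Definition hker (t x : R) : R[i] := if t <= x then cE c (x - t) else 0.

Definition ohker (o : option R) (x : R) : R[i] := if o is Some t then hker t x else 0.

Let a := - (2 * Re c).
Let a0 : 0 < a.
Proof. by rewrite oppr_gt0 pmulr_rlt0. Qed.

Lemma normc_hker_le1 t x : normc (hker t x) <= 1.
Proof.
rewrite /hker; case: ifP => [tx|_]; last by rewrite Normc.normc0.
by rewrite normc_cE -expR0 ler_expR mulr_le0_ge0 ?(ltW hc)// subr_ge0.
Qed.

Lemma sqr_normc_hker t x : normc (hker t x) ^+ 2 =
  if t <= x then expR (- a * (x - t)) else 0.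
Proof.
rewrite /hker; case: ifP => [tx|_]; last by rewrite Normc.normc0 expr0n.
by rewrite normc_cE -expRM_natl /a opprK mulrA.
Qed.

Lemma cmeasurable_hker t (D : set R) : measurable D -> D `<=` halfline ->
  cmeasurable D (hker t).
Proof.
move=> mD sub.
have h1 : cmeasurable D (fun x => (\1_(`[t, +oo[%classic) x)%:C * (cE c x * cE c (- t)) : R[i]).
  apply: cmeasurableM => //.
    by apply: cmeasurable_real; exact: measurable_indic.
  apply: cmeasurableM => //.
  by apply: cmeasurableS sub _ => //; exact: cmeasurable_cE.
apply: eq_cmeasurable h1 => x _; rewrite /hker indicE mem_setE in_itv/= andbT.
by case: (t <= x); rewrite ?mul0r// mul1r -cED.
Qed.

Lemma normc_1B_cE (t : R) : 0 <= t -> normc (1 - cE c t) <= normc c * t.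
Proof.
move=> t0; rewrite normc_distC -(cE0 c) (ac_incr (ac_cE c))//.
have ic := ac_integrable (ac_cE c) t0.
have sub : `]0, t] `<=` (`[0, t] : set R) by exact: itvoc_sub_cc.
have ic' : cintegrable `]0, t] (fun x => c * cE c x) by apply: cintegrableS sub ic.
apply: le_trans (normc_cint _ ic') _ => //.
rewrite -[X in _ <= _ * X]subr0; apply: integral_le_cst => //.
  exact: cintegrable_normc.
move=> x x0 _; rewrite Normc.normcM ler_piMr ?normc_ge0//.
by rewrite normc_cE -expR0 ler_expR mulr_le0_ge0 ?(ltW hc)// ltW.
Qed.

Lemma hker_shift_bound (s t d x : R) : t <= s -> s <= t + d ->
  normc (hker s x - hker t x) ^+ 2 <=
  (normc c * d) ^+ 2 * normc (hker s x) ^+ 2 +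
  (if (x < s) && (s <= x + d) then 1 else 0).
Proof.
move=> ts sd; have d0 : 0 <= d by lra.
have [sx|xs] := leP s x.
  rewrite {1 3}/hker sx {1}/hker (le_trans ts sx).
  have -> : cE c (x - t) = cE c (x - s) * cE c (s - t).
    by rewrite -cED addrA subrK.
  rewrite -{1}[cE c (x - s)]mulr1 -mulrBr Normc.normcM exprMn [leLHS]mulrC /= addr0 ler_wpM2r ?sqr_ge0//.
  rewrite ler_sqr ?nnegrE ?normc_ge0 ?mulr_ge0 ?normc_ge0//.
  apply: le_trans (normc_1B_cE _) _; rewrite ?subr_ge0// ler_wpM2l ?normc_ge0//.
  by rewrite lerBlDl.
rewrite {1 3}/hker [s <= x]leNgt xs/= sub0r normcN Normc.normc0 expr0n mulr0 add0r.
have [tx|xt] := leP t x.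
  have -> : s <= x + d by lra.
  by rewrite expr_le1 ?normc_ge0// normc_hker_le1.
rewrite /hker [t <= x]leNgt xt Normc.normc0 expr0n /=; by case: ifP.
Qed.

(* [co k] is the node of the coarse grid below the fine node [k * d'], if any. *)
Lemma refinement_sum_bound (d d' L x : R) N (co : nat -> option R) :
  0 < d' -> d' <= d ->
  (forall k t, co k = Some t -> t <= k%:R * d' /\ k%:R * d' <= t + d) ->
  (forall k, co k = None -> L <= k%:R * d') ->
  \sum_(k < N) d' * normc (hker (k%:R * d') x - ohker (co k) x) ^+ 2 <=
  (d' + a^-1) * ((normc c * d) ^+ 2 + (if L <= x then 1 else 0)) + 2 * d.
Proof.
move=> d'0 d'd hs hn; have d0 := lt_le_trans d'0 d'd.
set I : R := if L <= x then 1 else 0.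
have I0 : 0 <= I by rewrite /I; case: ifP.
pose e k : R := if k%:R * d' <= x then expR (- a * (x - k%:R * d')) else 0.
pose w k : R := if (x < k%:R * d') && (k%:R * d' <= x + d) then 1 else 0.
have e0 k : 0 <= e k by rewrite /e; case: ifP => // _; exact: expR_ge0.
have w0 k : 0 <= w k by rewrite /w; case: ifP.
apply: (@le_trans _ _ (\sum_(k < N) (((normc c * d) ^+ 2 + I) * (d' * e k) + d' * w k))).
  apply: ler_sum => k _.
  have -> : ((normc c * d) ^+ 2 + I) * (d' * e k) + d' * w k =
    d' * (((normc c * d) ^+ 2 + I) * e k + w k) by ring.
  rewrite ler_pM2l//.
  case E : (co k) => [t|] /=.
    have [t1 t2] := hs _ _ E; apply: le_trans (hker_shift_bound x t1 t2) _.
    rewrite sqr_normc_hker -/(e k) lerD2r ler_wpM2r// lerDl//.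
  rewrite subr0 sqr_normc_hker -/(e k).
  have := hn _ E => Lk; have h1 : e k <= I * e k.
    rewrite /I; case: ifP => [_|/negbT]; first by rewrite mul1r.
    rewrite -ltNge mul0r /e => xL; case: ifP => // kx.
    by move: xL; rewrite ltNge (le_trans Lk kx).
  have := sqr_ge0 (normc c * d); have := e0 k; have := w0 k; nra.
rewrite big_split/= -mulr_sumr; apply: lerD; last exact: window_sum_bound.
rewrite mulrC ler_wpM2r ?addr_ge0 ?sqr_ge0//; exact: geometric_sum_bound.
Qed.

Lemma grid_sum_bound (d' x : R) N : 0 < d' ->
  \sum_(k < N) d' * normc (hker (k%:R * d') x) ^+ 2 <= d' + a^-1.
Proof.
move=> d'0; apply: le_trans (@geometric_sum_bound R a d' x N a0 d'0).
by apply: ler_sum => k _; rewrite sqr_normc_hker.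
Qed.

End Kernel.

Section EdgeVectors.
Context {R : realType} {n : nat}.
Local Notation mu := (@lebesgue_measure R).
Local Notation starfun := ('I_n -> R -> R[i]).
Variable V : 'I_n -> R -> R.
Hypothesis hV : forall j, mu.-integrable halfline (EFin \o V j).
Implicit Types (h : R -> R[i]) (u : starfun) (j : 'I_n).

Definition bounded_measurable h :=
  cmeasurable halfline h /\ exists M : R, forall x, normc (h x) <= M.

Lemma bounded_measurableZ (a : R[i]) h : bounded_measurable h ->
  bounded_measurable (fun x => a * h x).
Proof.
move=> [mh [M hM]]; split; first by apply: cmeasurableM => //; exact: cmeasurable_cst.
by exists (normc a * M) => x; rewrite Normc.normcM ler_wpM2l ?normc_ge0.
Qed.

Lemma bounded_measurableB h1 h2 : bounded_measurable h1 -> bounded_measurable h2 ->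
  bounded_measurable (fun x => h1 x - h2 x).
Proof.
move=> [mh [M hM]] [mh' [M' hM']]; split; first exact: cmeasurableB.
by exists (M + M') => x; rewrite (le_trans (normcB _ _))// lerD.
Qed.

Lemma measurable_sqrt (f : R -> R) : measurable_fun halfline f ->
  measurable_fun halfline (fun x => Num.sqrt (f x)).
Proof.
move=> mf; apply: measurableT_comp mf.
by apply: continuous_measurable_fun; exact: sqrt_continuous.
Qed.

Lemma measurable_potential j : measurable_fun halfline (V j).
Proof. by apply/measurable_EFinP; exact: measurable_int (hV j). Qed.

Lemma cmeasurable_sqrt_abs j : cmeasurable halfline (fun x => (Num.sqrt `|V j x|)%:C : R[i]).
Proof.
apply: cmeasurable_real; apply: measurable_sqrt.
by apply: measurableT_comp => //; exact: measurable_potential.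
Qed.

Lemma cmeasurable_sqrt_sg j :
  cmeasurable halfline (fun x => (Num.sg (V j x) * Num.sqrt `|V j x|)%:C : R[i]).
Proof.
apply: cmeasurable_real.
have -> : (fun x => Num.sg (V j x) * Num.sqrt `|V j x|) =
    (fun x => Num.sqrt (V j x) - Num.sqrt (- V j x)).
  apply/funext => x; have [v0|v0|->] := ltrgt0P (V j x).
  - by rewrite gtr0_sg// mul1r [X in _ - X]ler0_sqrtr ?subr0// oppr_le0 ltW.
  - by rewrite ltr0_sg// mulN1r [Num.sqrt (V j x)]ler0_sqrtr ?sub0r// ltW.
  - by rewrite sgr0 mul0r oppr0 subrr.
apply: measurable_funB; apply: measurable_sqrt; first exact: measurable_potential.
by apply: measurableT_comp => //; exact: measurable_potential.
Qed.

Lemma integrable_potential j : mu.-integrable halfline (EFin \o (fun x => `|V j x|)).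
Proof. exact: integrable_abse (hV j). Qed.

Lemma normc_sqrt_abs j x : normc ((Num.sqrt `|V j x|)%:C : R[i]) ^+ 2 = `|V j x|.
Proof. by rewrite normc_real ger0_norm ?sqrtr_ge0// sqr_sqrtr. Qed.

Lemma normc_sqrt_sg j x :
  normc ((Num.sg (V j x) * Num.sqrt `|V j x|)%:C : R[i]) ^+ 2 = `|V j x|.
Proof.
rewrite normc_real normrM exprMn [X in _ * X ^+ 2]ger0_norm ?sqrtr_ge0// sqr_sqrtr//.
by have [->|v0] := eqVneq (V j x) 0; rewrite ?normr0 ?mulr0// normr_sg v0 expr1n mul1r.
Qed.

Lemma integrable_weight (f : R -> R) (M : R) j : measurable_fun halfline f ->
  (forall x, halfline x -> `|f x| <= M) ->
  mu.-integrable halfline (EFin \o (fun x => `|V j x| * f x)).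
Proof.
move=> mf hM; apply: (@le_integrable _ _ _ mu halfline _ _ (EFin \o (fun x => M * `|V j x|))) => //.
- apply/measurable_EFinP; apply: measurable_funM => //.
  by apply: measurableT_comp => //; exact: measurable_potential.
- move=> x x0 /=; rewrite lee_fin normrM normr_id normrM normr_id mulrC ler_wpM2r//.
  by rewrite (le_trans (hM _ x0))// ler_norm.
- by apply: integrable_scale => //; exact: integrable_potential.
Qed.

Lemma square_integrable_weight (m h : R -> R[i]) j : cmeasurable halfline m ->
  (forall x, normc (m x) ^+ 2 = `|V j x|) -> bounded_measurable h ->
  square_integrable (fun x => m x * h x).
Proof.
move=> mm hm [mh [M hM]]; split; first exact: cmeasurableM.
under eq_fun do rewrite Normc.normcM exprMn hm.
apply: (@integrable_weight _ (M ^+ 2)).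
  by apply: measurable_funX; exact: measurable_normc.
move=> x _; rewrite ger0_norm ?sqr_ge0// ler_sqr ?nnegrE ?normc_ge0//.
exact: le_trans (normc_ge0 _) (hM x).
Qed.

Definition left_vector j h : starfun := fun i x =>
  if i == j then (Num.sqrt `|V j x|)%:C * conjc (h x) else 0.

Definition right_vector j h : starfun := fun i x =>
  if i == j then (Num.sg (V j x) * Num.sqrt `|V j x|)%:C * h x else 0.

Definition edge_weight j h : R := \int[mu]_(x in halfline) (`|V j x| * normc (h x) ^+ 2).

Lemma bounded_measurable_conj h : bounded_measurable h ->
  bounded_measurable (fun x => conjc (h x)).
Proof.
move=> [mh [M hM]]; split; first exact: cmeasurable_conj.
by exists M => x; rewrite normc_conj.
Qed.

Lemma L2_left_vector j h : bounded_measurable h -> L2 (left_vector j h).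
Proof.
move=> bh i; rewrite /left_vector; case: (i == j); last exact: square_integrable0.
apply: square_integrable_weight; [exact: cmeasurable_sqrt_abs|exact: normc_sqrt_abs|].
exact: bounded_measurable_conj.
Qed.

Lemma L2_right_vector j h : bounded_measurable h -> L2 (right_vector j h).
Proof.
move=> bh i; rewrite /right_vector; case: (i == j); last exact: square_integrable0.
by apply: square_integrable_weight; [exact: cmeasurable_sqrt_sg|exact: normc_sqrt_sg|].
Qed.

Lemma normsq_single j (g : R -> R[i]) :
  normsq (fun i x => if i == j then g x else 0 : R[i]) =
  \int[mu]_(x in halfline) (normc (g x) ^+ 2).
Proof.
rewrite /normsq (bigD1 j)//= eqxx big1 ?addr0// => i /negbTE ->.
by under eq_Rintegral do rewrite Normc.normc0 expr0n; rewrite /Rintegral integral0.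
Qed.

Lemma L2norm_left_vector j h : L2norm (left_vector j h) = Num.sqrt (edge_weight j h).
Proof.
rewrite L2normE normsq_single; congr Num.sqrt; apply: eq_Rintegral => x _.
by rewrite Normc.normcM exprMn normc_sqrt_abs normc_conj.
Qed.

Lemma L2norm_right_vector j h : L2norm (right_vector j h) = Num.sqrt (edge_weight j h).
Proof.
rewrite L2normE normsq_single; congr Num.sqrt; apply: eq_Rintegral => x _.
by rewrite Normc.normcM exprMn normc_sqrt_sg.
Qed.

Lemma edge_weight_ge0 j h : 0 <= edge_weight j h.
Proof. by apply: Rintegral_ge0 => x _; rewrite mulr_ge0 ?sqr_ge0. Qed.

Lemma edge_weight_integrable j h : bounded_measurable h ->
  mu.-integrable halfline (EFin \o (fun x => `|V j x| * normc (h x) ^+ 2)).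
Proof.
move=> [mh [M hM]]; apply: (@integrable_weight _ (M ^+ 2)).
  by apply: measurable_funX; exact: measurable_normc.
move=> x _; rewrite ger0_norm ?sqr_ge0// ler_sqr ?nnegrE ?normc_ge0//.
exact: le_trans (normc_ge0 _) (hM x).
Qed.

Definition edge_pairing j h u : R[i] :=
  cint halfline (fun x => h x * mul_sqrt_abs V u j x).

Lemma cintegrable_mul_sqrt_abs j u : L2 u -> cintegrable halfline (mul_sqrt_abs V u j).
Proof.
move=> hu; apply: square_integrable_mul (hu j).
split; first exact: cmeasurable_sqrt_abs.
under eq_fun do rewrite normc_sqrt_abs; exact: integrable_potential.
Qed.

Lemma edge_pairing_integrable j h u : bounded_measurable h -> L2 u ->
  cintegrable halfline (fun x => h x * mul_sqrt_abs V u j x).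
Proof.
move=> [mh [M hM]] hu; apply: (@cintegrableM _ _ _ _ M) => //.
exact: cintegrable_mul_sqrt_abs.
Qed.

Lemma inner_left_vector j h u : inner (left_vector j h) u = edge_pairing j h u.
Proof.
rewrite /inner (bigD1 j)//= [X in _ + X]big1 ?addr0 => [|i /negbTE ij].
  apply: eq_cint => x _; rewrite /left_vector eqxx conjcM conjcK /mul_sqrt_abs.
  have -> : conjc ((Num.sqrt `|V j x|)%:C : R[i]) = (Num.sqrt `|V j x|)%:C.
    by apply: complexP; rewrite ?ReJ ?ImJ /= ?oppr0.
  by rewrite mulrA [h x * _]mulrC.
rewrite -[RHS](cint0 halfline); apply: eq_cint => x _.
by rewrite /left_vector ij conjc0 mul0r.
Qed.

Lemma edge_pairingB j h1 h2 u : bounded_measurable h1 -> bounded_measurable h2 -> L2 u ->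
  edge_pairing j (fun x => h1 x - h2 x) u = edge_pairing j h1 u - edge_pairing j h2 u.
Proof.
move=> b1 b2 hu; rewrite /edge_pairing -cintB//; try exact: edge_pairing_integrable.
by apply: eq_cint => x _; rewrite mulrBl.
Qed.

Lemma edge_pairingZ j (a : R[i]) h u : bounded_measurable h -> L2 u ->
  edge_pairing j (fun x => a * h x) u = a * edge_pairing j h u.
Proof.
move=> b1 hu; rewrite /edge_pairing -cintZ//; last exact: edge_pairing_integrable.
by apply: eq_cint => x _; rewrite mulrA.
Qed.

Lemma edge_weightZ j (a : R[i]) h : bounded_measurable h ->
  edge_weight j (fun x => a * h x) = normc a ^+ 2 * edge_weight j h.
Proof.
move=> bh; rewrite /edge_weight -RintegralZl//; last exact: edge_weight_integrable.
by apply: eq_Rintegral => x _; rewrite Normc.normcM exprMn mulrCA.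
Qed.

Lemma sqrt_edge_weightD j h1 h2 : bounded_measurable h1 -> bounded_measurable h2 ->
  Num.sqrt (edge_weight j h2) <= Num.sqrt (edge_weight j h1) +
    Num.sqrt (edge_weight j (fun x => h1 x - h2 x)).
Proof.
move=> b1 b2; rewrite -!L2norm_right_vector.
have -> : right_vector j h2 =
    ssub (right_vector j h1) (right_vector j (fun x => h1 x - h2 x)).
  apply/funext => i; apply/funext => x; rewrite /ssub /right_vector.
  by case: eqP => _; rewrite ?subr0//; ring.
apply: L2normB; apply: L2_right_vector => //; exact: bounded_measurableB.
Qed.

End EdgeVectors.

Section SumLemmas.

Lemma big_divn (A : nmodType) (F : nat -> A) N r : (0 < r)%N ->
  \sum_(k < N * r) F (k %/ r)%N = \sum_(k < N) F k *+ r.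
Proof.
move=> r0; rewrite -(big_mkord xpredT (fun k => F (k %/ r)%N)) big_nat_mul big_mkord.
apply: eq_bigr => k _; have -> : (k.+1 * r = r + k * r)%N by rewrite mulSn.
rewrite -{1}[(k * r)%N]add0n big_addn addnK; under eq_big_nat => i /andP[_ ir].
  rewrite addnC divnMDl// divn_small// addn0; over.
by rewrite sumr_const_nat subn0.
Qed.

(* The dummy element [t0] keeps the pieces nonempty, so that the partial sums exhaust [s]. *)
Lemma concat_sequence (T : Type) (t0 : T) (l : nat -> seq T) :
  exists (s : nat -> T) (len : nat -> nat), (forall m, m <= len m)%N /\
  forall (A : nmodType) (F : T -> A) m,
    \sum_(k < len m) F (s k) = \sum_(i < m) (F t0 + \sum_(p <- l i) F p).
Proof.
pose P m := flatten [seq t0 :: l i | i <- iota 0 m].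
have PS m : P m.+1 = P m ++ (t0 :: l m).
  by rewrite /P -addn1 iotaD map_cat flatten_cat /= cats0 add0n.
have Pprefix m k : exists w, P (m + k)%N = P m ++ w.
  elim: k => [|k [w ih]]; first by exists [::]; rewrite addn0 cats0.
  by rewrite addnS PS ih; exists (w ++ t0 :: l (m + k)%N); rewrite catA.
have sizeP m : (m <= size (P m))%N.
  elim: m => [//|m ih]; rewrite PS size_cat /= addnS ltnS; apply: leq_trans ih (leq_addr _ _).
exists (fun k => nth t0 (P k.+1) k), (fun m => size (P m)); split=> // A F m.
transitivity (\sum_(p <- P m) F p).
  rewrite (big_nth t0) big_mkord; apply: eq_bigr => -[k kP] _ /=; congr F.
  have [mk|km] := leqP m k.+1.
    have [w e] := Pprefix m (k.+1 - m)%N; move: e; rewrite subnKC// => ->.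
    by rewrite nth_cat kP.
  have [w e] := Pprefix k.+1 (m - k.+1)%N; move: e; rewrite subnKC ?(ltnW km)// => ->.
  by rewrite nth_cat sizeP.
rewrite /P big_flatten big_map; under eq_bigr do rewrite big_cons.
by rewrite -(big_mkord xpredT (fun i => F t0 + \sum_(p <- l i) F p)) /index_iota subn0.
Qed.

End SumLemmas.

Section Grid.
Context {R : realType} {n : nat}.
Local Notation mu := (@lebesgue_measure R).
Local Notation starfun := ('I_n -> R -> R[i]).
Variable V : 'I_n -> R -> R.
Hypothesis hV : forall j, mu.-integrable halfline (EFin \o V j).
Variable c : R[i].
Hypothesis hc : Re c < 0.
Implicit Types (h : R -> R[i]) (u : starfun) (j : 'I_n).

Lemma Rintegral_sum (I : Type) (r : seq I) (D : set R) (F : I -> R -> R) : measurable D ->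
  (forall i, mu.-integrable D (EFin \o F i)) ->
  mu.-integrable D (EFin \o (fun x => \sum_(i <- r) F i x)) /\
  \int[mu]_(x in D) (\sum_(i <- r) F i x) = \sum_(i <- r) \int[mu]_(x in D) F i x.
Proof.
move=> mD h; elim: r => [|i r [ih1 ih2]].
  rewrite big_nil; under eq_Rintegral do rewrite big_nil.
  rewrite /comp; under eq_fun do rewrite big_nil.
  by split; [exact: integrable0|rewrite /Rintegral integral0].
rewrite big_cons -ih2; under eq_Rintegral do rewrite big_cons.
rewrite /comp; under eq_fun do rewrite big_cons.
by split; [exact: integrable_add|rewrite RintegralD].
Qed.

Lemma bounded_hker t : bounded_measurable (hker c t).
Proof.
split; first exact: cmeasurable_hker.
by exists 1 => x; exact: normc_hker_le1.
Qed.

Lemma bounded_ohker o : bounded_measurable (ohker c o).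
Proof.
case: o => [t|]; first exact: bounded_hker.
by split; [exact: cmeasurable_cst|exists 0 => x; rewrite Normc.normc0].
Qed.

Definition potential_norm := \sum_j \int[mu]_(x in halfline) `|V j x|.

Lemma potential_norm_ge0 : 0 <= potential_norm.
Proof. by apply: sumr_ge0 => j _; apply: Rintegral_ge0. Qed.

Lemma potential_norm_component j : \int[mu]_(x in halfline) `|V j x| <= potential_norm.
Proof.
by rewrite /potential_norm (bigD1 j)//= lerDl; apply: sumr_ge0 => i _; apply: Rintegral_ge0.
Qed.

Lemma edge_weight_sum (B1 B2 L w : R) N j (h : 'I_N -> R -> R[i]) : 0 <= L -> 0 <= B1 -> 0 <= B2 ->
  (forall k, bounded_measurable (h k)) -> 0 <= w ->
  (forall x, \sum_k w * normc (h k x) ^+ 2 <= B1 + B2 * (if L <= x then 1 else 0)) ->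
  \sum_k w * edge_weight V j (h k) <=
  B1 * potential_norm + B2 * \int[mu]_(x in `]L, +oo[) `|V j x|.
Proof.
move=> L0 B10 B20 bh w0 hB.
have iw k : mu.-integrable halfline (EFin \o (fun x => w * (`|V j x| * normc (h k x) ^+ 2))).
  by apply: integrable_scale => //; exact: edge_weight_integrable.
have [iS eS] := Rintegral_sum (index_enum 'I_N) measurable_halfline iw.
rewrite (eq_bigr (fun k => \int[mu]_(x in halfline) (w * (`|V j x| * normc (h k x) ^+ 2)))); last first.
  by move=> k _; rewrite RintegralZl//; exact: edge_weight_integrable.
rewrite -eS.
pose I x : R := if L <= x then 1 else 0.
have mI : measurable_fun halfline I.
  have -> : I = \1_(`[L, +oo[%classic).
    by apply/funext => x; rewrite indicE mem_setE in_itv/= andbT /I; case: ifP.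
  exact: measurable_indic.
have iI : mu.-integrable halfline (EFin \o (fun x => `|V j x| * I x)).
  apply: (@integrable_weight _ _ _ hV _ 1) => // x _; rewrite /I; case: ifP => _; by rewrite ?normr1 ?normr0.
have iV := integrable_potential hV j.
apply: (@le_trans _ _ (\int[mu]_(x in halfline) (B1 * `|V j x| + B2 * (`|V j x| * I x)))).
  apply: le_Rintegral => //; first by apply: integrable_add => //; exact: integrable_scale.
  move=> x _; rewrite (eq_bigr (fun k => `|V j x| * (w * normc (h k x) ^+ 2))); last by move=> k _; rewrite mulrCA.
  rewrite -mulr_sumr mulrCA -[B1 * _]mulrC -mulrDr ler_wpM2l//; exact: hB.
rewrite RintegralD//; last 2 first.
- exact: integrable_scale.
- exact: integrable_scale.
rewrite !RintegralZl//; apply: lerD.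
  by rewrite ler_wpM2l// potential_norm_component.
rewrite ler_wpM2l//.
have i0 : mu.-integrable `[0, L] (EFin \o (fun x => `|V j x| * I x)).
  by apply: (@integrableS _ _ _ mu halfline) => //; exact: itvcc_sub_halfline.
have -> : \int[mu]_(x in halfline) (`|V j x| * I x) =
    \int[mu]_(x in `[0, L]) (`|V j x| * I x) + \int[mu]_(x in `]L, +oo[) (`|V j x| * I x).
  by rewrite Rintegral_tail//; ring.
rewrite -Rintegral_itv_bndo_bndc; last first.
  apply: (@integrableS _ _ _ mu `[0, L]%classic) => //.
  by move=> x /=; rewrite !in_itv/= => /andP[-> /ltW].
rewrite [X in X + _](_ : _ = 0) ?add0r; last first.
  rewrite (@eq_Rintegral _ _ _ _ _ (fun=> 0)); first by rewrite /Rintegral integral0.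
  move=> x /set_mem /=; rewrite in_itv/= => /andP[_ xL].
  by rewrite /I leNgt xL mulr0.
rewrite le_eqVlt; apply/orP; left; apply/eqP; apply: eq_Rintegral => x /set_mem /=.
by rewrite in_itv/= andbT => xL; rewrite /I ltW ?mulr1.
Qed.

End Grid.

Section Mesh.
Context {R : realType}.
Variable L : nat -> nat.
Definition mesh m : R := 2 ^- (2 * m + L m).
Definition nodes m := (L m * 2 ^ (2 * m + L m))%N.
Definition mesh_ratio m := (2 ^ ((2 * m.+1 + L m.+1) - (2 * m + L m)))%N.

Lemma mesh_gt0 m : 0 < mesh m.
Proof. by rewrite invr_gt0 exprn_gt0. Qed.

Lemma nodesE m : (nodes m)%:R * mesh m = (L m)%:R.
Proof. by rewrite /nodes natrM natrX /mesh mulfK// expf_neq0. Qed.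

Lemma mesh_ratio_gt0 m : (0 < mesh_ratio m)%N.
Proof. by rewrite expn_gt0. Qed.

Lemma mesh_length_le m : mesh m * ((L m)%:R + 1) <= 4 ^- m.
Proof.
rewrite /mesh exprD invfM exprM (_ : 2 ^+ 2 = 4); last by ring.
rewrite -mulrA ler_piMr ?invr_ge0 ?exprn_ge0// mulrC ler_pdivrMr ?exprn_gt0// mul1r.
by rewrite natr1 -natrX ler_nat ltn_expl.
Qed.

Lemma mesh_le m : mesh m <= 4 ^- m.
Proof.
apply: le_trans (mesh_length_le m); rewrite ler_peMr ?(ltW (mesh_gt0 m))//.
by rewrite lerDr.
Qed.

Hypothesis Lmono : forall m, (L m <= L m.+1)%N.

Let pmono m : (2 * m + L m <= 2 * m.+1 + L m.+1)%N.
Proof. by rewrite leq_add// leq_mul. Qed.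

Lemma mesh_ratioE m : mesh m = (mesh_ratio m)%:R * mesh m.+1.
Proof.
rewrite /mesh /mesh_ratio natrX; set k := (_ - _)%N.
have -> : (2 * m.+1 + L m.+1 = k + (2 * m + L m))%N by rewrite subnK// pmono.
by rewrite [2 ^+ (k + _)]exprD invfM mulrA mulfV ?mul1r// expf_neq0.
Qed.

Lemma nodes_refine m : (nodes m * mesh_ratio m <= nodes m.+1)%N.
Proof.
rewrite /nodes /mesh_ratio -mulnA -expnD subnKC ?pmono//.
by rewrite leq_mul2r Lmono orbT.
Qed.

Lemma mesh_decr m : mesh m.+1 <= mesh m.
Proof. by rewrite lef_pV2 ?posrE ?exprn_gt0// ler_weXn2l ?ler1n// pmono. Qed.

End Mesh.

Section Levels.
Context {R : realType} {n : nat}.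
Local Notation mu := (@lebesgue_measure R).
Local Notation starfun := ('I_n -> R -> R[i]).
Variable V : 'I_n -> R -> R.
Hypothesis hV : forall j, mu.-integrable halfline (EFin \o V j).
Variable c : R[i].
Hypothesis hc : Re c < 0.
Variables (L : nat -> nat) (K : R).
Hypothesis Lmono : forall m, (L m <= L m.+1)%N.
Hypothesis Ltail : forall m j, \int[mu]_(x in `](L m)%:R, +oo[) `|V j x| <= K * 4 ^- m.
Implicit Types (h : R -> R[i]) (u : starfun) (j : 'I_n).
Local Notation mesh := (@mesh R L).
Local Notation nodes := (nodes L).
Local Notation ratio := (mesh_ratio L).

Lemma sqrt_edge_weightZ j (b : R[i]) h : bounded_measurable h ->
  Num.sqrt (edge_weight V j (fun x => b * h x)) = normc b * Num.sqrt (edge_weight V j h).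
Proof.
move=> bh; rewrite (edge_weightZ hV)// sqrtrM ?sqr_ge0// sqrtr_sqr.
by rewrite ger0_norm ?normc_ge0.
Qed.

Definition vector_pair := {p : starfun * starfun | L2 p.1 /\ L2 p.2}.

Definition mk_pair j h1 h2 (b1 : bounded_measurable h1) (b2 : bounded_measurable h2) : vector_pair :=
  exist _ (left_vector V j h1, right_vector V j h2)
    (conj (L2_left_vector hV j b1) (L2_right_vector hV j b2)).

Definition node m k := hker c (k%:R * mesh m).

Definition grid_part m u : starfun := fun j x =>
  \sum_(i < n) \sum_(k < nodes m)
    (mesh m)%:C * edge_pairing V i (node m k) u * right_vector V i (node m k) j x.

Definition coarse m k : option R :=
  if (k %/ ratio m < nodes m)%N then Some ((k %/ ratio m)%:R * mesh m) else None.

Definition cnode m k := ohker c (coarse m k).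
Definition dnode m k := fun x => node m.+1 k x - cnode m k x.

Lemma bounded_node m k : bounded_measurable (node m k).
Proof. exact: bounded_hker. Qed.
Lemma bounded_cnode m k : bounded_measurable (cnode m k).
Proof. exact: bounded_ohker. Qed.
Lemma bounded_dnode m k : bounded_measurable (dnode m k).
Proof. apply: bounded_measurableB; [exact: bounded_node|exact: bounded_cnode]. Qed.

Lemma coarse_some m k t : coarse m k = Some t ->
  t <= k%:R * mesh m.+1 /\ k%:R * mesh m.+1 <= t + mesh m.
Proof.
rewrite /coarse; case: ifP => // _ [<-].
have d0 := mesh_gt0 (R := R) L m.+1.
rewrite (mesh_ratioE (R := R) Lmono m) !mulrA -mulrDl -!natrM.
rewrite !ler_pM2r// -natrD !ler_nat; split; first exact: leq_trunc_div.
by rewrite {1}(divn_eq k (ratio m)) leq_add2l ltnW// ltn_mod mesh_ratio_gt0.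
Qed.

Lemma coarse_none m k : coarse m k = None -> (L m)%:R <= k%:R * mesh m.+1.
Proof.
rewrite /coarse; case: ifP => // /negbT; rewrite -leqNgt => Nk _.
rewrite -(nodesE (R := R) L m) (mesh_ratioE (R := R) Lmono m) mulrA ler_pM2r ?mesh_gt0//.
by rewrite -natrM ler_nat (leq_trans _ (leq_trunc_div k (ratio m)))// leq_mul2r Nk orbT.
Qed.

Let a := - (2 * Re c).
Let a0 : 0 < a.
Proof. by rewrite oppr_gt0 pmulr_rlt0. Qed.
Let A := 1 + a^-1.
Let A0 : 0 <= A.
Proof. by rewrite addr_ge0 ?invr_ge0 ?ltW. Qed.
Let W := potential_norm V.

Let mesh1 m : mesh m <= 1.
Proof. by rewrite (le_trans (mesh_le (R := R) L m))// invf_le1 ?exprn_gt0// exprn_ege1// ler1n. Qed.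

Lemma dnode_weight_sum m j :
  \sum_(k < nodes m.+1) mesh m.+1 * edge_weight V j (dnode m k) <=
  (A * normc c ^+ 2 * W + 2 * W + A * K) * 4 ^- m.
Proof.
have d0 := mesh_gt0 (R := R) L m; have d'0 := mesh_gt0 (R := R) L m.+1.
have W0 : 0 <= W := potential_norm_ge0 V.
have q0 : 0 <= 4 ^- m :> R by rewrite invr_ge0 exprn_ge0.
pose B1 := A * (normc c * mesh m) ^+ 2 + 2 * mesh m.
have B10 : 0 <= B1.
  by apply: addr_ge0; apply: mulr_ge0 => //; [exact: sqr_ge0|exact: ltW].
apply: (@le_trans _ _ (B1 * W + A * \int[mu]_(x in `](L m)%:R, +oo[) `|V j x|)).
  apply: (edge_weight_sum hV) => //; [by move=> k; exact: bounded_dnode|exact: ltW|].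
  move=> x; apply: le_trans (refinement_sum_bound hc x (nodes m.+1) d'0
    (mesh_decr (R := R) Lmono m) (@coarse_some m) (@coarse_none m)) _.
  set I : R := if _ then 1 else 0.
  have I0 : 0 <= I by rewrite /I; case: ifP.
  have -> : B1 + A * I = A * ((normc c * mesh m) ^+ 2 + I) + 2 * mesh m by rewrite /B1; ring.
  by rewrite lerD2r ler_wpM2r ?addr_ge0 ?sqr_ge0// lerD2r.
have le1 : mesh m ^+ 2 <= 4 ^- m.
  apply: le_trans (mesh_le (R := R) L m); rewrite expr2 ler_piMr// ltW//.
have le2 := mesh_le (R := R) L m.
have h1 : A * \int[mu]_(x in `](L m)%:R, +oo[) `|V j x| <= A * (K * 4 ^- m) by rewrite ler_wpM2l.
have h2 : A * normc c ^+ 2 * W * mesh m ^+ 2 <= A * normc c ^+ 2 * W * 4 ^- m.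
  by apply: ler_wpM2l => //; apply: mulr_ge0 => //; apply: mulr_ge0 => //; exact: sqr_ge0.
have h3 : 2 * W * mesh m <= 2 * W * 4 ^- m by rewrite ler_wpM2l// mulr_ge0.
rewrite /B1 exprMn; nra.
Qed.

Lemma node_weight_sum m j :
  \sum_(k < nodes m.+1) mesh m.+1 * edge_weight V j (node m.+1 k) <= A * W.
Proof.
have d'0 := mesh_gt0 (R := R) L m.+1.
have W0 : 0 <= W := potential_norm_ge0 V.
have -> : A * W = A * W + 0 * \int[mu]_(x in `]0, +oo[) `|V j x| by rewrite mul0r addr0.
apply: (edge_weight_sum hV) => //; [by move=> k; exact: bounded_node|by rewrite ltW|].
move=> x; rewrite mul0r addr0; apply: le_trans (grid_sum_bound hc x _ d'0) _.
by rewrite /A /a lerD2r mesh1.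
Qed.

Lemma refinement_level m : exists l : seq vector_pair,
  \sum_(p <- l) L2norm (sval p).1 * L2norm (sval p).2 <=
    n%:R * (2 * (A * normc c ^+ 2 * W + 2 * W + A * K) + A * W) * 2 ^- m /\
  forall u, L2 u -> forall j x,
    \sum_(p <- l) inner (sval p).1 u * (sval p).2 j x =
    grid_part m.+1 u j x - grid_part m u j x.
Proof.
pose l := flatten [seq flatten [seq
  [:: mk_pair j (bounded_measurableZ (mesh m.+1)%:C (bounded_dnode m k)) (bounded_node m.+1 k);
      mk_pair j (bounded_measurableZ (mesh m.+1)%:C (bounded_cnode m k)) (bounded_dnode m k)]
  | k <- iota 0 (nodes m.+1)] | j <- enum 'I_n].
have d0 := mesh_gt0 (R := R) L m.+1.
have lE (X : nmodType) (F : vector_pair -> X) : \sum_(p <- l) F p =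
    \sum_(j < n) \sum_(k < nodes m.+1)
      (F (mk_pair j (bounded_measurableZ (mesh m.+1)%:C (bounded_dnode m k)) (bounded_node m.+1 k)) +
       F (mk_pair j (bounded_measurableZ (mesh m.+1)%:C (bounded_cnode m k)) (bounded_dnode m k))).
  rewrite /l big_flatten big_map big_enum; apply: eq_bigr => j _.
  rewrite big_flatten big_map -[iota 0 _]/(iota 0 _) -[X in iota 0 X]subn0 -/(index_iota _ _) big_mkord.
  by apply: eq_bigr => k _; rewrite !big_cons big_nil Monoid.mulm1.
exists l; split.
  rewrite lE; set C1 := A * _ * _ + _ + _.
  have -> : n%:R * (2 * C1 + A * W) * 2 ^- m =
      \sum_(j < n) ((2 * C1 + A * W) * 2 ^- m).
    by rewrite sumr_const card_ord -mulrA mulr_natl.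
  apply: ler_sum => j _.
  have w0 h := edge_weight_ge0 V j h.
  have C10 : 0 <= C1 * 4 ^- m.
    apply: le_trans (dnode_weight_sum m j); apply: sumr_ge0 => k _.
    by rewrite mulr_ge0 ?(ltW d0).
  apply: (@le_trans _ _ (\sum_(k < nodes m.+1) ((2 ^+ m + 1) * (mesh m.+1 * edge_weight V j (dnode m k)) +
      2 ^- m * (mesh m.+1 * edge_weight V j (node m.+1 k))))).
    apply: ler_sum => k _ /=; rewrite !L2norm_left_vector !L2norm_right_vector.
    rewrite (sqrt_edge_weightZ _ _ (bounded_dnode m k)) (sqrt_edge_weightZ _ _ (bounded_cnode m k)).
    rewrite normc_real (gtr0_norm d0).
    set x := Num.sqrt (edge_weight V j (dnode m k)); set y := Num.sqrt (edge_weight V j (node m.+1 k)).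
    have x0 : 0 <= x by exact: sqrtr_ge0.
    have xx : edge_weight V j (dnode m k) = x ^+ 2 by rewrite /x sqr_sqrtr.
    have yy : edge_weight V j (node m.+1 k) = y ^+ 2 by rewrite /y sqr_sqrtr.
    have hz : Num.sqrt (edge_weight V j (cnode m k)) <= y + x.
      exact: (sqrt_edge_weightD hV j (bounded_node m.+1 k) (bounded_cnode m k)).
    have am : 2 * (x * y) <= 2 ^+ m * x ^+ 2 + y ^+ 2 / 2 ^+ m.
      by apply: amgm_weighted; rewrite exprn_gt0.
    rewrite xx yy.
    set z := Num.sqrt (edge_weight V j (cnode m k)) in hz *; set q := 2 ^- m; set q' := 2 ^+ m.
    have : x * z <= x * (y + x) by rewrite ler_wpM2l.
    move=> xz; rewrite -subr_ge0.
    have -> : (q' + 1) * (mesh m.+1 * x ^+ 2) + q * (mesh m.+1 * y ^+ 2) -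
      (mesh m.+1 * x * y + mesh m.+1 * z * x) = mesh m.+1 * ((q' + 1) * x ^+ 2 + q * y ^+ 2 - x * y - x * z) by ring.
    rewrite mulr_ge0 ?(ltW d0)//; rewrite [y ^+ 2 / _]mulrC -/q -/q' in am; lra.
  rewrite big_split/= -[X in X + _]mulr_sumr -[X in _ + X]mulr_sumr.
  have q2 : 2 ^- m <= 1 :> R by rewrite invf_le1 ?exprn_gt0// exprn_ege1// ler1n.
  have q20 : 0 < 2 ^- m :> R by rewrite invr_gt0 exprn_gt0.
  have q4 : 4 ^- m = 2 ^- m * 2 ^- m :> R by rewrite -invfM -exprMn; congr (_ ^- _); ring.
  have h1 := dnode_weight_sum m j; have h2 := node_weight_sum m j.
  have e1 : (2 ^+ m + 1) * \sum_(k < nodes m.+1) mesh m.+1 * edge_weight V j (dnode m k) <=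
     (2 ^+ m + 1) * (C1 * 4 ^- m) by rewrite ler_wpM2l// addr_ge0 ?exprn_ge0.
  have e2 : 2 ^- m * \sum_(k < nodes m.+1) mesh m.+1 * edge_weight V j (node m.+1 k) <= 2 ^- m * (A * W).
    by rewrite ler_wpM2l// ltW.
  have e3 : (2 ^+ m + 1) * (C1 * 4 ^- m) <= 2 * C1 * 2 ^- m.
    have -> : (2 ^+ m + 1) * (C1 * 4 ^- m) = (2 ^- m + 2 ^- m * 2 ^- m) * C1.
      by rewrite q4; field; rewrite expf_neq0.
    have C11 : 0 <= C1 by move: C10; rewrite pmulr_lge0 ?invr_gt0 ?exprn_gt0.
    have : 2 ^- m * 2 ^- m <= 2 ^- m :> R by rewrite ler_piMr// ltW.
    nra.
  lra.
move=> u hu j x; rewrite lE /grid_part.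
have coarseE i : \sum_(k < nodes m.+1) (mesh m.+1)%:C * edge_pairing V i (cnode m k) u * right_vector V i (cnode m k) j x =
   \sum_(k < nodes m) (mesh m)%:C * edge_pairing V i (node m k) u * right_vector V i (node m k) j x.
  pose G k := (mesh m.+1)%:C * edge_pairing V i (node m k) u * right_vector V i (node m k) j x.
  rewrite -(big_mkord xpredT (fun k => (mesh m.+1)%:C * edge_pairing V i (cnode m k) u * right_vector V i (cnode m k) j x)).
  rewrite (@big_cat_nat _ _ _ (nodes m * ratio m)%N)//=; last exact: nodes_refine.
  rewrite [X in _ + X]big_nat_cond [X in _ + X]big1 ?addr0; last first.
    move=> k /andP[/andP[kN _] _]; rewrite /cnode /coarse ifF /=; last first.
      by apply/negbTE; rewrite -leqNgt leq_divRL ?mesh_ratio_gt0.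
    rewrite /edge_pairing (@eq_cint _ _ _ (fun=> 0)); last by move=> y _; rewrite mul0r.
    by rewrite cint0 mulr0 mul0r.
  rewrite big_mkord (eq_bigr (fun k : 'I__ => G (k %/ ratio m)%N)); last first.
    move=> k _; rewrite /cnode /coarse ltn_divLR ?mesh_ratio_gt0// ltn_ord//.
  rewrite big_divn ?mesh_ratio_gt0//; apply: eq_bigr => k _.
  rewrite /G -mulr_natl !mulrA; congr (_ * _ * _).
  by rewrite (mesh_ratioE (R := R) Lmono m) rmorphM rmorph_nat.
rewrite -sumrB; apply: eq_bigr => i _; rewrite -coarseE -sumrB; apply: eq_bigr => k _ /=.
rewrite !inner_left_vector !(edge_pairingZ hV)//; try exact: bounded_cnode; try exact: bounded_dnode.
rewrite (edge_pairingB hV)//; [|exact: bounded_node|exact: bounded_cnode].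
have -> : right_vector V i (dnode m k) j x = right_vector V i (node m.+1 k) j x - right_vector V i (cnode m k) j x.
  by rewrite /right_vector; case: eqP => _; rewrite ?subr0// /dnode; ring.
ring.
Qed.

End Levels.

Section HeadApproximation.
Context {R : realType}.
Local Notation mu := (@lebesgue_measure R).
Variable c : R[i].
Hypothesis hc : Re c < 0.
Variable f : R -> R[i].
Hypothesis fi : cintegrable halfline f.
Let k := - Re c.
Let k0 : 0 < k. Proof. by rewrite oppr_gt0. Qed.
Local Notation p := (tail_transform c f).
Let F := \int[mu]_(x in halfline) normc (f x).
Let df : decaying c f := decaying_integrable hc fi.
Let pac := tail_transform_ac df.

Let ip b : 0 <= b -> cintegrable `[0, b] p.
Proof. by move=> b0; exact: (@tail_transform_loc R 1 c (fun _ => f) ord0 b df b0). Qed.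

Let iq b : 0 <= b -> cintegrable `[0, b] (fun t => cE (- c) t * p t).
Proof. by move=> b0; apply: ac_mul_integrable (ac_cE _) b0 (ip b0). Qed.

Let Fn t : 0 <= t -> \int[mu]_(x in `]t, +oo[) normc (f x) <= F.
Proof.
move=> t0; apply: ler_Rintegral_sub => //; first exact: itvoy_sub_halfline.
  exact: cintegrable_normc.
by move=> x _; exact: normc_ge0.
Qed.

Lemma tail_transform_sup t : 0 <= t -> normc (p t) <= F.
Proof. by move=> t0; apply: le_trans (normc_tail_transform_le hc fi t0) (Fn t0). Qed.

Let F0 : 0 <= F.
Proof. by apply: Rintegral_ge0 => x _; exact: normc_ge0. Qed.

Lemma head_piece_bound (P s y x : R) : 0 <= s -> s <= y -> y <= x -> 0 <= P ->
  (forall t, s < t -> t <= y -> normc (p t) <= P) ->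
  normc (cE c x * cint `]s, y] (fun t => cE (- c) t * p t)) <= P / k.
Proof.
move=> s0 sy yx P0 hP; have y0 := le_trans s0 sy.
have sub : `]s, y] `<=` (`[0, y] : set R) by exact: itvoc_sub_cc.
have iE : cintegrable `[0, y] (cE (- c)).
  by apply: eq_cintegrable (ac_mul_integrable (ac_cE (- c)) y0 (cintegrable_one y)) => // t _; rewrite mulr1.
have iE' : cintegrable `]s, y] (cE (- c)) by apply: cintegrableS sub iE.
rewrite Normc.normcM (@eq_cint _ _ _ (fun t => p t * cE (- c) t)); last by move=> t _; rewrite mulrC.
have h : normc (cint `]s, y] (fun t => p t * cE (- c) t)) <=
    P * \int[mu]_(t in `]s, y]) normc (cE (- c) t).
  apply: normc_cintM => //.
    by apply: (cmeasurableS _ _ sub) => //; exact: ac_cmeasurable pac y0.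
  by move=> t /=; rewrite in_itv/= => /andP[]; exact: hP.
have dE (t : R) : is_derive t 1 (fun u => k^-1 * expR (k * u)) (expR (k * t)).
  have := is_deriveZ k^-1 (is_derive1_comp (is_derive_expR (k * t)) (is_derive_scale k t)).
  by rewrite /GRing.scale/= mulrCA mulVf ?mulr1 ?gt_eqF.
have [iexp eexp] := ftc_everywhere y0 dE (continuous_scaled (@continuous_expR R)).
have nE t : normc (cE (- c) t) = expR (k * t) by rewrite normc_cE ReN.
have h2 : \int[mu]_(t in `]s, y]) normc (cE (- c) t) <= k^-1 * expR (k * y).
  apply: (@le_trans _ _ (\int[mu]_(t in `[0, y]) normc (cE (- c) t))).
    apply: ler_Rintegral_sub => //; last by move=> t _; exact: normc_ge0.
    exact: cintegrable_normc.
  under eq_Rintegral do rewrite nE.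
  by rewrite eexp gerBl mulr_ge0 ?expR_ge0// invr_ge0 ltW.
apply: (@le_trans _ _ (normc (cE c x) * (P * (k^-1 * expR (k * y))))).
  by rewrite ler_wpM2l ?normc_ge0// (le_trans h)// ler_wpM2l.
have -> : normc (cE c x) * (P * (k^-1 * expR (k * y))) = P / k * (normc (cE c x) * expR (k * y)) by ring.
rewrite ler_piMr ?divr_ge0 ?(ltW k0)// normc_cE -expRD -expR0 ler_expR.
have -> : Re c * x + k * y = - (k * (x - y)) by rewrite /k; ring.
by rewrite oppr_le0 mulr_ge0 ?(ltW k0)// subr_ge0.
Qed.

Lemma head_transform_sup x : 0 <= x -> normc (head_transform c p x) <= F / k.
Proof.
move=> x0; rewrite /head_transform.
have -> : cint `[0, x] (fun t => cE (- c) t * p t) = cint `]0, x] (fun t => cE (- c) t * p t).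
  rewrite -cint_incr//; last exact: iq.
  by rewrite set_itv1 [X in _ - X](_ : _ = 0) ?subr0// /cint !Rintegral_set1.
apply: head_piece_bound => // t t0 _; apply: tail_transform_sup; exact: ltW.
Qed.

Lemma cell_error (s t x : R) : 0 <= s -> s <= t -> t <= x ->
  normc (cE c x * cint `]s, t] (fun y => cE (- c) y * p y) - (t - s)%:C * (cE c (x - s) * p s)) <=
  (t - s) * (2 * normc c * F * (t - s) + \int[mu]_(y in `]s, t]) normc (f y)).
Proof.
move=> s0 st tx; have t0 := le_trans s0 st.
pose q y := cE c x * (cE (- c) y * p y).
have sub : `]s, t] `<=` (`[0, t] : set R) by exact: itvoc_sub_cc.
have iq' : cintegrable `]s, t] q by apply: cintegrableZ => //; apply: cintegrableS sub (iq t0).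
have ics (z : R[i]) : cintegrable `]s, t] (fun=> z).
  apply: cintegrableS sub _ => //; apply: eq_cintegrable (cintegrableZ z _ (cintegrable_one t)) => // y _.
  by rewrite mulr1.
have iF : mu.-integrable `]s, t] (EFin \o (fun y => normc (f y))).
  apply: cintegrable_normc => //; apply: cintegrableS fi => //; exact: itvoc_sub_halfline.
have cst (z : R[i]) : cint `]s, t] (fun=> z) = (t - s)%:C * z.
  rewrite /cint !Rintegral_cst// [fine _](_ : _ = t - s); last exact: (congr1 fine (measure_itvoc st)).
  by apply: complexP; rewrite ?ReM ?ImM /= ?mul0r ?subr0 ?addr0 mulrC.
rewrite -cintZ//; last by apply: cintegrableS sub (iq t0).
have -> : cE c (x - s) * p s = q s by rewrite /q mulrA cED cENr.
rewrite -cst -cintB//.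
have iB := cintegrableB (measurable_itv _) iq' (ics (q s)).
apply: le_trans (normc_cint _ iB) _ => //; rewrite mulrC -/q.
apply: integral_le_cst => //; first exact: cintegrable_normc.
move=> y sy yt; have y0 : 0 <= y by rewrite (le_trans s0)// ltW.
have qac : ac_deriv q (fun y => cE c x * (p y * (- c * cE (- c) y) + cE (- c) y * (- c * p y - f y))).
  exact: ac_derivZ (ac_derivM (ac_cE (- c)) pac).
rewrite (ac_incr qac s0 (ltW sy)).
have subsy : `]s, y] `<=` (`]s, t] : set R) by exact: itvoc_sub.
have subsy0 : `]s, y] `<=` (`[0, y] : set R) by exact: itvoc_sub_cc.
have iqd : cintegrable `]s, y] (fun y => cE c x * (p y * (- c * cE (- c) y) + cE (- c) y * (- c * p y - f y))).
  by apply: cintegrableS subsy0 (ac_integrable qac y0).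
apply: le_trans (normc_cint _ iqd) _ => //.
have iFy : mu.-integrable `]s, y] (EFin \o (fun y => normc (f y))).
  exact: (@integrableS _ _ _ mu `]s, t]%classic).
have icst : mu.-integrable `]s, y] (EFin \o (fun=> 2 * normc c * F)).
  have := cintegrable_normc (measurable_itv _) (cintegrableS (measurable_itv _) (measurable_itv _) subsy (ics ((2 * normc c * F)%:C))).
  by rewrite normc_real ger0_norm// !mulr_ge0 ?normc_ge0.
apply: (@le_trans _ _ (\int[mu]_(y in `]s, y]) (2 * normc c * F + normc (f y)))).
  apply: le_Rintegral => //; [exact: cintegrable_normc|exact: integrable_add|].
  move=> w /=; rewrite in_itv/= => /andP[sw wy]; have w0 : 0 <= w by rewrite (le_trans s0)// ltW.
  have -> : cE c x * (p w * (- c * cE (- c) w) + cE (- c) w * (- c * p w - f w)) =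
     cE c (x - w) * (- (2 * c * p w) - f w) by rewrite cED cENr; ring.
  rewrite Normc.normcM; apply: (@le_trans _ _ (normc (- (2 * c * p w) - f w))).
    rewrite ler_piMl ?normc_ge0// normc_cE -expR0 ler_expR mulr_le0_ge0 ?(ltW hc)// subr_ge0.
    by rewrite (le_trans wy)// (le_trans yt).
  apply: le_trans (normcB _ _) _; rewrite lerD2r normcN [normc (2 * c * p w)]Normc.normcM [normc (2 * c)]Normc.normcM.
  have -> : normc (2 : R[i]) = 2 by rewrite -[2](rmorph_nat (real_complex R)) normc_real ger0_norm.
  by rewrite ler_wpM2l ?mulr_ge0 ?normc_ge0// tail_transform_sup.
rewrite RintegralD//; apply: lerD.
  rewrite Rintegral_cst// [fine _](_ : _ = y - s); last exact: (congr1 fine (measure_itvoc (ltW sy))).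
  by rewrite ler_wpM2l ?mulr_ge0 ?normc_ge0//= lerD2r.
by apply: ler_Rintegral_sub => // w _; exact: normc_ge0.
Qed.

Lemma head_approx (d x : R) N : 0 < d -> 0 <= x ->
  normc (head_transform c p x - \sum_(j < N) d%:C * (hker c (j%:R * d) x * p (j%:R * d))) <=
  (2 * normc c * (N%:R * d) + 3) * F * d + k^-1 * \int[mu]_(y in `](N%:R * d), +oo[) normc (f y).
Proof.
move=> d0 x0.
pose Q y := cE c x * cint `[0, Num.min y x] (fun t => cE (- c) t * p t).
have Qincr s t : 0 <= s -> s <= t -> Q t - Q s =
    cE c x * cint `](Num.min s x), (Num.min t x)] (fun t => cE (- c) t * p t).
  move=> s0 st; rewrite /Q -mulrBr cint_incr//.
  - by rewrite le_min s0.
  - by rewrite le_min ge_min st/= ge_min lexx orbT.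
  - by apply: iq; rewrite le_min (le_trans s0 st).
have Q0 : Q 0 = 0.
  by rewrite /Q min_l// set_itv1 /cint !Rintegral_set1 mulr0.
have L0 : 0 <= N%:R * d by rewrite mulr_ge0// ltW.
have P0 : 0 <= \int[mu]_(y in `](N%:R * d), +oo[) normc (f y).
  by apply: Rintegral_ge0 => y _; exact: normc_ge0.
have far : normc (head_transform c p x - Q (N%:R * d)) <= k^-1 * \int[mu]_(y in `](N%:R * d), +oo[) normc (f y).
  have -> : head_transform c p x = Q (Num.max (N%:R * d) x).
    by rewrite /Q min_r// le_max lexx orbT.
  rewrite Qincr// ?le_max ?lexx// [leRHS]mulrC.
  apply: head_piece_bound => //.
  - by rewrite le_min L0.
  - by rewrite le_min ge_min le_max lexx/= ge_min lexx orbT.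
  - by rewrite ge_min lexx orbT.
  move=> t tL; rewrite le_min => /andP[_ tx].
  have Lt : N%:R * d < t.
    by move: tL; rewrite gt_min => /orP[//|]; rewrite ltNge tx.
  apply: le_trans (normc_tail_transform_le hc fi (le_trans L0 (ltW Lt))) _.
  apply: ler_Rintegral_sub => //; first exact: itvoy_sub (ltW Lt).
    by apply: cintegrable_normc => //; apply: cintegrableS fi => //; exact: itvoy_sub_halfline.
  by move=> y _; exact: normc_ge0.
pose psi s := 2 * normc c * F * d * s + d * variation f s + 2 * F * d * (if x < s then 1 else 0).
have ifb b : 0 <= b -> cintegrable `[0, b] f.
  by move=> b0; apply: cintegrableS fi => //; exact: itvcc_sub_halfline.
have cell j : normc (Q (j.+1%:R * d) - Q (j%:R * d) - d%:C * (hker c (j%:R * d) x * p (j%:R * d))) <=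
    psi (j.+1%:R * d) - psi (j%:R * d).
  set s := j%:R * d; set t := j.+1%:R * d.
  have ts : t = s + d by rewrite /t /s -natr1 mulrDl mul1r.
  have s0 : 0 <= s by rewrite mulr_ge0// ltW.
  have st : s <= t by rewrite ts lerDl ltW.
  have t0 := le_trans s0 st.
  have e1 : 0 <= 2 * normc c * F * d * d by rewrite !mulr_ge0 ?normc_ge0 ?(ltW d0).
  have e2 := ler_variation s0 st (ifb _ t0).
  have e3 : 0 <= d * (variation f t - variation f s) by rewrite mulr_ge0 ?subr_ge0// ltW.
  have e4 : 0 <= F * d by rewrite mulr_ge0// ltW.
  rewrite Qincr//.
  have -> : psi t - psi s = 2 * normc c * F * d * d + d * (variation f t - variation f s) +
      2 * F * d * ((if x < t then 1 else 0) - (if x < s then 1 else 0)).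
    rewrite /psi; move: (variation f t) (variation f s) (if x < t then 1 else 0 : R) (if x < s then 1 else 0 : R).
    by move=> v1 v2 i1 i2; rewrite ts; ring.
  have [tx|xt] := leP t x.
    rewrite !min_l ?(le_trans st tx)// ltNge (le_trans st tx)/= /hker (le_trans st tx).
    have := cell_error s0 st tx; rewrite -(variation_incr s0 st (ifb _ t0)).
    have -> : t - s = d by rewrite ts addrC addKr.
    move=> h; apply: le_trans h _; rewrite subrr mulr0 addr0; nra.
  have [sx|xs] := leP s x.
    rewrite subr0 mulr1 /hker sx.
    have b1 : normc (cE c x * cint `]s, x] (fun y => cE (- c) y * p y)) <= d * F.
      rewrite -cintZ//; last by apply: cintegrableS (itvoc_sub_cc s0 (lexx x)) (iq x0).
      have ii : cintegrable `]s, x] (fun y => cE c x * (cE (- c) y * p y)).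
        by apply: cintegrableZ => //; apply: cintegrableS (itvoc_sub_cc s0 (lexx x)) (iq x0).
      apply: le_trans (normc_cint _ ii) _ => //.
      apply: (@le_trans _ _ (F * (x - s))).
        apply: integral_le_cst => //; first exact: cintegrable_normc.
        move=> y sy yx; have y0 : 0 <= y by rewrite (le_trans s0)// ltW.
        rewrite mulrA -[cE (- c) y]cENr -cED Normc.normcM.
        apply: (@le_trans _ _ (normc (p y))); last exact: tail_transform_sup.
        rewrite ler_piMl ?normc_ge0// normc_cE -expR0 ler_expR mulr_le0_ge0 ?(ltW hc)//.
        by rewrite subr_ge0.
      by rewrite mulrC ler_wpM2r// lerBlDl -ts ltW.
    have b2 : normc (d%:C * (cE c (x - s) * p s)) <= d * F.
      rewrite Normc.normcM [normc (cE c (x - s) * _)]Normc.normcM normc_real gtr0_norm//.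
      rewrite ler_wpM2l ?(ltW d0)//.
      apply: (@le_trans _ _ (normc (p s))); last exact: tail_transform_sup.
      rewrite ler_piMl ?normc_ge0// normc_cE -expR0 ler_expR mulr_le0_ge0 ?(ltW hc)//.
      by rewrite subr_ge0.
    by apply: le_trans (normcB _ _) _; nra.
  rewrite /hker [s <= x]leNgt xs/= mul0r mulr0 subr0 subrr mulr0 addr0.
  have -> : `]x, x]%classic = set0 :> set R by rewrite set_itv_ge// bnd_simp ltxx.
  rewrite [cint set0 _](_ : _ = 0); last by rewrite /cint !Rintegral_set0.
  by rewrite mulr0 Normc.normc0 addr_ge0.
have near : normc (Q (N%:R * d) - \sum_(j < N) d%:C * (hker c (j%:R * d) x * p (j%:R * d))) <=
    psi (N%:R * d) - psi 0.
  have -> : Q (N%:R * d) = \sum_(j < N) (Q (j.+1%:R * d) - Q (j%:R * d)).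
    rewrite -(big_mkord xpredT (fun j => Q (j.+1%:R * d) - Q (j%:R * d))).
    by rewrite (telescope_sumr (fun j => Q (j%:R * d)))// mul0r Q0 subr0.
  rewrite -sumrB; apply: le_trans (normc_sum _ _ _) _.
  exact: (@sum_le_telescope R psi _ d N cell).
have psiN : psi (N%:R * d) - psi 0 <= (2 * normc c * (N%:R * d) + 3) * F * d.
  rewrite /psi [x < 0]ltNge x0/=.
  have v0 : 0 <= variation f 0 by apply: Rintegral_ge0 => y _; exact: normc_ge0.
  have vF : variation f (N%:R * d) <= F.
    apply: ler_Rintegral_sub => //; first exact: itvcc_sub_halfline.
      exact: cintegrable_normc.
    by move=> y _; exact: normc_ge0.
  have i1 : (if x < N%:R * d then 1 else 0 : R) <= 1 by case: ifP.
  have dF : 0 <= F * d by rewrite mulr_ge0// ltW.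
  have h1 : d * variation f (N%:R * d) <= d * F by rewrite ler_wpM2l// ltW.
  have h2 : 0 <= d * variation f 0 by rewrite mulr_ge0// ltW.
  have h3 : F * d * (if x < N%:R * d then 1 else 0) <= F * d by rewrite ler_piMr.
  move: h1 h2 h3; move: (variation f (N%:R * d)) => v1; move: (variation f 0) => v2.
  by move: (if x < N%:R * d then _ else _) => v3 h1 h2 h3; lra.
rewrite -(subrK (Q (N%:R * d)) (head_transform c p x)) -addrA addrC.
by apply: le_trans (normcD _ _) _; rewrite lerD// (le_trans near).
Qed.

End HeadApproximation.

Section BirmanSchwinger.
Context {R : realType} {n : nat}.
Local Notation mu := (@lebesgue_measure R).
Local Notation starfun := ('I_n -> R -> R[i]).
Variable V : 'I_n -> R -> R.
Hypothesis hV : forall j, mu.-integrable halfline (EFin \o V j).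
Variable c : R[i].
Hypothesis hc : Re c < 0.
Implicit Types (u v : starfun) (j : 'I_n).
Let k := - Re c.
Let k0 : 0 < k. Proof. by rewrite oppr_gt0. Qed.
Let W := potential_norm V.
Let W0 : 0 <= W := potential_norm_ge0 V.

Definition birman u : starfun := mul_sqrt V (green c (mul_sqrt_abs V u)).

Let fi j u (hu : L2 u) : cintegrable halfline (mul_sqrt_abs V u j) :=
  cintegrable_mul_sqrt_abs hV j hu.

Lemma cint_hker (f : R -> R[i]) t : 0 <= t -> cintegrable halfline f ->
  cint halfline (fun x => hker c t x * f x) =
  cE (- c) t * cint `]t, +oo[ (fun x => cE c x * f x).
Proof.
move=> t0 If; have [_ i1] := decaying_integrable hc If.
have ih : cintegrable halfline (fun x => hker c t x * f x).
  have [mh [M hM]] := bounded_hker hc t.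
  by apply: (@cintegrableM _ _ _ _ M).
have i2 : cintegrable `]t, +oo[ (fun x => cE c x * f x).
  by apply: cintegrableS i1 => //; exact: itvoy_sub_halfline.
rewrite -cintZ//.
have -> : cint halfline (fun x => hker c t x * f x) =
    cint `[0, t] (fun x => hker c t x * f x) + cint `]t, +oo[ (fun x => hker c t x * f x).
  by rewrite -cint_tail//; ring.
rewrite [X in X + _](_ : _ = 0) ?add0r.
  apply: eq_cint => x /=; rewrite in_itv/= andbT => tx.
  by rewrite /hker ltW// cED cENr; ring.
have zero (g : R -> R) : mu.-integrable `[0, t] (EFin \o g) ->
    (forall x, x < t -> g x = 0) -> \int[mu]_(x in `[0, t]) g x = 0.
  move=> Ig g0; rewrite -Rintegral_itv_bndo_bndc; last first.
    apply: (@integrableS _ _ _ mu `[0, t]%classic) => //.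
    by move=> x /=; rewrite !in_itv/= => /andP[-> /ltW].
  rewrite (@eq_Rintegral _ _ _ _ _ (fun=> 0)); first by rewrite /Rintegral integral0.
  by move=> x /set_mem /=; rewrite in_itv/= => /andP[_ xt]; rewrite g0.
have [ir ii] : cintegrable `[0, t] (fun x => hker c t x * f x).
  by apply: cintegrableS ih => //; exact: itvcc_sub_halfline.
have h0 x : x < t -> hker c t x * f x = 0 by move=> xt; rewrite /hker leNgt xt mul0r.
apply: complexP => /=; rewrite zero// => x xt; by rewrite h0.
Qed.

Lemma edge_pairing_hker j t u : 0 <= t -> L2 u ->
  edge_pairing V j (hker c t) u = tail_transform c (mul_sqrt_abs V u j) t.
Proof.
move=> t0 hu; rewrite tail_transformE//; last exact: (decaying_integrable hc (fi j hu)).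
by rewrite /edge_pairing cint_hker//; exact: fi.
Qed.

Lemma mul_sqrt_bounded (g : starfun) (e : R) : 0 <= e ->
  (forall j, cmeasurable halfline (g j)) ->
  (forall j x, 0 <= x -> normc (g j x) <= e) ->
  L2 (mul_sqrt V g) /\ L2norm (mul_sqrt V g) <= Num.sqrt W * e.
Proof.
move=> e0 mg hg.
have nE j x : normc (mul_sqrt V g j x) ^+ 2 = `|V j x| * normc (g j x) ^+ 2.
  by rewrite Normc.normcM exprMn normc_sqrt_sg.
have le j x : halfline x -> `|V j x| * normc (g j x) ^+ 2 <= `|V j x| * e ^+ 2.
  move=> /halfline_ge0 x0; rewrite ler_wpM2l// ler_sqr ?nnegrE ?normc_ge0//; exact: hg.
have iV j : mu.-integrable halfline (EFin \o (fun x => e ^+ 2 * `|V j x|)).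
  by apply: integrable_scale => //; exact: integrable_potential.
have iw j : mu.-integrable halfline (EFin \o (fun x => `|V j x| * normc (g j x) ^+ 2)).
  apply: (@integrable_weight _ _ _ hV _ (e ^+ 2)).
    by apply: measurable_funX; exact: measurable_normc.
  move=> x /halfline_ge0 x0; rewrite ger0_norm ?sqr_ge0// ler_sqr ?nnegrE ?normc_ge0//; exact: hg.
have L2g : L2 (mul_sqrt V g).
  move=> j; split; first by apply: cmeasurableM => //; exact: cmeasurable_sqrt_sg.
  by under eq_fun do rewrite nE; exact: iw.
split => //; rewrite L2normE -[e in leRHS]ger0_norm// -sqrtr_sqr -sqrtrM//.
apply: ler_wsqrtr; rewrite /normsq /W /potential_norm mulr_suml; apply: ler_sum => j _.
rewrite mulrC -RintegralZl//; last exact: integrable_potential.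
under eq_Rintegral do rewrite nE.
by apply: le_Rintegral => // x hx; rewrite [leRHS]mulrC; exact: le.
Qed.

Lemma mul_sqrt_abs_norm u j (D : set R) : measurable D -> D `<=` halfline -> L2 u ->
  \int[mu]_(x in D) normc (mul_sqrt_abs V u j x) <=
  Num.sqrt (\int[mu]_(x in D) `|V j x|) * L2norm u.
Proof.
move=> mD sub hu; have [mu1 iu] := hu j.
have mD1 : measurable_fun D (fun x => Num.sqrt `|V j x|).
  apply: measurable_funS sub _ => //; apply: measurable_sqrt.
  by apply: measurableT_comp => //; exact: measurable_potential.
have mD2 : measurable_fun D (fun x => normc (u j x)).
  by apply: measurable_funS sub _ => //; exact: measurable_normc.
have i1 : mu.-integrable D (EFin \o (fun x => Num.sqrt `|V j x| ^+ 2)).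
  rewrite /comp; under eq_fun do rewrite sqr_sqrtr//.
  by apply: (@integrableS _ _ _ mu halfline) => //; exact: integrable_potential.
have i2 : mu.-integrable D (EFin \o (fun x => normc (u j x) ^+ 2)).
  by apply: (@integrableS _ _ _ mu halfline).
have [_ h] := Rcauchy_schwarz mD mD1 mD2 i1 i2.
apply: (@le_trans _ _ (\int[mu]_(x in D) (Num.sqrt `|V j x| * normc (u j x)))).
  rewrite le_eqVlt; apply/orP; left; apply/eqP; apply: eq_Rintegral => x _.
  by rewrite Normc.normcM normc_real ger0_norm ?sqrtr_ge0.
apply: le_trans h _; under eq_Rintegral do rewrite sqr_sqrtr//.
rewrite ler_wpM2l ?sqrtr_ge0// L2normE; apply: ler_wsqrtr.
apply: le_trans (normsq_component u j); apply: ler_Rintegral_sub => // x _.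
exact: sqr_ge0.
Qed.

Lemma mul_sqrt_abs_total u j : L2 u ->
  \int[mu]_(x in halfline) normc (mul_sqrt_abs V u j x) <= Num.sqrt W * L2norm u.
Proof.
move=> hu; apply: le_trans (mul_sqrt_abs_norm j _ _ hu) _ => //.
by rewrite ler_wpM2r ?L2norm_ge0// ler_wsqrtr// potential_norm_component.
Qed.

Lemma green_sup u j x : L2 u -> 0 <= x ->
  normc (green c (mul_sqrt_abs V u) j x) <=
  (Num.sqrt W / k + n%:R * Num.sqrt W / normc (n%:R * c)) * L2norm u.
Proof.
move=> hu x0; apply: le_trans (normcD _ _) _; rewrite mulrDl; apply: lerD.
  apply: le_trans (head_transform_sup hc (fi j hu) x0) _.
  by rewrite mulrAC ler_wpM2r ?invr_ge0 ?(ltW k0)// mul_sqrt_abs_total.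
rewrite Normc.normcM; apply: (@le_trans _ _ (normc (green_coef c (mul_sqrt_abs V u)))).
  by rewrite ler_piMr ?normc_ge0// normc_cE -expR0 ler_expR mulr_le0_ge0// ltW.
rewrite /green_coef mulNr normcN Normc.normcM Normc.normcV mulrAC ler_wpM2r ?invr_ge0 ?normc_ge0//.
apply: le_trans (normc_sum _ _ _) _.
apply: (@le_trans _ _ (\sum_(i < n) Num.sqrt W * L2norm u)).
  apply: ler_sum => i _; apply: le_trans (tail_transform_sup hc (fi i hu) (lexx 0)) _.
  exact: mul_sqrt_abs_total.
by rewrite sumr_const card_ord -mulrA mulr_natl.
Qed.

Lemma green_measurable u j : L2 u -> cmeasurable halfline (green c (mul_sqrt_abs V u) j).
Proof.
move=> hu; have df := decaying_integrable hc (fi j hu).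
exact: ac_cmeasurable_halfline (green_ac df).
Qed.

Lemma birman_bound : exists2 M : R, 0 <= M & forall u, L2 u ->
  L2 (birman u) /\ L2norm (birman u) <= M * L2norm u.
Proof.
set C := Num.sqrt W / k + n%:R * Num.sqrt W / normc (n%:R * c).
have C0 : 0 <= C.
  by rewrite addr_ge0// divr_ge0 ?mulr_ge0 ?sqrtr_ge0 ?normc_ge0// ltW.
exists (Num.sqrt W * C) => [|u hu]; first by rewrite mulr_ge0 ?sqrtr_ge0.
rewrite -mulrA; apply: mul_sqrt_bounded.
- by rewrite mulr_ge0 ?L2norm_ge0.
- by move=> j; exact: green_measurable.
- by move=> j x x0; exact: green_sup.
Qed.

Lemma tail_transform_linear (a : R[i]) f g t : decaying c f -> decaying c g -> 0 <= t ->
  tail_transform c (fun x => a * f x + g x) t = a * tail_transform c f t + tail_transform c g t.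
Proof.
move=> [_ If] [_ Ig] t0; rewrite /tail_transform.
have sub : `[0, t] `<=` (halfline : set R) by exact: itvcc_sub_halfline.
have E (D : set R) : measurable D -> D `<=` halfline -> cint D (fun x => cE c x * (a * f x + g x)) =
    a * cint D (fun x => cE c x * f x) + cint D (fun x => cE c x * g x).
  move=> mD sD; have If' := cintegrableS measurable_halfline mD sD If.
  have Ig' := cintegrableS measurable_halfline mD sD Ig.
  rewrite -cintZ// -cintD//; last exact: cintegrableZ.
  by apply: eq_cint => x _; ring.
by rewrite !E//; ring.
Qed.

Lemma head_transform_linear (a : R[i]) p q r x : 0 <= x ->
  (forall b, 0 <= b -> cintegrable `[0, b] p) -> (forall b, 0 <= b -> cintegrable `[0, b] q) ->
  (forall t, 0 <= t -> r t = a * p t + q t) ->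
  head_transform c r x = a * head_transform c p x + head_transform c q x.
Proof.
move=> x0 ip iq hr; rewrite /head_transform.
have ip' := ac_mul_integrable (ac_cE (- c)) x0 (ip x x0).
have iq' := ac_mul_integrable (ac_cE (- c)) x0 (iq x x0).
rewrite (@eq_cint _ _ _ (fun t => a * (cE (- c) t * p t) + cE (- c) t * q t)); last first.
  by move=> t /=; rewrite in_itv/= => /andP[t0 _]; rewrite hr//; ring.
by rewrite cintD ?cintZ//; [ring|exact: cintegrableZ].
Qed.

Lemma birman_linear (a : R[i]) u v j x : L2 u -> L2 v -> 0 <= x ->
  birman (fun j x => a * u j x + v j x) j x = a * birman u j x + birman v j x.
Proof.
move=> hu hv x0; pose f := mul_sqrt_abs V u; pose g := mul_sqrt_abs V v.
have dfu i := decaying_integrable hc (fi i hu).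
have dfv i := decaying_integrable hc (fi i hv).
have E : mul_sqrt_abs V (fun j x => a * u j x + v j x) = fun j x => a * f j x + g j x.
  by apply/funext => i; apply/funext => y; rewrite /f /g /mul_sqrt_abs; ring.
rewrite /birman /mul_sqrt E /green (@head_transform_linear a (tail_transform c (f j)) (tail_transform c (g j)))//.
- rewrite /green_coef (eq_bigr (fun i => a * tail_transform c (f i) 0 + tail_transform c (g i) 0)).
    rewrite big_split/= -mulr_sumr -/f -/g.
    move: (head_transform _ _ _) (head_transform _ _ _) (\sum_k _) (\sum_k _) => h1 h2 s1 s2.
    by move: (_%:C) (cE c x) ((n%:R * c)^-1) => w e d; ring.
  by move=> i _; rewrite tail_transform_linear.
- by move=> b b0; exact: (tail_transform_loc (dfu j) b0).
- by move=> b b0; exact: (tail_transform_loc (dfv j) b0).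
- by move=> t t0; rewrite tail_transform_linear.
Qed.

Lemma birman_bounded_operator : bounded_operator birman.
Proof.
have [M M0 hM] := birman_bound.
split; [by move=> u /hM[]| |by exists M => u /hM[]].
move=> a u v hu hv j; apply: (@aeW _ (measurableTypeR R) _ mu) => x /halfline_ge0 x0.
exact: birman_linear.
Qed.

End BirmanSchwinger.

Section TraceClass.
Context {R : realType} {n : nat}.
Local Notation mu := (@lebesgue_measure R).
Local Notation starfun := ('I_n -> R -> R[i]).
Variable V : 'I_n -> R -> R.
Hypothesis hV : forall j, mu.-integrable halfline (EFin \o V j).
Variable c : R[i].
Hypothesis hc : Re c < 0.
Implicit Types (u v : starfun) (j : 'I_n).
Let k := - Re c.
Let k0 : 0 < k. Proof. by rewrite oppr_gt0. Qed.
Let W := potential_norm V.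
Let W0 : 0 <= W := potential_norm_ge0 V.

Lemma exists_grid : exists (L : nat -> nat) (K : R),
  [/\ 0 <= K, L 0%N = 0%N, forall m, (L m <= L m.+1)%N, forall m, (m <= L m)%N &
      forall m j, \int[mu]_(x in `](L m)%:R, +oo[) `|V j x| <= K * 4 ^- m].
Proof.
have iV j := integrable_potential hV j.
have [iS eS] := Rintegral_sum (index_enum 'I_n) measurable_halfline iV.
have hB m : exists B : R, forall b, B <= b -> 0 <= b -> forall j,
    \int[mu]_(x in `]b, +oo[) `|V j x| <= 4 ^- m.
  have e0 : 0 < 4 ^- m :> R by rewrite invr_gt0 exprn_gt0.
  have S0 (x : R) : halfline x -> 0 <= \sum_(j < n) `|V j x| by move=> _; apply: sumr_ge0.
  have [B B0 hB] := tail_small iS S0 e0; exists B => b Bb b0 j; apply: le_trans (hB b Bb).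
  apply: le_Rintegral => //.
  - by apply: (@integrableS _ _ _ mu halfline) => //; exact: itvoy_sub_halfline.
  - by apply: (@integrableS _ _ _ mu halfline) => //; exact: itvoy_sub_halfline.
  - by move=> x _; rewrite (bigD1 j)//= lerDl sumr_ge0.
have /choice [B {}hB] := hB.
pose L m := (\sum_(i < m) (Num.trunc (B i.+1)).+1)%N.
exists L, (1 + W); split.
- by rewrite addr_ge0.
- by rewrite /L big_ord0.
- by move=> m; rewrite /L big_ord_recr/= leq_addr.
- elim=> [//|m ih]; rewrite /L big_ord_recr/= -/(L m) addnS ltnS.
  exact: leq_trans ih (leq_addr _ _).
move=> [|m] j.
  rewrite expr0 invr1 mulr1; apply: (@le_trans _ _ W); last by rewrite lerDr.
  apply: le_trans (potential_norm_component V j); apply: ler_Rintegral_sub => //.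
  exact: itvoy_sub_halfline.
apply: (@le_trans _ _ (4 ^- m.+1)).
  apply: hB => //; apply: (@le_trans _ _ ((Num.trunc (B m.+1)).+1)%:R).
    exact: ltW (truncnS_gt _).
  by rewrite ler_nat /L big_ord_recr/= leq_addl.
by rewrite ler_peMl ?lerDl// invr_ge0 exprn_ge0.
Qed.

Variables (L : nat -> nat) (K : R).
Hypothesis K0 : 0 <= K.
Hypothesis L0 : L 0%N = 0%N.
Hypothesis Lmono : forall m, (L m <= L m.+1)%N.
Hypothesis Ltail : forall m j, \int[mu]_(x in `](L m)%:R, +oo[) `|V j x| <= K * 4 ^- m.

Definition star_left : starfun := fun j x => (Num.sqrt `|V j x|)%:C * conjc (hker c 0 x).
Definition star_right : starfun := fun j x =>
  (Num.sg (V j x) * Num.sqrt `|V j x|)%:C * hker c 0 x.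
Definition star_weight : R[i] := - (n%:R * c)^-1.

Lemma L2_star_left : L2 star_left.
Proof.
move=> j; apply: (square_integrable_weight hV); [exact: cmeasurable_sqrt_abs|exact: normc_sqrt_abs|].
by apply: bounded_measurable_conj; exact: bounded_hker.
Qed.

Lemma L2_star_right : L2 star_right.
Proof.
by move=> j; apply: (square_integrable_weight hV);
  [exact: cmeasurable_sqrt_sg|exact: normc_sqrt_sg|exact: bounded_hker].
Qed.

Lemma inner_star_left u : inner star_left u = \sum_j edge_pairing V j (hker c 0) u.
Proof.
apply: eq_bigr => j _; rewrite -inner_left_vector /inner (bigD1 j)//= [X in _ + X]big1 ?addr0.
  by apply: eq_cint => x _; rewrite /left_vector eqxx.
move=> i /negbTE ij; rewrite -[RHS](cint0 halfline); apply: eq_cint => x _.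
by rewrite /left_vector ij conjc0 mul0r.
Qed.

Definition finite_birman m u : starfun := fun j x =>
  star_weight * inner star_left u * star_right j x + grid_part V c L m u j x.

Lemma birman_approx : exists2 C : R, 0 <= C & forall m u, L2 u ->
  L2norm (fun j x => birman V c u j x - finite_birman m u j x) <= C * 2 ^- m * L2norm u.
Proof.
set C := (2 * normc c + 3) * Num.sqrt W + k^-1 * Num.sqrt K.
have C0 : 0 <= C.
  by rewrite addr_ge0// mulr_ge0 ?sqrtr_ge0 ?addr_ge0 ?mulr_ge0 ?normc_ge0// invr_ge0 ltW.
exists (Num.sqrt W * C) => [|m u hu]; first by rewrite mulr_ge0 ?sqrtr_ge0.
pose d := @mesh R L m.
have d0 : 0 < d by exact: mesh_gt0.
pose f := mul_sqrt_abs V u.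
have fi j : cintegrable halfline (f j) := cintegrable_mul_sqrt_abs hV j hu.
have df j := decaying_integrable hc (fi j).
pose g : starfun := fun j x => head_transform c (tail_transform c (f j)) x -
  \sum_(i < nodes L m) d%:C * (hker c (i%:R * d) x * tail_transform c (f j) (i%:R * d)).
have nd0 i : 0 <= i%:R * d by rewrite mulr_ge0// ltW.
have -> : L2norm (fun j x => birman V c u j x - finite_birman m u j x) = L2norm (mul_sqrt V g).
  rewrite !L2normE; congr Num.sqrt; apply: eq_bigr => j _; apply: eq_Rintegral => x /set_mem /halfline_ge0 x0.
  congr (normc _ ^+ 2); rewrite /birman /finite_birman /mul_sqrt /star_right inner_star_left -/f.
  have -> : grid_part V c L m u j x = \sum_(l < nodes L m)
      d%:C * edge_pairing V j (node c L m l) u * right_vector V j (node c L m l) j x.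
    rewrite /grid_part (bigD1 j)//= [X in _ + X]big1 ?addr0// => i /negbTE ij.
    by rewrite big1// => l _; rewrite /right_vector eq_sym ij mulr0.
  have -> : hker c 0 x = cE c x by rewrite /hker x0 subr0.
  rewrite (eq_bigr (fun i => tail_transform c (f i) 0)); last by move=> i _; rewrite edge_pairing_hker.
  set w := (_ * _)%:C.
  rewrite [X in _ - (_ + X)](eq_bigr (fun i : 'I__ => w * (d%:C * (hker c (i%:R * d) x * tail_transform c (f j) (i%:R * d))))); last first.
    by move=> i _; rewrite edge_pairing_hker// /right_vector eqxx -/w /node -/d; ring.
  rewrite -[X in _ - (_ + X)]mulr_sumr /g /green /green_coef /star_weight; move: (head_transform _ _ _) (\sum_(i < nodes L m) _) (\sum_i _) => h s1 s2.
  by move: (cE c x) ((n%:R * c)^-1) => e q; ring.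
pose e := C * 2 ^- m * L2norm u.
have e0 : 0 <= e by rewrite mulr_ge0 ?L2norm_ge0// mulr_ge0// invr_ge0 exprn_ge0.
have -> : Num.sqrt W * C * 2 ^- m * L2norm u = Num.sqrt W * e by rewrite /e; ring.
apply: (proj2 (mul_sqrt_bounded hV e0 _ _)) => [j|j x x0].
  apply: cmeasurableB => //.
    have ip b : 0 <= b -> cintegrable `[0, b] (tail_transform c (f j)).
      by move=> b0; exact: (tail_transform_loc (df j) b0).
    exact: ac_cmeasurable_halfline (head_transform_ac c ip).
  apply: cmeasurable_sum => // i; apply: cmeasurableM => //.
  apply: cmeasurableM => //.
  by case: (bounded_hker hc (i%:R * d)).
apply: le_trans (head_approx hc (fi j) (nodes L m) d0 x0) _; rewrite -/k.
have hF := mul_sqrt_abs_total hV j hu; rewrite -/f -/W in hF.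
have hT : \int[mu]_(y in `]((nodes L m)%:R * d), +oo[) normc (f j y) <= Num.sqrt K * 2 ^- m * L2norm u.
  rewrite nodesE; apply: le_trans (mul_sqrt_abs_norm hV j _ _ hu) _ => //.
    exact: itvoy_sub_halfline.
  rewrite ler_wpM2r ?L2norm_ge0//.
  have -> : Num.sqrt K * 2 ^- m = Num.sqrt (K * 4 ^- m).
    rewrite sqrtrM// (_ : 4 ^- m = (2 ^- m) ^+ 2 :> R); last first.
      by rewrite expr2 -invfM -exprMn; congr (_ ^- _); ring.
    by rewrite sqrtr_sqr ger0_norm// invr_ge0 exprn_ge0.
  exact: ler_wsqrtr.
have hF0 : 0 <= \int[mu]_(x in halfline) normc (f j x) by apply: Rintegral_ge0 => y _; exact: normc_ge0.
move: hF0 hF; set F := \int[mu]_(x in halfline) _ => hF0 hF.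
have hd : (2 * normc c * ((nodes L m)%:R * d) + 3) * d <= (2 * normc c + 3) * 2 ^- m.
  rewrite nodesE; have h4 := mesh_length_le (R := R) L m; rewrite -/d in h4.
  have h42 : 4 ^- m <= 2 ^- m :> R by rewrite lef_pV2 ?posrE ?exprn_gt0// lerXn2r ?nnegrE// ler_nat.
  apply: (@le_trans _ _ ((2 * normc c + 3) * (d * ((L m)%:R + 1)))).
    have n0 := normc_ge0 c; have L00 : 0 <= (L m)%:R :> R by [].
    rewrite -subr_ge0; have -> : (2 * normc c + 3) * (d * ((L m)%:R + 1)) - (2 * normc c * (L m)%:R + 3) * d =
       d * (2 * normc c + 3 * (L m)%:R) by ring.
    by rewrite mulr_ge0 ?(ltW d0)// addr_ge0 ?mulr_ge0.
  rewrite ler_wpM2l ?addr_ge0 ?mulr_ge0 ?normc_ge0//.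
  exact: le_trans h4 h42.
have -> : e = ((2 * normc c + 3) * 2 ^- m) * (Num.sqrt W * L2norm u) +
    k^-1 * (Num.sqrt K * 2 ^- m * L2norm u) by rewrite /e /C; ring.
apply: lerD; last by rewrite ler_wpM2l// invr_ge0 ltW.
rewrite mulrAC; apply: ler_pM => //.
by rewrite mulr_ge0 ?(ltW d0)// addr_ge0// !mulr_ge0 ?normc_ge0// ltW.
Qed.

Lemma birman_trace_sequence : exists (f g : nat -> starfun) (len : nat -> nat),
  [/\ forall i, L2 (f i) /\ L2 (g i),
      cvgn (series (fun i => L2norm (f i) * L2norm (g i))),
      forall m, (m <= len m)%N &
      forall m u, L2 u -> (fun j x => \sum_(i < len m) inner (f i) u * g i j x) = finite_birman m u].
Proof.
pose T := @vector_pair R n.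
pose t0 : T := exist _ ((fun _ _ => 0), (fun _ _ => 0)) (conj L20 L20).
pose ps : T := exist _ (sscale (conjc star_weight) star_left, star_right) (conj (L2Z _ L2_star_left) L2_star_right).
have /choice [l hl] := fun m => refinement_level hV hc Lmono Ltail m.
pose l' m := if m is m'.+1 then l m' else [:: ps].
have [s [len [lenm hs]]] := concat_sequence t0 l'.
have a0 : L2norm (sval t0).1 * L2norm (sval t0).2 = 0.
  by rewrite [X in X * _]L2normE normsq0 sqrtr0 mul0r.
exists (fun i => (sval (s i)).1), (fun i => (sval (s i)).2), (fun m => len m.+1).
split.
- by move=> i; case: (s i).
- have sE : forall m, \sum_(i < len m) L2norm (sval (s i)).1 * L2norm (sval (s i)).2 =
     \sum_(i < m) \sum_(p <- l' i) L2norm (sval p).1 * L2norm (sval p).2.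
    move=> m; rewrite (hs _ (fun p => L2norm (sval p).1 * L2norm (sval p).2) m).
    by apply: eq_bigr => i _; rewrite a0 add0r.
  set C := n%:R * (2 * ((1 + (- (2 * Re c))^-1) * normc c ^+ 2 * potential_norm V + 2 * potential_norm V +
      (1 + (- (2 * Re c))^-1) * K) + (1 + (- (2 * Re c))^-1) * potential_norm V).
  apply: nondecreasing_is_cvgn.
    by apply: nondecreasing_series => i _ _; rewrite mulr_ge0 ?L2norm_ge0.
  exists (L2norm (sval ps).1 * L2norm (sval ps).2 + C * 2) => _ [m _ <-].
  apply: (@le_trans _ _ (\sum_(i < len m.+1) L2norm (sval (s i)).1 * L2norm (sval (s i)).2)).
    rewrite seriesEnat/= -(big_mkord xpredT (fun i => L2norm (sval (s i)).1 * L2norm (sval (s i)).2)).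
    rewrite [leRHS](@big_cat_nat _ _ _ m)//=; last exact: leq_trans (leqnSn m) (lenm _).
    by rewrite lerDl; apply: sumr_ge0 => i _; rewrite mulr_ge0 ?L2norm_ge0.
  rewrite sE big_ord_recl/= big_seq1 lerD2l.
  apply: (@le_trans _ _ (\sum_(i < m) C * 2 ^- i)).
    by apply: ler_sum => i _; case: (hl i).
  rewrite -mulr_sumr; apply: ler_wpM2l; last exact: geometric_sum_le2.
  have q0 : 0 <= (- (2 * Re c))^-1 by rewrite invr_ge0 oppr_ge0 pmulr_rle0// ltW.
  have q1 : 0 <= 1 + (- (2 * Re c))^-1 by rewrite addr_ge0.
  apply: mulr_ge0 => //; apply: addr_ge0; last exact: mulr_ge0.
  apply: mulr_ge0 => //; apply: addr_ge0; last exact: mulr_ge0.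
  apply: addr_ge0; last exact: mulr_ge0.
  by apply: mulr_ge0 => //; apply: mulr_ge0 => //; exact: sqr_ge0.
- by move=> m; exact: leq_trans (leqnSn m) (lenm _).
move=> m u hu; apply/funext => j; apply/funext => x.
rewrite (hs _ (fun p => inner (sval p).1 u * (sval p).2 j x) m.+1).
rewrite (eq_bigr (fun i : 'I__ => \sum_(p <- l' i) inner (sval p).1 u * (sval p).2 j x)); last first.
  by move=> i _; rewrite /= mulr0 add0r.
rewrite big_ord_recl/= big_seq1 /= innerZl//; last exact: L2_star_left.
rewrite conjcK /finite_birman; congr (_ + _).
rewrite (eq_bigr (fun i : 'I__ => grid_part V c L i.+1 u j x - grid_part V c L i u j x)); last first.
  by move=> i _; case: (hl i) => _ /(_ u hu j x).
rewrite -(big_mkord xpredT (fun i => grid_part V c L i.+1 u j x - grid_part V c L i u j x)).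
rewrite (telescope_sumr (fun i => grid_part V c L i u j x))// [X in _ - X](_ : _ = 0) ?subr0//.
rewrite /grid_part big1// => i _; rewrite /nodes L0 mul0n big_ord0//.
Qed.

Theorem birman_fredholm (Kf : nat -> nat) (F G : forall m, 'I_(Kf m) -> starfun) (d : R[i]) :
  (forall m nu, L2 (F m nu) /\ L2 (G m nu)) ->
  (forall m u, L2 u -> finite_birman m u = rank1_sum (F m) (G m) u) ->
  gram_det (F m) (G m) @[m --> \oo] --> d ->
  fredholm_det (birman V c) d.
Proof.
move=> FG FGE dcvg; have [f [g [len [fg cfg lenm hlen]]]] := birman_trace_sequence.
have [M M0 hM] := birman_bound hV hc.
have [C C0 hC] := birman_approx.
have SE m u : L2 u -> (fun j x => \sum_(i < len m) inner (f i) u * g i j x) = rank1_sum (F m) (G m) u.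
  by move=> hu; rewrite hlen// FGE.
apply: (fredholm_det_approx _ fg cfg _ lenm FG SE dcvg); first by move=> u /hM[].
move=> u hu; pose S := series (fun i => L2norm (f i) * L2norm (g i)).
have Tu : L2 (birman V c u) by case: (hM _ hu).
have L2S N : L2 (fun j x => \sum_(i < N) inner (f i) u * g i j x).
  by apply: (@L2_ssum _ _ _ _ (fun i : 'I_N => sscale _ (g i))) => i; apply: L2Z; case: (fg i).
have Snd : {homo S : n m / (n <= m)%N >-> n <= m}.
  by apply: nondecreasing_series => i _ _; rewrite mulr_ge0 ?L2norm_ge0.
have step N m : (len m <= N)%N ->
    L2norm (fun j x => birman V c u j x - \sum_(i < N) inner (f i) u * g i j x) <=
    C * 2 ^- m * L2norm u + L2norm u * (limn S - S m).
  move=> mN.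
  apply: le_trans (L2norm_triangle Tu (L2S (len m)) (L2S N)) _.
  apply: lerD; first by rewrite (hlen m u hu); exact: hC.
  rewrite L2norm_distC.
  apply: (@le_trans _ _ (L2norm u * (S N - S (len m)))); last first.
    rewrite ler_wpM2l ?L2norm_ge0// lerB//; last exact: Snd.
    exact: nondecreasing_cvgn_le.
  have -> : ssub (fun j x => \sum_(i < N) inner (f i) u * g i j x)
      (fun j x => \sum_(i < len m) inner (f i) u * g i j x) =
      ssum (index_iota (len m) N) (fun i => sscale (inner (f i) u) (g i)).
    apply/funext => j; apply/funext => x; rewrite /ssub /ssum.
    rewrite -!(big_mkord xpredT (fun i => inner (f i) u * g i j x)).
    by apply/eqP; rewrite subr_eq addrC (@big_cat_nat _ _ _ (len m) 0 N).
  apply: le_trans (L2norm_ssum _ _) _; first by move=> i; apply: L2Z; case: (fg i).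
  have -> : S N - S (len m) = \sum_(len m <= i < N) L2norm (f i) * L2norm (g i).
    by apply/eqP; rewrite /S !seriesEnat/= subr_eq addrC (@big_cat_nat _ _ _ (len m) 0 N).
  rewrite mulr_sumr; apply: ler_sum => i _; have [hf hg] := fg i.
  rewrite L2normZ// mulrA ler_wpM2r ?L2norm_ge0// mulrC; exact: cauchy_schwarz.
have Scvg : S m @[m --> \oo] --> limn S by exact: cfg.
have lim0 : C * 2 ^- m * L2norm u + L2norm u * (limn S - S m) @[m --> \oo] --> (0 : R).
  rewrite -[X in _ --> X]addr0; apply: cvgD.
    rewrite -(mul0r (L2norm u)) -(mulr0 C); apply: cvgM; last exact: cvg_cst.
    apply: cvgM; first exact: cvg_cst.
    under eq_fun do rewrite -exprVn; apply: cvg_expr.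
    by rewrite ger0_norm ?invr_ge0// invf_lt1// ltr1n.
  rewrite -(mulr0 (L2norm u)); apply: cvgM; first exact: cvg_cst.
  rewrite -(subrr (limn S)); apply: cvgB; [exact: cvg_cst|exact: Scvg].
apply/cvgrPdist_le => e e0.
have /cvgrPdist_le /(_ e e0) [m0 _ hm0] := lim0.
exists (len m0) => // N /= mN; rewrite sub0r normrN ger0_norm ?L2norm_ge0//.
apply: le_trans (step _ _ mN) _; have := hm0 m0 (leqnn _).
by rewrite sub0r normrN; apply: le_trans; exact: ler_norm.
Qed.

End TraceClass.

(** * Semiseparable determinants *)

Section SemiseparableDeterminant.
Variable F : fieldType.

Definition border k (M : 'M[F]_k) (r : 'rV[F]_k) (c : 'cV[F]_k) : F := (r *m \adj M *m c) 0 0.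

Lemma border_det k (M : 'M[F]_k) r c : border M r c = \det (M + c *m r) - \det M.
Proof. by rewrite det_rank1_update addrC addKr. Qed.

Lemma borderDl k (M : 'M[F]_k) r1 r2 c : border M (r1 + r2) c = border M r1 c + border M r2 c.
Proof. by rewrite /border !mulmxDl mxE. Qed.

Lemma borderDr k (M : 'M[F]_k) r c1 c2 : border M r (c1 + c2) = border M r c1 + border M r c2.
Proof. by rewrite /border !mulmxDr mxE. Qed.

Lemma borderZ k (M : 'M[F]_k) a b r c : border M (a *: r) (b *: c) = a * b * border M r c.
Proof. by rewrite /border -!scalemxAl -scalemxAr !mxE mulrA. Qed.

Lemma border_block k l (M1 : 'M[F]_k) (M2 : 'M[F]_l) r1 r2 c1 c2 :
  border (block_mx M1 0 0 M2) (row_mx r1 r2) (col_mx c1 c2) =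
  border M1 r1 c1 * \det M2 + \det M1 * border M2 r2 c2.
Proof.
have -> : row_mx r1 r2 = row_mx r1 0 + row_mx 0 r2 by rewrite add_row_mx addr0 add0r.
have -> : col_mx c1 c2 = col_mx c1 0 + col_mx 0 c2 by rewrite add_col_mx addr0 add0r.
rewrite !(borderDl, borderDr) !border_det !mul_col_row !add_block_mx.
rewrite !(mul0mx, mulmx0, addr0, add0r) !(det_lblock, det_ublock); ring.
Qed.

Variables (d : F) (q : nat -> F).

Definition edge_matrix (W : nat -> F) a k : 'M[F]_k :=
  \matrix_(i, j) ((i == j)%:R + d * (q (a + i)%N * q (a + j)%N * W (a + maxn i j)%N)).

Definition edge_row (W : nat -> F) a k : 'rV[F]_k := \row_j (q (a + j)%N * W (a + j)%N).

Definition edge_det W a k := \det (edge_matrix W a k).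

Definition edge_border (W : nat -> F) w a k : F :=
  w * edge_det W a k - d * border (edge_matrix W a k) (edge_row W a k) (edge_row W a k)^T.

Lemma edge_matrixS W a k : edge_matrix W a k.+1 =
  block_mx (1 + d * q a ^+ 2 * W a)%:M ((d * q a) *: edge_row W a.+1 k)
    ((d * q a) *: (edge_row W a.+1 k)^T) (edge_matrix W a.+1 k) :> 'M[F]_(1 + k).
Proof.
apply/matrixP => i j; rewrite !mxE; case: splitP => i' ei; rewrite mxE; case: splitP => j' ej; rewrite !mxE.
- have -> : i = j by apply/val_inj => /=; rewrite ei ej !ord1.
  have -> : i' = j' by rewrite !ord1.
  by rewrite eqxx [j' == j']eqxx maxnn ej !ord1 /= !addn0; ring.
- have -> : (i == j) = false by apply/negbTE; rewrite -val_eqE /= ei ej !ord1.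
  by rewrite ei ej !ord1 max0n addn0 add1n addnS /= ; ring.
- have -> : (i == j) = false by apply/negbTE; rewrite -val_eqE /= ei ej !ord1.
  by rewrite ei ej !ord1 maxn0 addn0 add1n addnS /= ; ring.
- have -> : (i == j) = (i' == j') by rewrite -!val_eqE /= ei ej.
  by rewrite ei ej !add1n maxnSS !addnS.
Qed.

Lemma edge_rowS W a k : edge_row W a k.+1 = row_mx (q a * W a)%:M (edge_row W a.+1 k) :> 'rV[F]_(1 + k).
Proof.
apply/rowP => j; rewrite !mxE; case: splitP => j' ej; rewrite !mxE ej.
  by rewrite !ord1 addn0.
by rewrite add1n addnS.
Qed.

Lemma edge_detS W a k :
  edge_det W a k.+1 = edge_det W a.+1 k + d * q a ^+ 2 * edge_border W (W a) a.+1 k.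
Proof.
rewrite {1}/edge_det edge_matrixS det_bordered -/(border _ _ _) borderZ /edge_border /edge_det; ring.
Qed.

Lemma edge_borderE W w a k : edge_border W w a k =
  \det (block_mx w%:M (d *: edge_row W a k) (edge_row W a k)^T (edge_matrix W a k)).
Proof.
by rewrite det_bordered -/(border _ _ _) -[(edge_row W a k)^T in RHS]scale1r borderZ mulr1.
Qed.

Lemma border_shift k (w p : F) (v : 'rV[F]_k) (M : 'M[F]_k) :
  \det (block_mx w%:M (d *: row_mx (p * w)%:M v) (row_mx (p * w)%:M v)^T
    (block_mx (1 + d * p ^+ 2 * w)%:M ((d * p) *: v) ((d * p) *: v^T) M)) =
  w * \det M - d * border M v v^T.
Proof.
set B := block_mx w%:M _ _ _.
pose e : 'rV[F]_(1 + k) := row_mx 1%:M 0.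
pose L : 'M[F]_(1 + (1 + k)) := block_mx 1%:M 0 (- (p *: e^T)) 1%:M.
pose U : 'M[F]_(1 + (1 + k)) := block_mx 1%:M (- ((d * p) *: e)) 0 1%:M.
have -> : \det B = \det (L *m B *m U).
  by rewrite !det_mulmx det_lblock det_ublock !det1 !mul1r !mulr1.
have -> : L *m B *m U = block_mx w%:M (d *: row_mx 0 v) (row_mx 0 v)^T (block_mx 1%:M 0 0 M).
  rewrite /L /B /U !mulmx_block !(mul1mx, mul0mx, mulmx0, mulmx1, addr0, add0r).
  have dl : - (p *: e^T) *m w%:M + (row_mx (p * w)%:M v)^T = (row_mx 0 v)^T.
    rewrite mul_mx_scalar /e.
    rewrite !(tr_row_mx, trmx0, trmx1, opp_col_mx, scale_col_mx, scaler0, oppr0, add_col_mx, add0r).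
    congr col_mx; by apply/matrixP => i j; rewrite !mxE !ord1 /=; ring.
  have ur : w%:M *m - ((d * p) *: e) + d *: row_mx (p * w)%:M v = d *: row_mx 0 v.
    rewrite mul_scalar_mx /e !(scale_row_mx, opp_row_mx, scaler0, oppr0, add_row_mx, add0r).
    by congr row_mx; apply/matrixP => i j; rewrite !mxE !ord1 /=; ring.
  rewrite ur dl; congr block_mx.
  rewrite mulmxN -scalemxAr mulNmx -scalemxAl -scalemxAr /e.
  rewrite !tr_row_mx trmx0 trmx1 !mul_col_row !scale_block_mx !opp_block_mx !add_block_mx.
  rewrite !(trmx0, mul0mx, mulmx0, mul1mx, mulmx1, scaler0, oppr0, addr0, add0r); congr block_mx.
  - by apply/matrixP => i j; rewrite !mxE !ord1 /=; ring.
  - by apply/matrixP => i j; rewrite !mxE /=; ring.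
  - by apply/matrixP => i j; rewrite !mxE /=; ring.
rewrite det_bordered -/(border _ _ _) -[(row_mx 0 v)^T]scale1r borderZ mulr1.
rewrite det_lblock det1 mul1r tr_row_mx trmx0 border_block /border !mul0mx mxE mul0r add0r det1 mul1r.
by [].
Qed.

Lemma edge_borderS W a k : edge_border W (W a) a k.+1 = edge_border W (W a) a.+1 k.
Proof. by rewrite edge_borderE edge_matrixS edge_rowS; exact: border_shift. Qed.

Lemma edge_det0 W a : edge_det W a 0 = 1.
Proof. exact: det_mx00. Qed.

Lemma edge_border0 W w a : edge_border W w a 0 = w.
Proof.
rewrite /edge_border edge_det0 mulr1 /border [\adj _]flatmx0 mulmx0 mul0mx mxE mulr0 subr0 //.
Qed.

Lemma edge_borderD W w w' a k :
  edge_border W w a k = edge_border W w' a k + (w - w') * edge_det W a k.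
Proof. by rewrite /edge_border; ring. Qed.

End SemiseparableDeterminant.

Lemma sum_prod_cons (T : eqType) (A : comNzRingType) (S D : T -> A) j js : j \notin js ->
  \sum_(i <- j :: js) S i * \prod_(k <- j :: js | k != i) D k =
  S j * \prod_(k <- js) D k + D j * \sum_(i <- js) S i * \prod_(k <- js | k != i) D k.
Proof.
move=> jjs; rewrite big_cons; congr (_ * _ + _).
  rewrite big_cons eqxx /= [LHS]big_seq_cond [RHS]big_seq; apply: eq_bigl => k.
  by case: (boolP (k \in js)) => //= kjs; apply: contraNneq jjs => <-.
rewrite mulr_sumr; apply: eq_big_seq => i ijs; rewrite big_cons ifT 1?mulrCA//.
by apply: contraNneq jjs => ->.
Qed.

Section GramDeterminant.
Context {R : realType} {n : nat}.
Local Notation mu := (@lebesgue_measure R).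
Local Notation starfun := ('I_n -> R -> R[i]).
Variable V : 'I_n -> R -> R.
Hypothesis hV : forall j, mu.-integrable halfline (EFin \o V j).
Variable c : R[i].
Hypothesis hc : Re c < 0.
Variables (d : R) (N : nat).
Hypothesis d0 : 0 < d.
Implicit Types (u v : starfun) (j : 'I_n) (js : seq 'I_n).

Definition jump (v : R -> R) t : R[i] := cint `]t, +oo[ (fun x => cE (2 * c) x * (v x)%:C).
Definition node_jump j i := jump (V j) (i%:R * d).
Definition node_phase i : R[i] := cE (- c) (i%:R * d).
Local Notation ker i := (hker c (i%:R * d)).
Local Notation D j := (edge_det d%:C node_phase (node_jump j) 0 N).
Local Notation S j := (edge_border d%:C node_phase (node_jump j) (node_jump j 0) 0 N).

Let nd i : 0 <= i%:R * d.
Proof. by rewrite mulr_ge0// ltW. Qed.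

Lemma cintegrable_potential j : cintegrable halfline (fun x => (V j x)%:C : R[i]).
Proof. by split; [exact: hV|exact: integrable0]. Qed.

Lemma inner_left_right j1 j2 (h1 h2 : R -> R[i]) :
  inner (left_vector V j1 h1) (right_vector V j2 h2) =
  if j1 == j2 then cint halfline (fun x => h1 x * (h2 x * (V j1 x)%:C)) else 0.
Proof.
rewrite inner_left_vector /edge_pairing /mul_sqrt_abs /right_vector.
case: eqP => [<-|_]; last first.
  by rewrite -[RHS](cint0 halfline); apply: eq_cint => x _; rewrite !mulr0.
apply: eq_cint => x _.
have -> : (V j1 x)%:C = (Num.sqrt `|V j1 x|)%:C * (Num.sg (V j1 x) * Num.sqrt `|V j1 x|)%:C :> R[i].
  by rewrite -rmorphM mulrCA -expr2 sqr_sqrtr// -numEsg.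
by ring.
Qed.

Lemma cint_hker2 j s t : 0 <= s -> s <= t ->
  cint halfline (fun x => hker c t x * (hker c s x * (V j x)%:C)) =
  cE (- c) s * cE (- c) t * jump (V j) t.
Proof.
move=> s0 st; have t0 := le_trans s0 st.
have [mh [M hM]] := bounded_hker hc s.
have iV := cintegrable_potential j.
rewrite (cint_hker hc)//; last by apply: (@cintegrableM _ _ _ _ M).
rewrite mulrC mulrAC [cE (- c) s * _]mulrC; congr (_ * _).
rewrite /jump -cintZr//; last first.
  apply: (@cintegrableS _ halfline) => //; first exact: itvoy_sub_halfline.
  apply: (@cintegrableM _ _ _ _ 1) => //; first exact: cmeasurable_cE.
  move=> x /halfline_ge0 x0; rewrite normc_cE -expR0 ler_expR mulr_le0_ge0//.
  have -> : Re (2 * c) = Re c + Re c by rewrite -ReD; congr complex.Re; ring.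
  by move: hc; lra.
apply: eq_cint => x /=; rewrite in_itv/= andbT => tx.
rewrite /hker (le_trans st (ltW tx)) cED cENr (_ : 2 * c = c + c) ?cEDl; ring.
Qed.

Lemma inner_node j1 j2 i1 i2 :
  inner (left_vector V j1 (ker i1)) (right_vector V j2 (ker i2)) =
  if j1 == j2 then node_phase i1 * node_phase i2 * node_jump j1 (maxn i1 i2) else 0.
Proof.
rewrite inner_left_right; case: eqP => // _.
have [h|/ltnW h] := leqP i1 i2.
  rewrite (@eq_cint _ _ _ (fun x => ker i2 x * (ker i1 x * (V j1 x)%:C))); last by move=> x _; ring.
  by rewrite cint_hker2// ler_wpM2r ?(ltW d0)// ler_nat.
rewrite cint_hker2//; last by rewrite ler_wpM2r ?(ltW d0)// ler_nat.
by rewrite /node_phase /node_jump; ring.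
Qed.

Fixpoint left_family js : 'I_(size js * N) -> starfun :=
  match js return 'I_(size js * N) -> starfun with
  | [::] => fun _ _ _ => 0
  | j :: js' => fun i => match fintype.split (i : 'I_(N + size js' * N)) with
    | inl k => sscale d%:C (left_vector V j (ker k))
    | inr i' => left_family i' end
  end.

Fixpoint right_family js : 'I_(size js * N) -> starfun :=
  match js return 'I_(size js * N) -> starfun with
  | [::] => fun _ _ _ => 0
  | j :: js' => fun i => match fintype.split (i : 'I_(N + size js' * N)) with
    | inl k => right_vector V j (ker k)
    | inr i' => right_family i' end
  end.

Lemma left_family_l j js (k : 'I_N) :
  @left_family (j :: js) (lshift _ k : 'I_(N + size js * N)) = sscale d%:C (left_vector V j (ker k)).
Proof. by rewrite /= (unsplitK (inl _ k)). Qed.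
Lemma left_family_r j js (k : 'I_(size js * N)) :
  @left_family (j :: js) (rshift N k : 'I_(N + size js * N)) = left_family k.
Proof. by rewrite /= (unsplitK (inr _ k)). Qed.
Lemma right_family_l j js (k : 'I_N) :
  @right_family (j :: js) (lshift _ k : 'I_(N + size js * N)) = right_vector V j (ker k).
Proof. by rewrite /= (unsplitK (inl _ k)). Qed.
Lemma right_family_r j js (k : 'I_(size js * N)) :
  @right_family (j :: js) (rshift N k : 'I_(N + size js * N)) = right_family k.
Proof. by rewrite /= (unsplitK (inr _ k)). Qed.

Lemma L2_left_family js i : L2 (@left_family js i).
Proof.
elim: js i => [|j js ih] i; first exact: L20.
rewrite /=; case: fintype.split => k; last exact: ih.
by apply: L2Z; apply: L2_left_vector => //; exact: bounded_hker.
Qed.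

Lemma L2_right_family js i : L2 (@right_family js i).
Proof.
elim: js i => [|j js ih] i; first exact: L20.
rewrite /=; case: fintype.split => k; last exact: ih.
by apply: L2_right_vector => //; exact: bounded_hker.
Qed.

Lemma sum_family js u j x : \sum_i inner (@left_family js i) u * right_family i j x =
  \sum_(j' <- js) \sum_(k < N) inner (sscale d%:C (left_vector V j' (ker k))) u * right_vector V j' (ker k) j x.
Proof.
elim: js => [|j' js ih]; first by rewrite big_nil big1// => -[].
rewrite big_cons -ih [LHS](@big_split_ord _ _ _ N (size js * N)).
by congr (_ + _); apply: eq_bigr => k _;
  rewrite ?left_family_l ?right_family_l ?left_family_r ?right_family_r.
Qed.

Definition family_gram js : 'M[R[i]]_(size js * N) :=
  1%:M + \matrix_(i, i') inner (left_family i) (@right_family js i').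

Definition family_row js : 'rV[R[i]]_(size js * N) :=
  \row_i inner (star_left V c) (@right_family js i).

Lemma inner_left_family0 js j (k : 'I_N) i : j \notin js ->
  inner (@left_family js i) (right_vector V j (ker k)) = 0.
Proof.
elim: js i => [|j' js ih] i; first by case: i.
rewrite inE negb_or eq_sym => /andP[jj' jjs] /=; case: fintype.split => k'; last exact: ih.
rewrite innerZl; [|exact: L2_right_vector (bounded_hker _ _)|exact: L2_left_vector (bounded_hker _ _)].
by rewrite inner_node (negbTE jj') mulr0.
Qed.

Lemma inner_right_family0 js j (k : 'I_N) i : j \notin js ->
  inner (left_vector V j (ker k)) (@right_family js i) = 0.
Proof.
elim: js i => [|j' js ih] i; first by case: i.
rewrite inE negb_or => /andP[jj' jjs] /=; case: fintype.split => k'; last exact: ih.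
by rewrite inner_node (negbTE jj').
Qed.

Lemma family_gram_cons j js : j \notin js -> family_gram (j :: js) =
  block_mx (edge_matrix d%:C node_phase (node_jump j) 0 N) 0 0 (family_gram js) :> 'M[R[i]]_(N + size js * N).
Proof.
move=> jjs; apply/matrixP => i i'.
have bk t : bounded_measurable (ker t) := bounded_hker hc _.
rewrite -(splitK i) -(splitK i'); case: (fintype.split i) => k; case: (fintype.split i') => k'; rewrite [LHS]mxE [X in X + _]mxE [X in _ + X]mxE.
- rewrite block_mxEul left_family_l right_family_l innerZl ?conjc_real; [|exact: L2_right_vector|exact: L2_left_vector].
  rewrite inner_node eqxx !mxE !add0n; congr (_%:R + _).
- rewrite block_mxEur left_family_l right_family_r innerZl; [|exact: L2_right_family|exact: L2_left_vector].
  by rewrite inner_right_family0// mulr0 addr0 eq_lrshift mxE.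
- rewrite block_mxEdl left_family_r right_family_l inner_left_family0//.
  by rewrite addr0 eq_rlshift mxE.
rewrite block_mxEdr left_family_r right_family_r !mxE; congr (_%:R + _).
by rewrite eq_rshift.
Qed.

Lemma node_phase0 : node_phase 0 = 1.
Proof. by rewrite /node_phase mul0r cE0. Qed.

Lemma hker0 : hker c 0 = ker 0.
Proof. by rewrite mul0r. Qed.

Lemma inner_star_node j k : inner (star_left V c) (right_vector V j (ker k)) =
  node_phase k * node_jump j k.
Proof.
rewrite inner_star_left (bigD1 j)//= [X in _ + X]big1 ?addr0 => [|i /negbTE ij];
  rewrite -inner_left_vector hker0 inner_node ?eqxx ?ij//.
by rewrite max0n node_phase0 mul1r.
Qed.

Lemma inner_node_star j k : inner (left_vector V j (ker k)) (star_right V c) =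
  node_phase k * node_jump j k.
Proof.
have := inner_node j j k 0; rewrite eqxx maxn0 node_phase0 mulr1 => <-.
rewrite !inner_left_vector; apply: eq_cint => x _.
by rewrite /mul_sqrt_abs /right_vector eqxx /star_right hker0.
Qed.

Lemma inner_star_star : inner (star_left V c) (star_right V c) = \sum_j node_jump j 0.
Proof.
rewrite inner_star_left; apply: eq_bigr => j _.
by rewrite -inner_left_vector hker0 inner_node_star node_phase0 mul1r.
Qed.

Lemma family_row_cons j js : family_row (j :: js) =
  row_mx (edge_row node_phase (node_jump j) 0 N) (family_row js) :> 'rV[R[i]]_(N + size js * N).
Proof.
apply/rowP => i; rewrite -(splitK i) [LHS]mxE; case: (fintype.split i) => k.
  by rewrite row_mxEl right_family_l inner_star_node mxE.
by rewrite row_mxEr right_family_r mxE.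
Qed.

Lemma inner_left_family_star js i :
  inner (@left_family js i) (star_right V c) = d%:C * family_row js 0 i.
Proof.
rewrite mxE; elim: js i => [|j js ih] i; first by case: i.
rewrite /=; case: fintype.split => k; last exact: ih.
rewrite innerZl ?conjc_real; [|exact: L2_star_right|exact: L2_left_vector (bounded_hker _ _)].
by rewrite inner_node_star inner_star_node.
Qed.

Lemma det_family_gram js : uniq js -> \det (family_gram js) = \prod_(j <- js) D j.
Proof.
elim: js => [|j js ih] /=; first by rewrite big_nil [family_gram [::]](_ : _ = 1%:M) ?det1//; apply/matrixP => -[].
by move=> /andP[jjs /ih e]; rewrite big_cons -e family_gram_cons// det_lblock.
Qed.

Lemma border_family_gram js : uniq js ->
  (\sum_(j <- js) node_jump j 0) * \det (family_gram js) -
    d%:C * border (family_gram js) (family_row js) (family_row js)^T =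
  \sum_(j <- js) S j * \prod_(k <- js | k != j) D k.
Proof.
elim: js => [|j js ih] /=.
  move=> _; rewrite !big_nil mul0r sub0r /border.
  by rewrite [X in (X *m _ *m _) 0 0](_ : _ = 0) ?mul0mx ?mxE ?mulr0 ?oppr0//; apply/rowP => -[].
move=> /andP[jjs ujs]; have := ih ujs => {}ih.
have eP := det_family_gram ujs.
have eP' : \det (family_gram (j :: js)) = D j * \prod_(k <- js) D k.
  by rewrite det_family_gram ?big_cons//= jjs.
have eB := congr2 (fun (M : 'M[R[i]]_(N + size js * N)) (r : 'rV[R[i]]_(N + size js * N)) =>
  border M r r^T) (family_gram_cons jjs) (family_row_cons j js).
rewrite tr_row_mx border_block eP in eB.
transitivity ((node_jump j 0 + \sum_(j <- js) node_jump j 0) * (D j * \prod_(k <- js) D k) -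
  d%:C * (border (edge_matrix d%:C node_phase (node_jump j) 0 N)
    (edge_row node_phase (node_jump j) 0 N) (edge_row node_phase (node_jump j) 0 N)^T *
    \prod_(k <- js) D k + D j * border (family_gram js) (family_row js) (family_row js)^T)).
  by rewrite big_cons eP'; congr (_ - _ * _); exact: eB.
rewrite (sum_prod_cons _ _ jjs) -ih eP /edge_border.
move: (border _ _ _) (border _ _ _) (edge_det _ _ _ _ _) (\prod_(k <- js) _) (\sum_(k <- js) _) (node_jump _ _) => b1 b2 D0 P0 W0 J0; ring.
Qed.

Local Notation all_edges := (enum 'I_n).

Definition total_left (i : 'I_(1 + size all_edges * N)) : starfun :=
  match fintype.split i with
  | inl _ => sscale (conjc (@star_weight R n c)) (star_left V c)
  | inr i' => left_family i'
  end.

Definition total_right (i : 'I_(1 + size all_edges * N)) : starfun :=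
  match fintype.split i with
  | inl _ => star_right V c
  | inr i' => right_family i'
  end.

Lemma L2_total i : L2 (total_left i) /\ L2 (total_right i).
Proof.
rewrite /total_left /total_right; case: fintype.split => k; split.
- by apply: L2Z; exact: L2_star_left.
- exact: L2_star_right.
- exact: L2_left_family.
- exact: L2_right_family.
Qed.

Lemma gram_det_total : gram_det total_left total_right =
  \prod_j D j + @star_weight R n c * \sum_j S j * \prod_(k | k != j) D k.
Proof.
have uE : uniq all_edges by exact: enum_uniq.
pose w := @star_weight R n c; pose J := \sum_j node_jump j 0.
have -> : gram_det total_left total_right =
    \det (block_mx (1 + w * J)%:M (w *: family_row all_edges) (d%:C *: (family_row all_edges)^T)
      (family_gram all_edges)).
  rewrite /gram_det; congr (\det _); apply/matrixP => i i'.
  rewrite -(splitK i) -(splitK i') [LHS]mxE [X in X + _]mxE [X in _ + X]mxE.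
  case: (fintype.split i) => k; case: (fintype.split i') => k'; rewrite /total_left /total_right !unsplitK /=.
  - rewrite block_mxEul innerZl ?conjcK; [|exact: L2_star_right|exact: L2_star_left].
    by rewrite inner_star_star mxE !ord1 eqxx mulr1n.
  - rewrite block_mxEur innerZl ?conjcK; [|exact: L2_right_family|exact: L2_star_left].
    by rewrite eq_lrshift add0r !mxE.
  - by rewrite block_mxEdl inner_left_family_star eq_rlshift add0r !mxE.
  by rewrite block_mxEdr !mxE eq_rshift.
rewrite det_bordered -/(border _ _ _) borderZ det_family_gram// -big_enum /=.
have := border_family_gram uE; rewrite det_family_gram// !big_enum /= -/J => h.
have -> : \sum_j S j * \prod_(k | k != j) D k =
    \sum_(i in 'I_n) S i * \prod_(k <- all_edges | k != i) D k.
  by apply: eq_big => // j _; rewrite big_enum_cond; congr (_ * _); apply: eq_bigl.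
rewrite -h -/w; move: (border _ _ _) (\prod_(i in 'I_n) _) => b P; ring.
Qed.

Lemma rank1_total u : L2 u -> rank1_sum total_left total_right u = fun j x =>
  @star_weight R n c * inner (star_left V c) u * star_right V c j x +
  \sum_(i < n) \sum_(k < N) d%:C * edge_pairing V i (ker k) u * right_vector V i (ker k) j x.
Proof.
move=> hu; apply/funext => j; apply/funext => x; rewrite /rank1_sum big_split_ord /= big_ord1.
congr (_ + _).
  rewrite /total_left /total_right (unsplitK (inl _ ord0)) innerZl ?conjcK//.
  exact: L2_star_left.
rewrite (eq_bigr (fun i => inner (left_family i) u * right_family i j x)); last first.
  by move=> i _; rewrite /total_left /total_right (unsplitK (inr _ i)).
rewrite sum_family big_enum; apply: eq_big => // i _; apply: eq_bigr => k _.
rewrite innerZl ?conjc_real//; last exact: L2_left_vector (bounded_hker _ _).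
by rewrite inner_left_vector.
Qed.

End GramDeterminant.

(** * Jost solutions *)

Section Jost.
Context {R : realType}.
Local Notation mu := (@lebesgue_measure R).
Variable v : R -> R.
Hypothesis hv : mu.-integrable halfline (EFin \o v).
Variable c : R[i].
Hypothesis hc : Re c < 0.
Variables th dth : R -> R[i].
Hypothesis th_ac : ac_deriv th dth.
Hypothesis dth_ac : ac_deriv dth (fun x => ((v x)%:C + c ^+ 2) * th x).
Hypothesis th_lim : (fun x : R => th x / cE c x) x @[x --> +oo] --> (1 : R[i]).

Definition amplitude x : R[i] := cE (- c) x * th x.
Definition incoming x : R[i] := dth x - c * th x.
Definition flux x : R[i] := cE c x * incoming x.
Definition slope x : R[i] := cE (- c) x * incoming x.

Let cE2 x : cE (2 * c) x = cE c x * cE c x.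
Proof. by rewrite (_ : 2 * c = c + c) ?cEDl//; ring. Qed.
Let cE2N x : cE (- (2 * c)) x = cE (- c) x * cE (- c) x.
Proof. by rewrite (_ : - (2 * c) = - c + - c) ?cEDl//; ring. Qed.
Let hc2 : Re (2 * c) < 0.
Proof. by rewrite (_ : Re (2 * c) = Re c + Re c) -?ReD; [move: hc; lra|congr complex.Re; ring]. Qed.

Lemma amplitude_ac : ac_deriv amplitude slope.
Proof.
have := ac_derivM (ac_cE (- c)) th_ac; apply: eq_ac_deriv => x x0 //.
by rewrite /slope /incoming; ring.
Qed.

Lemma incoming_ac : ac_deriv incoming (fun x => (v x)%:C * th x - c * incoming x).
Proof.
have := ac_derivD dth_ac (ac_derivZ (- c) th_ac); apply: eq_ac_deriv => x x0.
  by rewrite /incoming; ring.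
by rewrite /incoming; ring.
Qed.

Lemma flux_ac : ac_deriv flux (fun x => cE (2 * c) x * ((v x)%:C * amplitude x)).
Proof.
have := ac_derivM (ac_cE c) incoming_ac; apply: eq_ac_deriv => x x0 //.
rewrite /amplitude cE2.
transitivity (cE c x * (v x)%:C * th x * (cE c x * cE (- c) x)); last by ring.
by rewrite cEK mulr1; ring.
Qed.

Lemma slope_ac : ac_deriv slope (fun x => (v x)%:C * amplitude x - 2 * c * slope x).
Proof.
have := ac_derivM (ac_cE (- c)) incoming_ac; apply: eq_ac_deriv => x x0 //.
by rewrite /amplitude /slope; ring.
Qed.

Lemma slope_flux x : slope x = cE (- (2 * c)) x * flux x.
Proof.
rewrite /slope /flux cE2N; have e : cE c x * cE (- c) x = 1 by exact: cEK.
by rewrite -[LHS]mulr1 -e; ring.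
Qed.

Lemma amplitude_limit (e : R) : 0 < e ->
  exists2 X, 0 <= X & forall x, X <= x -> normc (amplitude x - 1) <= e.
Proof.
move=> e0; have /cvgCP /(_ e e0) [X [Xr hX]] := th_lim.
exists (Num.max 0 (X + 1)); first by rewrite le_max lexx.
move=> x; rewrite ge_max => /andP[x0 xX]; have : X < x by lra.
move=> /hX /ltW; rewrite /amplitude.
suff -> : th x / cE c x = cE (- c) x * th x by [].
by rewrite mulrC; congr (_ * _); apply: (mulfI (cexp_neq0 (c * x%:C))); rewrite mulfV ?cexp_neq0// -/(cE c x) cEK.
Qed.

Lemma amplitude_bounded : exists2 M : R, 0 <= M & forall x, 0 <= x -> normc (amplitude x) <= M.
Proof.
have [X X0 hX] := amplitude_limit ltr01.
exists (2 + (normc (amplitude 0) + variation slope X)).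
  rewrite addr_ge0// addr_ge0 ?normc_ge0//; apply: Rintegral_ge0 => x _; exact: normc_ge0.
have v0 : 0 <= variation slope X by apply: Rintegral_ge0 => x _; exact: normc_ge0.
move=> x x0; have [xX|/ltW Xx] := leP x X.
  by apply: le_trans (ac_bounded amplitude_ac x0 xX) _; rewrite lerDr.
have := hX x Xx => h; rewrite -[amplitude x](subrK 1).
apply: le_trans (normcD _ _) _; rewrite Normc.normc1; have := normc_ge0 (amplitude 0); lra.
Qed.

Variable M : R.
Hypothesis M0 : 0 <= M.
Hypothesis hM : forall x, 0 <= x -> normc (amplitude x) <= M.

Let g x := (v x)%:C * amplitude x.
Definition tail_mass t := \int[mu]_(x in `]t, +oo[) `|v x|.
Definition total_mass := \int[mu]_(x in halfline) `|v x|.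

Let iav : mu.-integrable halfline (EFin \o (fun x => `|v x|)).
Proof. exact: integrable_abse hv. Qed.

Let iv : cintegrable halfline (fun x => (v x)%:C : R[i]).
Proof. by split; [exact: hv|exact: integrable0]. Qed.

Let ig : cintegrable halfline g.
Proof.
have h : cintegrable halfline (fun x => amplitude x * (v x)%:C).
  apply: (@cintegrableM _ _ _ _ M) => //; first exact: ac_cmeasurable_halfline amplitude_ac.
  by move=> x /halfline_ge0; exact: hM.
by apply: eq_cintegrable h => // x _; rewrite mulrC.
Qed.

Let iEg : cintegrable halfline (fun x => cE (2 * c) x * g x).
Proof. by have [] := decaying_integrable hc2 ig. Qed.

Lemma total_mass_ge0 : 0 <= total_mass.
Proof. exact: Rintegral_ge0. Qed.

Lemma tail_mass_le t : 0 <= t -> tail_mass t <= total_mass.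
Proof. by move=> t0; apply: ler_Rintegral_sub => //; exact: itvoy_sub_halfline. Qed.

Let tail_g t : 0 <= t -> normc (tail_transform (2 * c) g t) <= M * tail_mass t.
Proof.
move=> t0; apply: le_trans (normc_tail_transform_le hc2 ig t0) _.
have sub := itvoy_sub_halfline t0.
have it : mu.-integrable `]t, +oo[ (EFin \o (fun x => `|v x|)).
  exact: (@integrableS _ _ _ mu halfline).
rewrite /tail_mass -RintegralZl//; apply: le_Rintegral => //.
- by apply: cintegrable_normc => //; apply: cintegrableS ig.
- exact: integrable_scale.
move=> x /sub /halfline_ge0 x0; rewrite Normc.normcM normc_real mulrC ler_wpM2r//; exact: hM.
Qed.

Let finf := flux 0 + cint halfline (fun x => cE (2 * c) x * g x).

Let slopeE t : 0 <= t ->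
  slope t = cE (- (2 * c)) t * finf - tail_transform (2 * c) g t.
Proof.
move=> t0; rewrite slope_flux; have [_ ->] := flux_ac t0.
by rewrite /tail_transform /finf -/g; ring.
Qed.

(* A nonzero limit of the flux would make the amplitude grow exponentially. *)
Lemma flux_limit0 : finf = 0.
Proof.
pose b := - (2 * Re c); have b0 : 0 < b by rewrite oppr_gt0 pmulr_rlt0.
have c0 : c != 0 by apply/eqP => h; move: hc; rewrite h ltxx.
pose C := 2 * normc c * (2 * M + M * total_mass).
have nE t : normc (cE (- (2 * c)) t) = expR (b * t).
  by rewrite cE2N Normc.normcM !normc_cE -expRD; congr expR; rewrite ReN /b; ring.
have main t : 0 <= t -> normc finf * (expR b - 1) * expR (b * t) <= C.
  move=> t0; have t1 : t <= t + 1 by rewrite lerDl.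
  have t10 := le_trans t0 t1.
  have sub : `]t, t + 1] `<=` (`[0, t + 1] : set R) by exact: itvoc_sub_cc.
  pose p := tail_transform (2 * c) g.
  have ip : cintegrable `]t, t + 1] p.
    apply: cintegrableS sub _ => //.
    exact: (@tail_transform_loc R 1 (2 * c) (fun _ => g) ord0 (t + 1) (decaying_integrable hc2 ig)).
  have iE : cintegrable `]t, t + 1] (fun x => - (2 * c) * cE (- (2 * c)) x).
    by apply: cintegrableS sub (ac_integrable (ac_cE (- (2 * c))) t10).
  have e1 := ac_incr amplitude_ac t0 t1.
  have e2 := ac_incr (ac_cE (- (2 * c))) t0 t1.
  have e3 : - (2 * c) * cint `]t, t + 1] slope = finf * cint `]t, t + 1] (fun x => - (2 * c) * cE (- (2 * c)) x) + 2 * c * cint `]t, t + 1] p.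
    have is_ : cintegrable `]t, t + 1] slope by apply: cintegrableS sub (ac_integrable amplitude_ac t10).
    rewrite -!cintZ// -cintD//; try exact: cintegrableZ.
    apply: eq_cint => x /=; rewrite in_itv/= => /andP[tx _].
    rewrite (slopeE (le_trans t0 (ltW tx))) -/p; ring.
  rewrite -e1 -e2 in e3.
  have e4 : finf * (cE (- (2 * c)) (t + 1) - cE (- (2 * c)) t) =
      - (2 * c) * (amplitude (t + 1) - amplitude t) - 2 * c * cint `]t, t + 1] p by rewrite e3; ring.
  have bp : normc (cint `]t, t + 1] p) <= M * total_mass.
    apply: le_trans (normc_cint _ ip) _ => //.
    have <- : M * total_mass * (t + 1 - t) = M * total_mass by ring.
    apply: integral_le_cst => //; first exact: cintegrable_normc.
    move=> x tx _; have x0 : 0 <= x by rewrite (le_trans t0)// ltW.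
    by apply: le_trans (tail_g x0) _; rewrite ler_wpM2l// tail_mass_le.
  have n2 : normc (2 * c) = 2 * normc c.
    by rewrite Normc.normcM -[2](rmorph_nat (real_complex R)) normc_real ger0_norm.
  have rhs : normc (- (2 * c) * (amplitude (t + 1) - amplitude t) - 2 * c * cint `]t, t + 1] p) <= C.
    apply: le_trans (normcB _ _) _; rewrite (Normc.normcM (- (2 * c))) (Normc.normcM (2 * c)) normcN n2 /C mulrDr; apply: lerD.
      rewrite ler_wpM2l ?mulr_ge0 ?normc_ge0//; apply: le_trans (normcB _ _) _.
      by have := hM t0; have := hM t10; lra.
    by rewrite ler_wpM2l ?mulr_ge0 ?normc_ge0.
  rewrite -e4 Normc.normcM in rhs; apply: le_trans rhs; rewrite -mulrA ler_wpM2l ?normc_ge0//.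
  rewrite -!nE; have := ler_dist_normc (cE (- (2 * c)) (t + 1)) (cE (- (2 * c)) t).
  apply: le_trans; rewrite !nE mulrDr mulr1 expRD; apply: le_trans (ler_norm _); lra.
apply/eqP; rewrite -normc_eq0 eq_le normc_ge0 andbT leNgt; apply/negP => f0.
have eb : 0 < expR b - 1 by rewrite subr_gt0 expR_gt1.
set K := normc finf * (expR b - 1) in main; have K0 : 0 < K by rewrite mulr_gt0.
have C0 : 0 <= C by rewrite !(mulr_ge0, addr_ge0) ?normc_ge0 ?total_mass_ge0.
have t0 : 0 <= C / K / b by rewrite !divr_ge0// ltW.
have := main _ t0; apply/negP; rewrite -ltNge.
have -> : b * (C / K / b) = C / K by field; rewrite !gt_eqF.
apply: (@lt_le_trans _ _ (K * (1 + C / K))); last by rewrite ler_wpM2l ?(ltW K0)// expR_ge1Dx.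
by rewrite mulrDr mulr1 mulrCA mulfV ?gt_eqF// mulr1 ltrDr.
Qed.

Lemma slope_bound t : 0 <= t -> normc (slope t) <= M * tail_mass t.
Proof. by move=> t0; rewrite slopeE// flux_limit0 mulr0 sub0r normcN; exact: tail_g. Qed.

End Jost.

Lemma discrete_gronwall (R : realType) (x a e : nat -> R) N :
  (forall k, 0 <= a k) -> (forall k, 0 <= e k) -> (forall k, 0 <= x k) ->
  (forall k, (k < N)%N -> x k <= (1 + a k) * x k.+1 + e k) ->
  x 0%N <= expR (\sum_(k < N) a k) * (x N + \sum_(k < N) e k).
Proof.
move=> a0 e0 x0; elim: N => [|N ih] h.
  by rewrite !big_ord0 expR0 mul1r addr0.
apply: le_trans (ih _) _; first by move=> k kN; apply: h; rewrite ltnS ltnW.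
rewrite !big_ord_recr/= expRD -mulrA ler_wpM2l ?expR_ge0//.
have h1 := h N (ltnSn N); have h2 := expR_ge1Dx (a N).
have s0 : 0 <= \sum_(k < N) e k by apply: sumr_ge0.
have := x0 N.+1; have := e0 N; have := a0 N; nra.
Qed.

Section JostDiscretization.
Context {R : realType}.
Local Notation mu := (@lebesgue_measure R).
Variable v : R -> R.
Hypothesis hv : mu.-integrable halfline (EFin \o v).
Variable c : R[i].
Hypothesis hc : Re c < 0.
Variables th dth : R -> R[i].
Hypothesis th_ac : ac_deriv th dth.
Hypothesis dth_ac : ac_deriv dth (fun x => ((v x)%:C + c ^+ 2) * th x).
Variable M : R.
Hypothesis M0 : 0 <= M.
Hypothesis hM : forall x, 0 <= x -> normc (amplitude c th x) <= M.
Variables (d : R) (N : nat).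
Hypothesis d0 : 0 < d.
Hypothesis d1 : d <= 1.

Local Notation q := (node_phase c d).
Local Notation W := (fun i => jump c v (i%:R * d)).
Local Notation A := (amplitude c th).
Local Notation B := (flux c th dth).
Local Notation sg := (slope c th dth).
Local Notation MV := (total_mass v).

Definition edge_tail_det k := edge_det d%:C q W k (N - k).
Definition edge_tail_border k := edge_border d%:C q W (W k) k (N - k).

Let b := - (2 * Re c).
Let b0 : 0 < b. Proof. by rewrite oppr_gt0 pmulr_rlt0. Qed.

Lemma edge_tail_detS k : (k < N)%N ->
  edge_tail_det k = edge_tail_det k.+1 + d%:C * q k ^+ 2 * edge_tail_border k.
Proof.
move=> kN; rewrite /edge_tail_det /edge_tail_border.
have -> : (N - k = (N - k.+1).+1)%N by rewrite subnSK.
by rewrite edge_detS edge_borderS.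
Qed.

Lemma edge_tail_borderS k : (k < N)%N ->
  edge_tail_border k = edge_tail_border k.+1 + (W k - W k.+1) * edge_tail_det k.+1.
Proof.
move=> kN; rewrite /edge_tail_det /edge_tail_border.
have -> : (N - k = (N - k.+1).+1)%N by rewrite subnSK.
rewrite edge_borderS.
by rewrite (edge_borderD _ _ _ _ (W k.+1)).
Qed.

Definition det_error k := normc (edge_tail_det k - A (k%:R * d)).
Definition border_error k := normc (q k ^+ 2 * (edge_tail_border k + B (k%:R * d))).
Definition cell_mass k := \int[mu]_(x in `](k%:R * d), (k.+1%:R * d)]) `|v x|.

Let nd k : 0 <= k%:R * d.
Proof. by rewrite mulr_ge0// ltW. Qed.
Let ndS k : k%:R * d <= k.+1%:R * d.
Proof. by rewrite ler_wpM2r ?(ltW d0)// ler_nat. Qed.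
Let step k : k.+1%:R * d - k%:R * d = d.
Proof. by rewrite -natr1; ring. Qed.

Let iav : mu.-integrable halfline (EFin \o (fun x => `|v x|)).
Proof. exact: integrable_abse hv. Qed.

Let iv : cintegrable halfline (fun x => (v x)%:C : R[i]).
Proof. by split; [exact: hv|exact: integrable0]. Qed.

Lemma cell_mass_ge0 k : 0 <= cell_mass k.
Proof. exact: Rintegral_ge0. Qed.

Lemma cell_mass_sum : \sum_(k < N) cell_mass k <= MV.
Proof.
pose P k := \int[mu]_(x in `[0, k%:R * d]) `|v x|.
have E k : cell_mass k = P k.+1 - P k.
  have := variation_incr (g := fun x => (v x)%:C) (nd k) (ndS k).
  rewrite /variation /cell_mass /P => h.
  have nE (D : set R) : \int[mu]_(x in D) normc ((v x)%:C : R[i]) = \int[mu]_(x in D) `|v x|.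
    by apply: eq_Rintegral => x _; rewrite normc_real.
  rewrite !nE in h; rewrite h//; apply: cintegrableS iv => //; exact: itvcc_sub_halfline.
rewrite (eq_bigr (fun k : 'I_N => P k.+1 - P k)) => [|k _]; last by rewrite E.
rewrite -(big_mkord xpredT (fun k => P k.+1 - P k)) (telescope_sumr P)//.
apply: (@le_trans _ _ (P N)).
  by rewrite gerBl; apply: Rintegral_ge0.
by apply: ler_Rintegral_sub => //; exact: itvcc_sub_halfline.
Qed.

Let slope_sup t : 0 <= t -> normc (sg t) <= M * MV.
Proof.
move=> t0; apply: le_trans (slope_bound hv hc th_ac dth_ac M0 hM t0) _.
by rewrite ler_wpM2l// tail_mass_le.
Qed.

Lemma amplitude_osc s t : 0 <= s -> s <= t -> normc (A t - A s) <= M * MV * (t - s).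
Proof.
move=> s0 st; have aA := amplitude_ac c th_ac; rewrite (ac_incr aA s0 st).
have is_ : cintegrable `]s, t] sg.
  by apply: cintegrableS (itvoc_sub_cc s0 (lexx t)) (ac_integrable aA (le_trans s0 st)).
apply: le_trans (normc_cint _ is_) _ => //.
apply: integral_le_cst => //; first exact: cintegrable_normc.
by move=> x sx _; apply: slope_sup; rewrite (le_trans s0)// ltW.
Qed.

Let sub_cell k x y : k%:R * d <= x -> y <= k.+1%:R * d ->
  \int[mu]_(z in `]x, y]) `|v z| <= cell_mass k.
Proof.
move=> kx yk; apply: ler_Rintegral_sub => //; first exact: itvoc_sub.
by apply: (@integrableS _ _ _ mu halfline) => //; exact: itvoc_sub_halfline.
Qed.

Lemma slope_osc k x : k%:R * d < x -> x <= k.+1%:R * d ->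
  normc (sg x - sg (k%:R * d)) <= M * cell_mass k + 2 * normc c * (M * MV) * d.
Proof.
move=> kx xk; have x0 : 0 <= x by rewrite (le_trans (nd k))// ltW.
have aS := slope_ac th_ac dth_ac; rewrite (ac_incr aS (nd k) (ltW kx)).
have sub : `](k%:R * d), x] `<=` (`[0, x] : set R) by exact: itvoc_sub_cc.
have i1 := cintegrableS (measurable_itv _) (measurable_itv _) sub (ac_integrable aS x0).
apply: le_trans (normc_cint _ i1) _ => //.
have iV : mu.-integrable `](k%:R * d), x] (EFin \o (fun x => `|v x|)).
  by apply: (@integrableS _ _ _ mu halfline) => //; exact: itvoc_sub_halfline.
have iC : mu.-integrable `](k%:R * d), x] (EFin \o (fun=> 2 * normc c * (M * MV))).
  have ic : cintegrable `](k%:R * d), x] (fun=> (2 * normc c * (M * MV))%:C * 1).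
    by apply: cintegrableZ => //; apply: cintegrableS sub (cintegrable_one x).
  have := cintegrable_normc (measurable_itv _) ic.
  rewrite mulr1 normc_real ger0_norm// !mulr_ge0 ?normc_ge0//; exact: total_mass_ge0.
apply: (@le_trans _ _ (\int[mu]_(y in `](k%:R * d), x]) (M * `|v y| + 2 * normc c * (M * MV)))).
  apply: le_Rintegral => //; first exact: cintegrable_normc.
    by apply: integrable_add => //; exact: integrable_scale.
  move=> y /=; rewrite in_itv/= => /andP[ky _]; have y0 : 0 <= y by rewrite (le_trans (nd k))// ltW.
  apply: le_trans (normcB _ _) _; apply: lerD.
    by rewrite Normc.normcM normc_real mulrC ler_wpM2r//; exact: hM.
  rewrite Normc.normcM [normc (2 * c)]Normc.normcM.
  have -> : normc (2 : R[i]) = 2 by rewrite -[2](rmorph_nat (real_complex R)) normc_real ger0_norm.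
  by rewrite ler_wpM2l ?mulr_ge0 ?normc_ge0//; exact: slope_sup.
rewrite RintegralD//; last exact: integrable_scale.
rewrite RintegralZl//; apply: lerD; first by rewrite ler_wpM2l// sub_cell.
rewrite Rintegral_cst// [fine _](_ : _ = x - k%:R * d); last exact: (congr1 fine (measure_itvoc (ltW kx))).
rewrite ler_wpM2l ?mulr_ge0 ?normc_ge0 ?total_mass_ge0//.
by have := step k; lra.
Qed.

Let cst_int s t (z : R[i]) : 0 <= s -> s <= t ->
  cintegrable `]s, t] (fun=> z) /\ cint `]s, t] (fun=> z) = (t - s)%:C * z.
Proof.
move=> s0 st; have sub : `]s, t] `<=` (`[0, t] : set R) by exact: itvoc_sub_cc.
have ic : cintegrable `]s, t] (fun=> z * 1).
  by apply: cintegrableZ => //; apply: cintegrableS sub (cintegrable_one t).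
rewrite mulr1 in ic; split => //.
rewrite /cint !Rintegral_cst// [fine _](_ : _ = t - s); last exact: (congr1 fine (measure_itvoc st)).
by apply: complexP; rewrite ?ReM ?ImM /= ?mul0r ?subr0 ?addr0 mulrC.
Qed.

Lemma det_error_step k : (k < N)%N -> det_error k <= det_error k.+1 + d * border_error k +
  d * (M * cell_mass k + 2 * normc c * (M * MV) * d).
Proof.
move=> kN; rewrite /det_error edge_tail_detS//.
have aA := amplitude_ac c th_ac; have e1 := ac_incr aA (nd k) (ndS k).
have qB : q k ^+ 2 * B (k%:R * d) = sg (k%:R * d).
  by rewrite slope_flux // /node_phase expr2 (_ : - (2 * c) = - c + - c) ?cEDl//; ring.
have [iz ez] := cst_int (sg (k%:R * d)) (nd k) (ndS k).
rewrite step in ez.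
have sub : `](k%:R * d), (k.+1%:R * d)] `<=` (`[0, k.+1%:R * d] : set R) by exact: itvoc_sub_cc.
have is_ : cintegrable `](k%:R * d), (k.+1%:R * d)] sg.
  by apply: cintegrableS sub (ac_integrable aA (nd k.+1)).
have iB := cintegrableB (measurable_itv _) is_ iz.
have E : edge_tail_det k.+1 + d%:C * q k ^+ 2 * edge_tail_border k - A (k%:R * d) =
  (edge_tail_det k.+1 - A (k.+1%:R * d)) + d%:C * (q k ^+ 2 * (edge_tail_border k + B (k%:R * d))) +
  cint `](k%:R * d), (k.+1%:R * d)] (fun x => sg x - sg (k%:R * d)).
  rewrite cintB// -e1 ez -qB; ring.
rewrite E; apply: le_trans (normcD _ _) _; apply: lerD.
  apply: le_trans (normcD _ _) _; rewrite lerD2l Normc.normcM normc_real ger0_norm ?(ltW d0)//.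
apply: le_trans (normc_cint _ iB) _ => //.
have <- : (M * cell_mass k + 2 * normc c * (M * MV) * d) * (k.+1%:R * d - k%:R * d) =
  d * (M * cell_mass k + 2 * normc c * (M * MV) * d) by rewrite step mulrC.
apply: integral_le_cst => //; first exact: cintegrable_normc.
by move=> x; exact: slope_osc.
Qed.

Lemma normc_cE2 x : normc (cE (2 * c) x) = expR (- b * x).
Proof.
rewrite (_ : 2 * c = c + c) ?cEDl//; last by ring.
by rewrite Normc.normcM !normc_cE -expRD; congr expR; rewrite /b; ring.
Qed.

Lemma normc_sqr_phase k : normc (q k ^+ 2) = expR (b * (k%:R * d)).
Proof.
by rewrite expr2 Normc.normcM /node_phase !normc_cE -expRD; congr expR; rewrite ReN /b; ring.
Qed.

Lemma border_error_step k : (k < N)%N -> border_error k <=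
  expR (- b * d) * border_error k.+1 + cell_mass k * det_error k.+1 + cell_mass k * (M * MV * d).
Proof.
move=> kN; rewrite /border_error edge_tail_borderS//.
set s := k%:R * d; set t := k.+1%:R * d.
have s0 : 0 <= s := nd k; have st : s <= t := ndS k; have t0 := le_trans s0 st.
have sub : `]s, t] `<=` (`[0, t] : set R) by exact: itvoc_sub_cc.
have subh : `]s, t] `<=` (halfline : set R) by exact: itvoc_sub_halfline.
have aB := flux_ac th_ac dth_ac; have e1 := ac_incr aB s0 st.
have hc2 : Re (2 * c) < 0.
  by rewrite (_ : Re (2 * c) = Re c + Re c) -?ReD; [move: hc; lra|congr complex.Re; ring].
have [_ iEv] := decaying_integrable hc2 iv.
have iEv' : cintegrable `]s, t] (fun x => cE (2 * c) x * (v x)%:C) by apply: cintegrableS iEv.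
have iEt : cintegrable `[0, t] (fun x => cE (2 * c) x * (v x)%:C).
  by apply: cintegrableS iEv => //; exact: itvcc_sub_halfline.
have e2 : jump c v s - jump c v t = cint `]s, t] (fun x => cE (2 * c) x * (v x)%:C).
  by rewrite /jump -!cint_tail// -cint_incr//; ring.
have iB : cintegrable `]s, t] (fun x => cE (2 * c) x * ((v x)%:C * A x)).
  by apply: cintegrableS sub (ac_integrable aB t0).
have E : edge_tail_border k.+1 + (jump c v s - jump c v t) * edge_tail_det k.+1 + B s =
  (edge_tail_border k.+1 + B t) + (jump c v s - jump c v t) * (edge_tail_det k.+1 - A t) +
  cint `]s, t] (fun x => (A t - A x) * (cE (2 * c) x * (v x)%:C)).
  have -> : cint `]s, t] (fun x => (A t - A x) * (cE (2 * c) x * (v x)%:C)) =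
      A t * (jump c v s - jump c v t) - (B t - B s).
    rewrite e1 e2 -cintZ// -cintB//; last exact: cintegrableZ.
    by apply: eq_cint => x _; ring.
  ring.
rewrite E.
have mE x : `]s, t]%classic x -> normc (cE (2 * c) x * (v x)%:C) <= expR (- b * s) * `|v x|.
  rewrite /= in_itv/= => /andP[sx _]; rewrite Normc.normcM normc_real ler_wpM2r// normc_cE2 ler_expR.
  by apply: ler_wnM2l; [rewrite oppr_le0 ltW|exact: ltW].
have iV : mu.-integrable `]s, t] (EFin \o (fun x => `|v x|)) by apply: (@integrableS _ _ _ mu halfline).
have nW : \int[mu]_(x in `]s, t]) normc (cE (2 * c) x * (v x)%:C) <= expR (- b * s) * cell_mass k.
  rewrite /cell_mass -RintegralZl//; apply: le_Rintegral => //.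
  - exact: cintegrable_normc.
  - exact: integrable_scale.
have nJ : normc (jump c v s - jump c v t) <= expR (- b * s) * cell_mass k.
  by rewrite e2; apply: le_trans (normc_cint _ iEv') nW.
have nI : normc (cint `]s, t] (fun x => (A t - A x) * (cE (2 * c) x * (v x)%:C))) <=
    (M * MV * d) * (expR (- b * s) * cell_mass k).
  apply: le_trans (normc_cintM (C := M * MV * d) _ _ _ iEv') _ => //.
  - apply: cmeasurableB => //.
    by apply: cmeasurableS (ac_cmeasurable (amplitude_ac c th_ac) t0).
  - move=> x /=; rewrite in_itv/= => /andP[sx xt]; have x0 : 0 <= x by rewrite (le_trans s0)// ltW.
    apply: le_trans (amplitude_osc x0 xt) _.
    rewrite ler_wpM2l ?mulr_ge0 ?total_mass_ge0//; have := step k; rewrite -/s -/t; lra.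
  rewrite ler_wpM2l// !mulr_ge0 ?total_mass_ge0// ltW//.
have qq : normc (q k ^+ 2) * expR (- b * s) = 1.
  by rewrite normc_sqr_phase -/s -expRD (_ : b * s + - b * s = 0) ?expR0//; ring.
have q1 : normc (q k ^+ 2) = expR (- b * d) * normc (q k.+1 ^+ 2).
  by rewrite !normc_sqr_phase -expRD; congr expR; rewrite -natr1; ring.
have p0 := normc_ge0 (q k ^+ 2); have m0 := cell_mass_ge0 k.
rewrite Normc.normcM.
apply: (@le_trans _ _ (normc (q k ^+ 2) * (normc (edge_tail_border k.+1 + B t) +
   expR (- b * s) * cell_mass k * det_error k.+1 + (M * MV * d) * (expR (- b * s) * cell_mass k)))).
  rewrite ler_wpM2l//; apply: le_trans (normcD _ _) _; apply: lerD => //.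
  apply: le_trans (normcD _ _) _; rewrite lerD2l Normc.normcM /det_error -/t ler_wpM2r ?normc_ge0//.
have -> : normc (q k ^+ 2) * (normc (edge_tail_border k.+1 + B t) +
   expR (- b * s) * cell_mass k * det_error k.+1 + (M * MV * d) * (expR (- b * s) * cell_mass k)) =
   normc (q k ^+ 2) * normc (edge_tail_border k.+1 + B t) +
   (normc (q k ^+ 2) * expR (- b * s)) * (cell_mass k * det_error k.+1 + cell_mass k * (M * MV * d)) by ring.
rewrite qq mul1r q1 (Normc.normcM (q k.+1 ^+ 2)); lra.
Qed.

Lemma terminal_error : det_error N = normc (1 - A (N%:R * d)) /\
  border_error N <= (1 + M) * tail_mass v (N%:R * d).
Proof.
rewrite /det_error /border_error /edge_tail_det /edge_tail_border subnn edge_det0 edge_border0; split => //.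
have hc2 : Re (2 * c) < 0.
  by rewrite (_ : Re (2 * c) = Re c + Re c) -?ReD; [move: hc; lra|congr complex.Re; ring].
have q2 : q N ^+ 2 = cE (- (2 * c)) (N%:R * d).
  by rewrite /node_phase expr2 (_ : - (2 * c) = - c + - c) ?cEDl//; ring.
rewrite mulrDr q2 -slope_flux; apply: le_trans (normcD _ _) _; rewrite [leRHS]mulrDl mul1r; apply: lerD.
  rewrite /jump -tail_transformE//; last exact: decaying_integrable.
  apply: le_trans (normc_tail_transform_le hc2 iv (nd N)) _.
  by under eq_Rintegral do rewrite normc_real.
exact: slope_bound.
Qed.

Lemma edge_error : det_error 0 + b^-1 * border_error 0 <=
  expR ((b^-1 + 1) * MV) *
  (normc (1 - A (N%:R * d)) + b^-1 * ((1 + M) * tail_mass v (N%:R * d)) +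
   d * (((b^-1 + 1) * (M * MV) + M) * MV + 2 * normc c * (M * MV) * (N%:R * d))).
Proof.
pose al := b^-1; have al0 : 0 < al by rewrite invr_gt0.
have MM0 : 0 <= M * MV by rewrite mulr_ge0 ?total_mass_ge0.
pose x k := det_error k + al * border_error k.
pose a k := (al + 1) * cell_mass k.
pose e k := d * (((al + 1) * (M * MV) + M) * cell_mass k + 2 * normc c * (M * MV) * d).
have a0 k : 0 <= a k by rewrite mulr_ge0 ?cell_mass_ge0// addr_ge0 ?(ltW al0).
have e0 k : 0 <= e k.
  apply: mulr_ge0; first exact: ltW.
  apply: addr_ge0; last by rewrite mulr_ge0 ?(ltW d0)// mulr_ge0// mulr_ge0 ?normc_ge0.
  by rewrite mulr_ge0 ?cell_mass_ge0// addr_ge0// mulr_ge0// addr_ge0 ?(ltW al0).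
have x0 k : 0 <= x k by rewrite addr_ge0 ?normc_ge0// mulr_ge0 ?normc_ge0 ?(ltW al0).
have hx k : (k < N)%N -> x k <= (1 + a k) * x k.+1 + e k.
  move=> kN; have h1 := det_error_step kN; have h2 := border_error_step kN.
  have m0 := cell_mass_ge0 k; have r0 : 0 <= border_error k.+1 := normc_ge0 _.
  have de0 : 0 <= det_error k.+1 := normc_ge0 _.
  have hE : (d + al) * expR (- b * d) <= al.
    have : expR (- b * d) <= (1 + b * d)^-1.
      rewrite mulNr expRN lef_pV2 ?posrE ?expR_gt0//; first exact: expR_ge1Dx.
      by rewrite ltr_wpDr// mulr_ge0 ?(ltW b0)// ltW.
    move=> h; apply: (@le_trans _ _ ((d + al) * (1 + b * d)^-1)).
      by rewrite ler_wpM2l// addr_ge0 ?(ltW al0)// ltW.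
    have bd : 0 < 1 + b * d by rewrite ltr_wpDr// mulr_ge0 ?(ltW b0)// ltW.
    rewrite ler_pdivrMr// mulrDr mulr1 mulrA mulVf ?gt_eqF// mul1r; lra.
  have h3 : (d + al) * border_error k <= al * border_error k.+1 +
     (al + 1) * (cell_mass k * det_error k.+1 + cell_mass k * (M * MV * d)).
    apply: (@le_trans _ _ ((d + al) * (expR (- b * d) * border_error k.+1 + cell_mass k * det_error k.+1 + cell_mass k * (M * MV * d)))).
      by rewrite ler_wpM2l// addr_ge0 ?(ltW al0)// ltW.
    have u1 : 0 <= cell_mass k * det_error k.+1 by rewrite mulr_ge0.
    have u2 : 0 <= cell_mass k * (M * MV * d) by rewrite mulr_ge0// mulr_ge0// ltW.
    have h4 : ((d + al) * expR (- b * d)) * border_error k.+1 <= al * border_error k.+1 by rewrite ler_wpM2r.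
    have h5 : d * (cell_mass k * det_error k.+1 + cell_mass k * (M * MV * d)) <=
      cell_mass k * det_error k.+1 + cell_mass k * (M * MV * d) by rewrite ler_piMl// addr_ge0.
    lra.
  have u3 : 0 <= (al + 1) * cell_mass k * (al * border_error k.+1).
    by rewrite !mulr_ge0 ?addr_ge0 ?(ltW al0).
  rewrite /x /a /e; lra.
have h := discrete_gronwall a0 e0 x0 hx.
apply: le_trans h _; rewrite -mulr_sumr.
have [t1 t2] := terminal_error; have ms := cell_mass_sum.
have ms0 : 0 <= \sum_(k < N) cell_mass k by apply: sumr_ge0 => k _; exact: cell_mass_ge0.
apply: ler_pM; rewrite ?expR_ge0//.
- by rewrite addr_ge0// sumr_ge0.
- by rewrite ler_expR ler_wpM2l// addr_ge0 ?(ltW al0).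
apply: lerD; first by rewrite /x t1 lerD2l ler_wpM2l// ltW.
rewrite /e -mulr_sumr ler_wpM2l ?(ltW d0)// big_split/= -mulr_sumr sumr_const card_ord -mulr_natl; apply: lerD.
  by rewrite ler_wpM2l// addr_ge0// mulr_ge0// addr_ge0 ?(ltW al0).
rewrite le_eqVlt; apply/orP; left; apply/eqP; ring.
Qed.

End JostDiscretization.

Section EdgeLimit.
Context {R : realType}.
Local Notation mu := (@lebesgue_measure R).
Variable v : R -> R.
Hypothesis hv : mu.-integrable halfline (EFin \o v).
Variable c : R[i].
Hypothesis hc : Re c < 0.
Variables th dth : R -> R[i].
Hypothesis th_ac : ac_deriv th dth.
Hypothesis dth_ac : ac_deriv dth (fun x => ((v x)%:C + c ^+ 2) * th x).
Hypothesis th_lim : (fun x : R => th x / cE c x) x @[x --> +oo] --> (1 : R[i]).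
Variables (L : nat -> nat) (K : R).
Hypothesis Lge : forall m, (m <= L m)%N.
Hypothesis Ltail : forall m, tail_mass v (L m)%:R <= K * 4 ^- m.
Local Notation d m := (@mesh R L m).
Local Notation jumps m := (fun i => jump c v (i%:R * d m)).

Lemma cvg_geometric0 (a : R) : a * 4 ^- m @[m --> \oo] --> (0 : R).
Proof.
rewrite -(mulr0 a); apply: cvgM; first exact: cvg_cst.
under eq_fun do rewrite -exprVn; apply: cvg_expr.
by rewrite ger0_norm ?invr_ge0// invf_lt1// ltr1n.
Qed.

Lemma edge_limit :
  edge_det (d m)%:C (node_phase c (d m)) (jumps m) 0 (nodes L m) @[m --> \oo] --> th 0 /\
  edge_border (d m)%:C (node_phase c (d m)) (jumps m) (jumps m 0) 0 (nodes L m) @[m --> \oo] -->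
    - (dth 0 - c * th 0).
Proof.
have [M M0 hM] := amplitude_bounded th_ac th_lim.
have mesh1 m : d m <= 1.
  by rewrite (le_trans (mesh_le (R := R) L m))// invf_le1 ?exprn_gt0// exprn_ege1// ler1n.
pose b := - (2 * Re c); have b0 : 0 < b by rewrite oppr_gt0 pmulr_rlt0.
have MV0 : 0 <= total_mass v := total_mass_ge0 v.
pose C1 := ((b^-1 + 1) * (M * total_mass v) + M) * total_mass v.
pose C2 := 2 * normc c * (M * total_mass v).
have C10 : 0 <= C1.
  apply: mulr_ge0 => //; apply: addr_ge0 => //; apply: mulr_ge0; last exact: mulr_ge0.
  by rewrite addr_ge0// invr_ge0 ltW.
have C20 : 0 <= C2 by rewrite !mulr_ge0 ?normc_ge0.
pose e m := expR ((b^-1 + 1) * total_mass v) *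
  (normc (amplitude c th (L m)%:R - 1) + (b^-1 * ((1 + M) * K) + (C1 + C2)) * 4 ^- m).
have err m : det_error v c th (d m) (nodes L m) 0 +
    b^-1 * border_error v c th dth (d m) (nodes L m) 0 <= e m.
  have dp := mesh_gt0 (R := R) L m.
  apply: le_trans (edge_error hv hc th_ac dth_ac M0 hM (nodes L m) dp (mesh1 m)) _.
  rewrite -/b /e nodesE ler_wpM2l ?expR_ge0// normc_distC -addrA lerD2l [leRHS]mulrDl; apply: lerD.
    rewrite -!mulrA ler_wpM2l ?invr_ge0 ?(ltW b0)// ler_wpM2l ?addr_ge0//; exact: Ltail.
  rewrite -/C1 -/C2; apply: (@le_trans _ _ ((C1 + C2) * (d m * ((L m)%:R + 1)))).
    have L0 : 0 <= (L m)%:R :> R by [].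
    rewrite -subr_ge0; have -> : (C1 + C2) * (d m * ((L m)%:R + 1)) - d m * (C1 + C2 * (L m)%:R) =
      d m * (C1 * (L m)%:R + C2) by ring.
    by rewrite mulr_ge0 ?(ltW dp)// addr_ge0// mulr_ge0.
  by rewrite ler_wpM2l ?addr_ge0//; exact: mesh_length_le.
have amp0 : normc (amplitude c th (L m)%:R - 1) @[m --> \oo] --> (0 : R).
  apply/cvgrPdist_le => eps eps0; have [X X0 hX] := amplitude_limit th_lim eps0.
  exists (Num.trunc X).+1 => // m /= Xm; rewrite sub0r normrN ger0_norm ?normc_ge0//.
  apply: hX; apply: (@le_trans _ _ ((Num.trunc X).+1)%:R); first exact: ltW (truncnS_gt X).
  by rewrite ler_nat (leq_trans Xm).
have e0 : e m @[m --> \oo] --> (0 : R).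
  rewrite -(mulr0 (expR ((b^-1 + 1) * total_mass v))); apply: cvgM; first exact: cvg_cst.
  by rewrite -[X in _ --> X]addr0; apply: cvgD => //; exact: cvg_geometric0.
have det0 m : 0 <= det_error v c th (d m) (nodes L m) 0 := normc_ge0 _.
have bor0 m : 0 <= border_error v c th dth (d m) (nodes L m) 0 := normc_ge0 _.
split; apply/cvgC_normc.
  apply: (@squeeze_cvgr _ _ _ _ (fun=> 0) e) => //; last exact: cvg_cst.
  apply: nearW => m; rewrite normc_ge0/=; apply: le_trans (err m).
  rewrite -[leLHS]addr0; apply: lerD; last by rewrite mulr_ge0// invr_ge0 ltW.
  by rewrite /det_error /edge_tail_det subn0 mul0r /amplitude cE0 mul1r.
apply: (@squeeze_cvgr _ _ _ _ (fun=> 0) (fun m => b * e m)) => //; last 2 first.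
- exact: cvg_cst.
- by rewrite -(mulr0 b); apply: cvgM => //; exact: cvg_cst.
apply: nearW => m; rewrite normc_ge0/= opprK.
have -> : normc (edge_border (d m)%:C (node_phase c (d m)) (jumps m) (jumps m 0%N) 0 (nodes L m) + (dth 0 - c * th 0)) =
    border_error v c th dth (d m) (nodes L m) 0.
  rewrite /border_error /edge_tail_border subn0 node_phase0 expr1n mul1r mul0r.
  by rewrite /flux /incoming cE0 mul1r.
rewrite mulrC -ler_pdivrMr// mulrC; apply: le_trans (err m).
by rewrite lerDr.
Qed.

End EdgeLimit.

Section JostAlgebra.
Context {R : realType} {n : nat}.

Lemma jost_KwE (theta dtheta : 'I_n -> R -> R[i]) :
  jost_Kw theta dtheta = \sum_(j < n) dtheta j 0 * \prod_(k < n | k != j) theta k 0.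
Proof.
rewrite /jost_Kw; case: ifP => // /forallP h.
rewrite /jost_K mulr_suml; apply: eq_bigr => j _; rewrite (bigD1 j)//= /jost_w.
by rewrite mulrA divfK//; exact: h.
Qed.

Lemma cvg_total (D S : nat -> 'I_n -> R[i]) (D0 S0 : 'I_n -> R[i]) (w : R[i]) :
  (forall j, D m j @[m --> \oo] --> D0 j) -> (forall j, S m j @[m --> \oo] --> S0 j) ->
  (fun m => \prod_j D m j + w * \sum_j S m j * \prod_(k | k != j) D m k : R[i]) @ \oo -->
  (\prod_j D0 j + w * \sum_j S0 j * \prod_(k | k != j) D0 k : R[i]).
Proof.
move=> hD hS.
have h2 j : (fun m => \prod_(k | k != j) D m k : R[i]) @ \oo --> (\prod_(k | k != j) D0 k : R[i]).
  rewrite -[X in _ --> X]big_filter; under eq_fun do rewrite -big_filter.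
  exact: (@cvgC_prod R _ _ D D0 hD).
have h3 j : (fun m => S m j * \prod_(k | k != j) D m k : R[i]) @ \oo --> (S0 j * \prod_(k | k != j) D0 k : R[i]).
  by apply: (@cvgM R[i]); [exact: hS|exact: h2].
have h4 := @cvgC_sum R _ (index_enum 'I_n) _ _ h3.
have h5 : (fun m => w * \sum_j S m j * \prod_(k | k != j) D m k : R[i]) @ \oo -->
    (w * \sum_j S0 j * \prod_(k | k != j) D0 k : R[i]).
  by apply: (@cvgM R[i]); [exact: cvg_cst|exact: h4].
by apply: cvgD; [exact: (@cvgC_prod R _ (index_enum 'I_n) D D0 hD)|exact: h5].
Qed.

End JostAlgebra.

Theorem corollary3p1 (R : realType) (n : nat) (hn : (2 <= n)%N)
  (V : 'I_n -> R -> R)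
  (hV : forall j, (@lebesgue_measure R).-integrable halfline (EFin \o V j))
  (z zeta : R[i]) (hz : resolvent_set V z)
  (hzeta : zeta ^+ 2 = z) (hIm : 0 < complex.Im zeta)
  (theta dtheta : 'I_n -> R -> R[i])
  (htheta : forall j, jost_solution (V j) zeta (theta j) (dtheta j)) :
  perturbation_det V z (jost_Kw theta dtheta / ((0 +i* 1) * n%:R * zeta)).
Proof.
pose c : R[i] := (0 +i* 1) * zeta.
have hn0 : (0 < n)%N by exact: ltnW.
have hc : Re c < 0 by rewrite /c ReM /= mul0r sub0r mul1r oppr_lt0.
have i2 : (0 +i* 1) * (0 +i* 1) = -1 :> R[i].
  by apply: complexP; rewrite ?ReM ?ImM /= ?ReN ?ImN /=; ring.
have zE : z = - c ^+ 2 by rewrite -hzeta /c exprMn [(0 +i* 1) ^+ 2]expr2 i2; ring.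
have c2E : c ^+ 2 = - zeta ^+ 2 by rewrite /c exprMn [(0 +i* 1) ^+ 2]expr2 i2; ring.
have c0 : c != 0 by apply/eqP => h; move: hc; rewrite h ltxx.
have n0 : n%:R != 0 :> R[i] by rewrite pnatr_eq0 -lt0n.
have zn (s : R) : 0 <= s -> - c ^+ 2 != s%:C.
  move=> s0; apply/eqP; rewrite c2E opprK => h.
  have hre : Re zeta * Re zeta - Im zeta * Im zeta = s by rewrite -ReM -expr2 h.
  have him : Re zeta * Im zeta + Im zeta * Re zeta = 0 by rewrite -ImM -expr2 h.
  have : Re zeta * Im zeta = 0 by lra.
  move=> /eqP; rewrite mulf_eq0 (gt_eqF hIm) orbF => /eqP r0.
  by move: hre; rewrite r0; nra.
split.
  rewrite zE; split; first by move=> psi; exact: resolvent0_unique zn.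
  have [M M0 hM] := @green_bounded R n c hc.
  exists M => f hf; exists (green c f); [exact: green_resolvent|exact: hM].
exists (birman V c).
  split; first exact: birman_bounded_operator.
  move=> phi hphi hVphi; exists (green c (mul_sqrt_abs V phi)).
    by rewrite zE; exact: green_resolvent.
  by move=> j; apply: (@aeW _ (measurableTypeR R) _ (@lebesgue_measure R)).
have [L [K [K0 L0 Lmono Lge Ltail]]] := exists_grid hV.
pose d m := @mesh R L m.
apply: (@birman_fredholm R n V hV c hc L K K0 L0 Lmono Ltail _
  (fun m => total_left V c (d m) (N := nodes L m))
  (fun m => total_right V c (d m) (N := nodes L m))).
- by move=> m nu; exact: L2_total.
- move=> m u hu; rewrite rank1_total//; exact: mesh_gt0.
pose D m j : R[i] := edge_det (d m)%:C (node_phase c (d m)) (node_jump V c (d m) j) 0 (nodes L m).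
pose S m j : R[i] := edge_border (d m)%:C (node_phase c (d m)) (node_jump V c (d m) j)
  (node_jump V c (d m) j 0) 0 (nodes L m).
have lim j : D m j @[m --> \oo] --> theta j 0 /\ S m j @[m --> \oo] --> - (dtheta j 0 - c * theta j 0).
  have [h1 h2 h3] := htheta j.
  apply: (edge_limit (hV j) hc h1 _ _ Lge (fun m => Ltail m j)).
    by apply: eq_ac_deriv h2 => x x0 //; rewrite c2E.
  rewrite (_ : (fun x => theta j x / cE c x) = fun x => theta j x / cexp ((0 +i* 1) * x%:C * zeta))//.
  by apply/funext => x; rewrite /cE /c mulrAC.
rewrite (_ : (fun m => gram_det _ _) = fun m => \prod_j D m j +
    @star_weight R n c * \sum_j S m j * \prod_(k | k != j) D m k); last first.
  by apply/funext => m; rewrite gram_det_total//; exact: mesh_gt0.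
have -> : jost_Kw theta dtheta / ((0 +i* 1) * n%:R * zeta) =
    \prod_j theta j 0 + @star_weight R n c *
      \sum_j - (dtheta j 0 - c * theta j 0) * \prod_(k | k != j) theta k 0.
  have -> : \sum_j - (dtheta j 0 - c * theta j 0) * \prod_(k | k != j) theta k 0 =
      n%:R * c * \prod_j theta j 0 - jost_Kw theta dtheta.
    rewrite jost_KwE -sumrN.
    have -> : n%:R * c * \prod_j theta j 0 = \sum_(j < n) c * \prod_j theta j 0.
      by rewrite sumr_const card_ord -mulrA mulr_natl.
    rewrite -big_split/=; apply: eq_bigr => j _; rewrite [\prod_j theta j 0](bigD1 j)//=.
    by move: (\prod_(k | k != j) _) => P; ring.
  have -> : (0 +i* 1) * n%:R * zeta = n%:R * c by rewrite /c; ring.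
  rewrite /star_weight; move: (jost_Kw _ _) (\prod_j _) => J P.
  by field; rewrite c0 n0.
exact: (@cvg_total R n D S (fun j => theta j 0) (fun j => - (dtheta j 0 - c * theta j 0))
  (star_weight c) (fun j => proj1 (lim j)) (fun j => proj2 (lim j))).
Qed.
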